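(* Let $g\ge 1$, let $k,\ell\ge0$, and let $\lambda,\mu$ be Young diagrams with $k+2$ and $\ell+2$ boxes respectively. Let $\widetilde H_\lambda\subset\mathfrak h_{g,1}(k)$ be the $\lambda$-isotypical component of $\mathfrak h_{g,1}(k)$ and $\widetilde H_\mu\subset\mathfrak h_{g,1}(\ell)$ the $\mu$-isotypical component of $\mathfrak h_{g,1}(\ell)$. (i) The bracket $[\widetilde H_\lambda,\widetilde H_\mu]$ is included in the $\mathrm{GL}$-submodule $$B(\lambda,\mu)=\bigoplus_{\nu\text{ satisfies }(C)}\widetilde H_\nu\subset\mathfrak h_{g,1}(k+\ell),$$ where $\nu$ runs over Young diagrams with $k+\ell+2$ boxes and condition (C) is: $\lambda_{\mathrm{GL}}\otimes\mu_{\mathrm{GL}}$ and $\wedge^2H_{\mathbb Q}\otimes\nu_{\mathrm{GL}}$ have a common $\mathrm{GL}$-irreducible summand. In particular, the height of such a $\nu$ must satisfy $$\max\{h(\lambda),h(\mu)\}-2\le h(\nu)\le h(\lambda)+h(\mu).$$ (ii) The $\mathrm{Sp}$-invariant part $[\widetilde H_\lambda,\widetilde H_\mu]^{\mathrm{Sp}}$ is included in the submodule $$S(\lambda,\mu)=\bigoplus_{\nu\text{ satisfies }(S)}H_\nu\subset\mathfrak h_{g,1}(k+\ell)^{\mathrm{Sp}},$$ where $\nu$ runs over Young diagrams with $2|\nu|=k+\ell+2$ and condition (S) is: $\lambda_{\mathrm{GL}}\otimes\mu_{\mathrm{GL}}$ and $\wedge^2H_{\mathbb Q}\otimes\nu^\delta_{\mathrm{GL}}$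 have a common $\mathrm{GL}$-irreducible summand. In particular, the $\nu$-coordinate of any element of $[\widetilde H_\lambda,\widetilde H_\mu]^{\mathrm{Sp}}$ vanishes for all $\nu$ such that $2h(\nu)>h(\lambda)+h(\mu)$ or $2h(\nu)<\max\{h(\lambda),h(\mu)\}-2$.
   Context: $H_{\mathbb Q}$ is the first rational homology of a compact oriented genus $g$ surface with one boundary component, with its intersection form; it is the standard representation of $\mathrm{Sp}=\mathrm{Sp}(2g,\mathbb Q)$ and of $\mathrm{GL}=\mathrm{GL}(2g,\mathbb Q)$. $\mathcal L_{g,1}=\bigoplus_{k\ge1}\mathcal L_{g,1}(k)$ is the free graded Lie algebra on $H_{\mathbb Q}$, with $\mathcal L_{g,1}(k)\subset H_{\mathbb Q}^{\otimes k}$ via $[u,v]=u\otimes v-v\otimes u$. $\mathfrak h_{g,1}$ is the graded Lie algebra of symplectic derivations of $\mathcal L_{g,1}$ (those killing the symplectic element), with the commutator bracket of derivations; its degree $k$ part is identified, using Poincaré duality $H_{\mathbb Q}^*\cong H_{\mathbb Q}$, with $$\mathfrak h_{g,1}(k)=\mathrm{Ker}\big(H_{\mathbb Q}\otimes\mathcal L_{g,1}(k+1)\xrightarrow{[\ ,\ ]}\mathcal L_{g,1}(k+2)\big)\subset H_{\mathbb Q}^{\otimes(k+2)},$$ which is a $\mathrm{GL}$-submodule (the bracket of $\mathfrak h_{g,1}$ is $\mathrm{Sp}$-equivariant but not $\mathrm{GL}$-equivariant). $[A,B]$ denotes the span of brackets of elements of $A$ and $B$; the superscript $\mathrm{Sp}$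 denotes the $\mathrm{Sp}$-invariant part. For a Young diagram $\lambda=[\lambda_1\cdots\lambda_h]$: $|\lambda|$ is the number of boxes, $h(\lambda)=h$ the number of rows, $\lambda_{\mathrm{GL}}$ the corresponding irreducible $\mathrm{GL}$-representation, and $\lambda^\delta=[\lambda_1\lambda_1\cdots\lambda_h\lambda_h]$. $V^n_\lambda\subset H_{\mathbb Q}^{\otimes n}$ ($|\lambda|=n$) is the $\mathrm{GL}$-isotypical component of type $\lambda$. For $|\lambda|=k+2$, $\widetilde H_\lambda=V^{k+2}_\lambda\cap\mathfrak h_{g,1}(k)$, so $\mathfrak h_{g,1}(k)=\bigoplus_{|\lambda|=k+2}\widetilde H_\lambda$. For $|\nu|=m+1$, $H_\nu=\widetilde H_{\nu^\delta}^{\mathrm{Sp}}\subset\mathfrak h_{g,1}(2m)^{\mathrm{Sp}}$; one has $\mathfrak h_{g,1}(2m)^{\mathrm{Sp}}=\bigoplus_{|\nu|=m+1,\,h(\nu)\le g}H_\nu$, and the $\nu$-coordinate of an element of $\mathfrak h_{g,1}(2m)^{\mathrm{Sp}}$ is its component in $H_\nu$. *)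

(* Defs.v *)
From HB Require Import structures.
From mathcomp Require Import all_boot all_order all_algebra all_fingroup.
From mathcomp Require Import finmap monalg.

Set Implicit Arguments.
Unset Strict Implicit.
Unset Printing Implicit Defensive.

Import GRing.Theory.
Local Open Scope ring_scope.

(* The tensor algebra of H = Q^d, as the free associative algebra on the       *)
(* letters 'I_d: the word [:: i1; ..; in] is e_i1 (x) .. (x) e_in, and the     *)
(* product is the tensor product.  All representations of GL_d below are       *)
(* realised as subspaces (predicates) of this algebra.                         *)
Notation tensor d := {malg rat[{fmonom 'I_d}]}.

Section Tensors.
Context (d : nat).
Implicit Types (x y u v : tensor d) (U W A B : tensor d -> Prop).

Definition word (s : seq 'I_d) : tensor d := << FMonom s >>.

Definition gen (i : 'I_d) : tensor d := word [:: i].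

(* The linear extension of a map given on words. *)
Definition linext (f : seq 'I_d -> tensor d) x : tensor d :=
  \sum_(w <- msupp x) x@_w *: f w.

(* homog n is the subspace H^{(x) n}; in particular homog 1 is H. *)
Definition homog (n : nat) x : Prop := forall w, w \in msupp x -> size w = n.

Definition lie u v : tensor d := u * v - v * u.

Definition subspace U : Prop :=
  U 0 /\ forall (a : rat) x y, U x -> U y -> U (a *: x + y).

Definition span U x : Prop :=
  exists s : seq (rat * tensor d),
    (forall p, p \in s -> U p.2) /\ x = \sum_(p <- s) p.1 *: p.2.

(* Since H^{(x) m} (x) H^{(x) n} = H^{(x) (m + n)}, for subspaces A and B of   *)
(* homogeneous tensors this is the tensor product of A and B.                  *)
Definition tens A B : tensor d -> Prop :=
  span (fun z => exists u v, [/\ A u, B v & z = u * v]).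

Definition ext2 : tensor d -> Prop :=
  span (fun z => exists u v, [/\ homog 1 u, homog 1 v & z = u * v - v * u]).

Inductive free_lie : tensor d -> Prop :=
| FreeLieGen i : free_lie (gen i)
| FreeLieLin (a : rat) x y : free_lie x -> free_lie y -> free_lie (a *: x + y)
| FreeLieBr x y : free_lie x -> free_lie y -> free_lie (lie x y).

Definition lie_deg (n : nat) x : Prop := free_lie x /\ homog n x.

(* The standard representation sends e_i to the i-th column of M. *)
Definition gl_act (M : 'M[rat]_d) : tensor d -> tensor d :=
  linext (fun w => \prod_(i <- w) \sum_(j < d) M j i *: gen j).

Definition gl_submod U : Prop :=
  subspace U /\ forall M, M \in unitmx -> forall x, U x -> U (gl_act M x).

Definition gl_iso U W : Prop :=
  exists f : tensor d -> tensor d,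
    [/\ forall (a : rat) x y, U x -> U y -> f (a *: x + y) = a *: f x + f y,
        forall M, M \in unitmx -> forall x, U x -> f (gl_act M x) = gl_act M (f x),
        forall x, U x -> W (f x),
        forall x, U x -> f x = 0 -> x = 0
      & forall y, W y -> exists2 x, U x & f x = y].

Definition irreducible U : Prop :=
  [/\ gl_submod U, exists2 x, U x & x <> 0
    & forall W, gl_submod W -> (forall x, W x -> U x) ->
        (forall x, W x -> x = 0) \/ (forall x, U x -> W x)].

Definition summand W U : Prop :=
  [/\ gl_submod W, forall x, W x -> U x
    & exists2 C, gl_submod C
      & [/\ forall x, C x -> U x,
            forall x, U x -> exists u v, [/\ W u, C v & x = u + v]
          & forall x, W x -> C x -> x = 0]].

Definition common_irreducible_summand A B : Prop :=
  exists U W, [/\ irreducible U, summand U A, summand W B & gl_iso U W].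

(* The derivation of the tensor algebra with value f i on e_i. *)
Definition der (f : 'I_d -> tensor d) : tensor d -> tensor d :=
  linext (fun w => \sum_(p < size w)
    word (take p w) * f (tnth (in_tuple w) p) * word (drop p.+1 w)).

(* u (x) xi |-> [u, xi] for u in H. *)
Definition bracket_map : tensor d -> tensor d :=
  linext (fun w => if w is i :: w' then lie (gen i) (word w') else 0).

End Tensors.

(* A Young diagram is the decreasing sequence of its (positive) row lengths:   *)
(* |lam| is sumn lam and h(lam) is size lam.                                   *)
Definition young_diagram (lam : seq nat) : bool :=
  sorted geq lam && (0 \notin lam).

Definition ydelta (lam : seq nat) : seq nat := flatten [seq [:: r; r] | r <- lam].

(* Row and column groups of the tableau of shape lam whose boxes are numbered  *)
(* 0, 1, 2, .. along the successive rows.                                      *)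
Definition row_group (lam : seq nat) : {set 'S_(sumn lam)} :=
  [set s : 'S_(sumn lam) | [forall p, reshape_index lam (s p) == reshape_index lam p]].

Definition col_group (lam : seq nat) : {set 'S_(sumn lam)} :=
  [set s : 'S_(sumn lam) | [forall p, reshape_offset lam (s p) == reshape_offset lam p]].

Section Schur.
Context (d : nat).

(* The Young symmetrizer, S_n acting by place permutations. *)
Definition young_sym (lam : seq nat) (w : (sumn lam).-tuple 'I_d) : tensor d :=
  \sum_(a in row_group lam) \sum_(b in col_group lam)
    (-1) ^+ odd_perm b *: word [seq tnth w ((a * b)%g p) | p : 'I_(sumn lam)].

(* lam_GL as a submodule of H^{(x) |lam|}; it is 0 when h(lam) > d. *)
Definition schur (lam : seq nat) : tensor d -> Prop :=
  span (fun z => exists w, z = @young_sym lam w).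

Definition isotypic (lam : seq nat) : tensor d -> Prop :=
  span (fun x => exists W : tensor d -> Prop,
    [/\ gl_submod W, forall y, W y -> homog (sumn lam) y,
        gl_iso (schur lam) W & W x]).

(* Internal sum of the subspaces F nu with P nu, and its directness. *)
Definition dsum (P : seq nat -> Prop) (F : seq nat -> tensor d -> Prop) :
    tensor d -> Prop :=
  span (fun x => exists2 nu, P nu & F nu x).

Definition direct (P : seq nat -> Prop) (F : seq nat -> tensor d -> Prop) : Prop :=
  forall nu x, P nu -> F nu x -> dsum (fun nu' => P nu' /\ nu' <> nu) F x -> x = 0.

End Schur.

Section Symplectic.
Context (g : nat).
Local Notation T := (tensor (g + g)).
Implicit Types (s t x y : T).

(* Symplectic basis x_i = gen (lshift g i), y_i = gen (rshift g i), with       *)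
(* omega (x_i, y_i) = 1.                                                       *)
Definition omega : 'M[rat]_(g + g) := block_mx 0 1%:M (- 1%:M) 0.

Definition sp_inv x : Prop :=
  forall M, M^T *m omega *m M = omega -> gl_act M x = x.

(* Poincare duality: u (x) xi is the map v |-> omega (u, v) xi on H. *)
Definition contract t (j : 'I_(g + g)) : T :=
  linext (fun w => if w is i :: w' then omega i j *: word w' else 0) t.

Definition der_of_tensor t : T -> T := der (contract t).

Definition tensor_of_der (D : T -> T) : T :=
  \sum_(i < g) (gen (lshift g i) * D (gen (rshift g i))
                - gen (rshift g i) * D (gen (lshift g i))).

Definition hbracket s t : T :=
  tensor_of_der (fun v => der_of_tensor s (der_of_tensor t v)
                          - der_of_tensor t (der_of_tensor s v)).

Definition hder (k : nat) t : Prop :=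
  tens (@homog (g + g) 1) (@lie_deg (g + g) k.+1) t /\ bracket_map t = 0.

Definition Htilde (k : nat) (lam : seq nat) x : Prop := isotypic lam x /\ hder k x.

Definition Hsp (k : nat) (nu : seq nat) x : Prop :=
  Htilde k (ydelta nu) x /\ sp_inv x.

Definition bracket_span (A B : T -> Prop) : T -> Prop :=
  span (fun x => exists s t, [/\ A s, B t & x = hbracket s t]).

Definition condC (lam mu nu : seq nat) : Prop :=
  common_irreducible_summand
    (tens (@schur (g + g) lam) (@schur (g + g) mu))
    (tens (@ext2 (g + g)) (@schur (g + g) nu)).

Definition condS (lam mu nu : seq nat) : Prop := condC lam mu (ydelta nu).

Definition Bindex (k l : nat) (lam mu nu : seq nat) : Prop :=
  [/\ young_diagram nu, sumn nu = (k + l).+2 & condC lam mu nu].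

Definition Bsub (k l : nat) (lam mu : seq nat) : T -> Prop :=
  dsum (Bindex k l lam mu) (Htilde (k + l)).

Definition Sindex (k l : nat) (lam mu nu : seq nat) : Prop :=
  [/\ young_diagram nu, (2 * sumn nu = (k + l).+2)%N & condS lam mu nu].

Definition Ssub (k l : nat) (lam mu : seq nat) : T -> Prop :=
  dsum (Sindex k l lam mu) (Hsp (k + l)).

(* y is the nu-coordinate of x in h(k)^Sp, the direct sum of the Hsp k nu'     *)
(* with 2 |nu'| = k + 2 and h(nu') <= g (for h(nu) > g, Hsp k nu = 0).         *)
Definition Hsp_coord (k : nat) (nu : seq nat) x y : Prop :=
  Hsp k nu y /\
  dsum (fun nu' => [/\ young_diagram nu', (2 * sumn nu' = k.+2)%N,
                       (size nu' <= g)%N & nu' <> nu]) (Hsp k) (x - y).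

End Symplectic.

(* Main.v *)
(* Words form an orthonormal basis of H^{(x) n} for which the adjoint of the    *)
(* action of M is the action of M^T, so orthogonal complements of GL-submodules *)
(* are GL-submodules.  Highest weight vectors show that the Schur modules S_nu  *)
(* are irreducible and pairwise non-isomorphic, and that every nonzero element  *)
(* of a GL-submodule Y pairs nontrivially with some copy of an S_nu inside Y.   *)
(* (i) The bracket [s, t] is the contraction with omega of a GL-equivariant map *)
(* of s (x) t with values in wedge^2 H (x) H^{(x) (k + l + 2)}.  If [s, t]      *)
(* pairs nontrivially with a copy of S_nu, composing with the corresponding     *)
(* projection gives a nonzero GL-map from S_lam (x) S_mu to wedge^2 H (x) S_nu, *)
(* whence a common irreducible summand.  The bounds on heights come from the    *)
(* projection of H on its first a coordinates, which kills S_nu exactly when    *)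
(* a < h(nu).                                                                   *)
(* (ii) A nonzero Sp-invariant x in S_nu pairs nontrivially with the highest    *)
(* weight vector, since gl = sp + b for the upper triangular matrices b.  The   *)
(* torus of Sp kills x, which forces nu_1 = nu_2, nu_3 = nu_4, .., so that      *)
(* nu = rho^delta for some rho.                                                 *)
Require Import Defs.
From mathcomp Require Import all_boot all_order all_algebra all_fingroup.
From mathcomp Require Import finmap monalg ring zify.
From Stdlib Require Import Classical.

Set Implicit Arguments.
Unset Strict Implicit.
Unset Printing Implicit Defensive.

Import Order.TTheory GRing.Theory Num.Theory.
Local Open Scope ring_scope.

(** * Linear maps and words *)

(** Everything takes place in tensor powers of Q^d, where words are orthonormal and the adjoint of M
    is M^T. Orthogonal projection onto a GL-submodule is then equivariant ([proj_exists],
    [proj_gact]), which gives complete reducibility. Two facts link the group with operators: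
    interpolation in t of the action of 1 + tX expresses the action of gl through that of GL
    ([lmx_gact]), and every symmetrised product of n matrices is a polynomial in the action of gl
    ([dmx_closure]). So GL-submodules are stable, and GL-maps equivariant, under the whole Schur
    algebra, singular matrices included ([gsub_dmx], [on_dmx]).

    The Schur module of c is generated by [v0], the Young symmetrization of the word with letter i
    all along row i. Its highest weight vectors are multiples of [v0] ([schurS_hw]), whence
    irreducibility ([schurS_irr]) and the fact that the module determines c ([schur_hom_eq]).
    Conversely, a nonzero GL-submodule contains a copy of some Schur module ([schur_in]), and each
    of its nonzero elements pairs nontrivially with such a copy ([schur_pairing]).

    For (i), each term of [s, t] contracts the first letter of one tensor with a later letter of the
    other. Moving the two letters to the front and antisymmetrising them, instead of contracting,
    gives the GL-map [bracket_lift] with values in wedge^2 H (x) H^{(x) (k + l + 2)}, and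
    contracting it gives 2 [s, t] ([c2_bracket_lift]). If [s, t] had a component orthogonal to
    B(lambda, mu), that component would pair with a copy of some S_nu orthogonal to B(lambda, mu):
    either nu satisfies (C) and the copy lies in B(lambda, mu), or [not_condC_kills] makes the
    pairing zero ([hbracket_Bsub]). The heights are compared through the coordinate projections
    eps_a ([common_height]): eps_a kills S_lam when a < h(lam), whereas a nonzero submodule of a
    product survives as soon as a reaches the total number of rows ([epsm_tens]).

    For (ii), isotypic components are orthogonal, so the components of an Sp-invariant are
    Sp-invariant ([sp_inv_component]). A nonzero invariant of type nu pairs with the highest weight
    vector, because gl is the sum of sp and the upper triangular matrices; the torus of Sp then
    forces the rows of nu to be equal in pairs ([schurS_sp], [sp_inv_shape]). Hence only the types
    nu^delta survive, and vanishing of a coordinate follows from directness ([coord_eq0]). *)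

Definition lin (U V : lmodType rat) (F : U -> V) : Prop :=
  forall (a : rat) x y, F (a *: x + y) = a *: F x + F y.

Section Lin.
Context (U V : lmodType rat) (F : U -> V) (Fl : lin F).

Lemma lin0 : F 0 = 0.
Proof. by have := Fl (-1) 0 0; rewrite scaler0 addr0 scaleN1r addNr. Qed.

Lemma linD x y : F (x + y) = F x + F y.
Proof. by have := Fl 1 x y; rewrite !scale1r. Qed.

Lemma linZ a x : F (a *: x) = a *: F x.
Proof. by have := Fl a x 0; rewrite lin0 !addr0. Qed.

Lemma linB x y : F (x - y) = F x - F y.
Proof. by rewrite linD -scaleN1r linZ scaleN1r. Qed.

Lemma lin_sum I (r : seq I) (P : pred I) G :
  F (\sum_(i <- r | P i) G i) = \sum_(i <- r | P i) F (G i).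
Proof.
elim: r => [|i r IH]; first by rewrite !big_nil lin0.
by rewrite !big_cons; case: (P i) => //; rewrite linD IH.
Qed.
End Lin.

Lemma lin_comp (U V W : lmodType rat) (F : V -> W) (G : U -> V) :
  lin F -> lin G -> lin (fun x => F (G x)).
Proof. by move=> Fl Gl a x y; rewrite Gl Fl. Qed.

Lemma lin_add (U V : lmodType rat) (F G : U -> V) :
  lin F -> lin G -> lin (fun x => F x + G x).
Proof. by move=> Fl Gl a x y; rewrite Gl Fl scalerDr addrACA. Qed.

Lemma lin_scale (U V : lmodType rat) c (F : U -> V) :
  lin F -> lin (fun x => c *: F x).
Proof. by move=> Fl a x y; rewrite Fl scalerDr !scalerA mulrC. Qed.

Lemma lin_sub (U V : lmodType rat) (F G : U -> V) :
  lin F -> lin G -> lin (fun x => F x - G x).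
Proof.
by move=> Fl Gl a x y; rewrite Gl Fl scalerBr opprD addrACA.
Qed.

Lemma lin_bigsum (U V : lmodType rat) I (r : seq I) (F : I -> U -> V) :
  (forall i, lin (F i)) -> lin (fun x => \sum_(i <- r) F i x).
Proof.
move=> Fl a x y; rewrite scaler_sumr -big_split /=.
by apply: eq_bigr => i _; rewrite Fl.
Qed.

(** Same body as [subspace], and [vspan] as [span], over an arbitrary left module: on tensors they
    are convertible. *)
Definition vsub (V : lmodType rat) (Q : V -> Prop) : Prop :=
  Q 0 /\ forall (a : rat) x y, Q x -> Q y -> Q (a *: x + y).

Definition vspan (V : lmodType rat) (Q : V -> Prop) x : Prop :=
  exists s : seq (rat * V),
    (forall p, p \in s -> Q p.2) /\ x = \sum_(p <- s) p.1 *: p.2.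

Section VSub.
Context (V : lmodType rat).
Implicit Types (x y : V) (P Q : V -> Prop).

Lemma sub_lin Q : vsub Q ->
  forall I (r : seq I) (P : pred I) F, (forall i, P i -> Q (F i)) ->
  Q (\sum_(i <- r | P i) F i).
Proof.
case=> Q0 QD I r P F QF; apply: big_ind => // x y Qx Qy.
by rewrite -[x]scale1r; apply: QD.
Qed.

Lemma sub_lin_in Q : vsub Q ->
  forall (I : eqType) (r : seq I) F, (forall i, i \in r -> Q (F i)) ->
  Q (\sum_(i <- r) F i).
Proof. by move=> Qs I r F QF; rewrite big_seq; apply: (sub_lin Qs). Qed.

Lemma subZ Q : vsub Q -> forall a x, Q x -> Q (a *: x).
Proof. by case=> Q0 QD a x Qx; rewrite -[_ *: _]addr0; apply: QD. Qed.

Lemma subD Q : vsub Q -> forall x y, Q x -> Q y -> Q (x + y).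
Proof. by case=> Q0 QD x y Qx Qy; rewrite -[x]scale1r; apply: QD. Qed.

Lemma subB Q : vsub Q -> forall x y, Q x -> Q y -> Q (x - y).
Proof. by move=> Qs x y Qx Qy; apply: subD => //; rewrite -scaleN1r; apply: subZ. Qed.

Lemma sub_eq (W : lmodType rat) (F G : V -> W) :
  lin F -> lin G -> vsub (fun x => F x = G x).
Proof.
move=> Fl Gl; split; first by rewrite (lin0 Fl) (lin0 Gl).
by move=> a x y hx hy; rewrite Fl Gl hx hy.
Qed.

Lemma sub_zero (W : lmodType rat) (F : V -> W) :
  lin F -> vsub (fun x => F x = 0).
Proof. by move=> Fl; split; [exact: lin0|move=> a x y hx hy; rewrite Fl hx hy scaler0 addr0]. Qed.

Lemma sub_and P Q : vsub P -> vsub Q ->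
  vsub (fun x => P x /\ Q x).
Proof.
by move=> [P0 PD] [Q0 QD]; split=> // a x y [? ?] [? ?]; split; [apply: PD|apply: QD].
Qed.

Lemma sub_all (I : Type) (Q : I -> V -> Prop) : (forall i, vsub (Q i)) ->
  vsub (fun x => forall i, Q i x).
Proof.
move=> Qs; split; first by move=> i; case: (Qs i).
by move=> a x y hx hy i; case: (Qs i) => _; apply.
Qed.

Lemma sub_imp (A : Prop) Q : vsub Q -> vsub (fun x => A -> Q x).
Proof. by case=> Q0 QD; split=> // a x y hx hy hA; apply: QD; auto. Qed.

End VSub.

Lemma sub_pre (V W : lmodType rat) (F : V -> W) (Q : W -> Prop) :
  lin F -> vsub Q -> vsub (fun x => Q (F x)).
Proof.
move=> Fl [Q0 QD]; split; first by rewrite (lin0 Fl).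
by move=> a x y hx hy; rewrite Fl; apply: QD.
Qed.

Lemma malgU_scale (K : choiceType) (a : rat) (k : K) :
  << a *g k >> = a *: << k >> :> {malg rat[K]}.
Proof. by apply/malgP => k'; rewrite mcoeffZ !mcoeffU mulrnAr mulr1. Qed.

Lemma malg_mulZr (K : monomType) (a : rat) (x y : {malg rat[K]}) :
  x * (a *: y) = a *: (x * y).
Proof.
apply/malgP => k; rewrite mcoeffZ (mcoeffMl x y k).
rewrite (mcoeffMlw _ (fsubset_refl _) (msuppZ_le a y)).
rewrite mulr_sumr; apply: eq_bigr => i _; rewrite mulr_sumr.
apply: eq_bigr => j _; rewrite mcoeffZ.
by case: (_ == k); rewrite ?mulr1n ?mulr0n ?mulr0 // mulrCA.
Qed.

Section Words.
Context (d : nat).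
Local Notation T := (tensor d).
Implicit Types (x y : T) (s t : seq 'I_d).

Definition linx (V : lmodType rat) (f : seq 'I_d -> V) x : V :=
  \sum_(w <- msupp x) x@_w *: f w.

Lemma linxEw (V : lmodType rat) (f : seq 'I_d -> V) x (D : {fset {fmonom 'I_d}}) :
  (msupp x `<=` D)%fset -> linx f x = \sum_(w <- D) x@_w *: f w.
Proof.
move=> sub; rewrite /linx (big_fset_incl _ sub) //= => w _ /mcoeff_outdom ->.
by rewrite scale0r.
Qed.

Lemma linx_lin (V : lmodType rat) (f : seq 'I_d -> V) : lin (linx f).
Proof.
move=> a x y.
pose D := (msupp x `|` msupp y)%fset.
rewrite (linxEw f (fsubsetUl _ _ : (msupp x `<=` D)%fset)).
rewrite (linxEw f (fsubsetUr _ _ : (msupp y `<=` D)%fset)).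
rewrite (@linxEw _ f _ D); last first.
  apply: fsubset_trans (msuppD_le _ _) _.
  by apply: fsetSU; apply: msuppZ_le.
rewrite scaler_sumr -big_split /=; apply: eq_bigr => w _.
by rewrite mcoeffD mcoeffZ scalerDl scalerA.
Qed.

Lemma linx_word (V : lmodType rat) (f : seq 'I_d -> V) s : linx f (word s) = f s.
Proof.
by rewrite /linx /word msuppU1 big_seq_fset1 mcoeffUU scale1r.
Qed.

Lemma word_exp x : x = linx (@word d) x.
Proof.
rewrite {1}(monalgE x); apply: eq_bigr => w _.
by rewrite /word fmK malgU_scale.
Qed.

Lemma linext_lin f : lin (@linext d f). Proof. exact: linx_lin. Qed.
Lemma linext_word f s : @linext d f (word s) = f s. Proof. exact: linx_word. Qed.

Lemma word_cat s t : word (s ++ t) = word s * word t.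
Proof. by rewrite /word malgM_def fgmulUU mulr1 -[mmul _ _]/(fmmul _ _) fmmulE. Qed.

Lemma word_nil : word [::] = 1 :> T.
Proof. by rewrite /word -fmoneE. Qed.

Lemma word_cons i s : word (i :: s) = gen i * word s.
Proof. by rewrite -word_cat. Qed.

Lemma mcoeff_word s t : (word s)@_(FMonom t) = (s == t)%:R.
Proof. by rewrite /word mcoeffU1 fmP. Qed.

Lemma word_ind_supp (Q : T -> Prop) x : vsub Q ->
  (forall w, w \in msupp x -> Q (word w)) -> Q x.
Proof.
move=> Qs Qw; rewrite (word_exp x) /linx big_seq.
by apply: (sub_lin Qs) => w wx; apply: subZ => //; apply: Qw.
Qed.

Lemma word_ind (Q : T -> Prop) : vsub Q -> (forall s, Q (word s)) -> forall x, Q x.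
Proof. by move=> Qs Qw x; apply: word_ind_supp. Qed.

Lemma homog_ind n (Q : T -> Prop) : vsub Q ->
  (forall s, size s = n -> Q (word s)) -> forall x, homog n x -> Q x.
Proof. by move=> Qs Qw x hx; apply: word_ind_supp => // w /hx sw; apply: Qw. Qed.

Lemma word_ext (V : lmodType rat) (F G : T -> V) : lin F -> lin G ->
  (forall s, F (word s) = G (word s)) -> forall x, F x = G x.
Proof. by move=> Fl Gl; apply: word_ind; apply: sub_eq. Qed.

Lemma homog_ext n (V : lmodType rat) (F G : T -> V) : lin F -> lin G ->
  (forall s, size s = n -> F (word s) = G (word s)) ->
  forall x, homog n x -> F x = G x.
Proof. by move=> Fl Gl; apply: homog_ind; apply: sub_eq. Qed.

Lemma homogP n x : homog n x <-> forall s, size s <> n -> x@_(FMonom s) = 0.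
Proof.
split=> [hx s ns|h w wx].
  by apply: mcoeff_outdom; apply/negP => /hx.
apply: NNPP => nw; move: wx; rewrite -mcoeff_neq0.
by have := h w nw; rewrite fmK => ->; rewrite eqxx.
Qed.

Lemma homog_sub n : vsub (@homog d n).
Proof.
split; first by apply/homogP => s _; rewrite mcoeff0.
move=> a x y /homogP hx /homogP hy; apply/homogP => s ns.
by rewrite mcoeffD mcoeffZ hx // hy // mulr0 addr0.
Qed.

Lemma homog_word s : homog (size s) (word s).
Proof.
apply/homogP => t nt; rewrite mcoeff_word; case: eqP => // est.
by rewrite est in nt.
Qed.

Lemma lin_id : lin (fun x : T => x). Proof. by []. Qed.

Lemma lin_mull y : lin (fun x : T => x * y).
Proof. by move=> a x z; rewrite mulrDl scalerAl. Qed.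

Lemma mulr_scale (a : rat) x y : x * (a *: y) = a *: (x * y).
Proof. exact: malg_mulZr. Qed.

Lemma lin_mulr y : lin (fun x : T => y * x).
Proof. by move=> a x z; rewrite mulrDr mulr_scale. Qed.

Lemma homog_mul m n x y : homog m x -> homog n y -> homog (m + n)%N (x * y).
Proof.
move=> hx hy; move: x hx; apply: homog_ind.
  by apply: (sub_pre (lin_mull y)); apply: homog_sub.
move=> s <-; move: y hy; apply: homog_ind.
  by apply: (sub_pre (lin_mulr (word s))); apply: homog_sub.
by move=> t <-; rewrite -word_cat -size_cat; apply: homog_word.
Qed.
End Words.

(** * Tensor powers *)

(* An n-fold tensor power of Q^d inside V: a basis indexed by words of length *)
(* n with its coordinate functions.  Working over an abstract V keeps the     *)
(* monoid-algebra structure of the tensor algebra out of unification problems. *)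
Record frame (d n : nat) (V : lmodType rat) := Frame {
  fe : {ffun 'I_n -> 'I_d} -> V;
  fc : V -> {ffun 'I_n -> 'I_d} -> rat;
  fc_lin : forall v, lin ((fun x => fc x v) : V -> rat^o);
  fc_fe : forall u v, fc (fe u) v = (u == v)%:R }.

Section Coordinates.
Context (d n : nat) (V : lmodType rat) (fr : frame d n V).
Local Notation I := {ffun 'I_n -> 'I_d}.
Local Notation wd := (fe fr).
Local Notation cf := (fc fr).
Implicit Types (x y : V) (u v w : I).

Definition mk (F : I -> rat) : V := \sum_v F v *: wd v.
(** Membership in the n-fold tensor power: [x] is rebuilt from its coordinates. The ambient [V] may
    be larger, as the tensor algebra is. *)
Definition thom x : Prop := mk (cf x) = x.

Lemma cf_lin v : lin ((fun x => cf x v) : V -> rat^o).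
Proof. exact: fc_lin. Qed.

Lemma cf_wd u v : cf (wd u) v = (u == v)%:R.
Proof. exact: fc_fe. Qed.

Lemma cfP v a x y : cf (a *: x + y) v = a * cf x v + cf y v.
Proof. exact: cf_lin. Qed.

Lemma cf0 v : cf 0 v = 0. Proof. exact: (lin0 (cf_lin v)). Qed.
Lemma cfB v x y : cf (x - y) v = cf x v - cf y v. Proof. exact: (linB (cf_lin v)). Qed.
Lemma cfZ v a x : cf (a *: x) v = a * cf x v. Proof. exact: (linZ (cf_lin v)). Qed.
Lemma cf_sum v J (r : seq J) (P : pred J) F :
  cf (\sum_(i <- r | P i) F i) v = \sum_(i <- r | P i) cf (F i) v.
Proof. exact: (lin_sum (cf_lin v)). Qed.

Lemma cf_mk F v : cf (mk F) v = F v.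
Proof.
rewrite /mk cf_sum (bigD1 v) //= big1 => [|u uv].
  by rewrite addr0 cfZ cf_wd eqxx mulr1.
by rewrite cfZ cf_wd (negPf uv) mulr0.
Qed.

Lemma mk_lin (W : lmodType rat) (K : I -> W -> rat) :
  (forall v, lin (K v : W -> rat^o)) -> lin (fun z => mk (fun v => K v z)).
Proof.
move=> Kl a x y; rewrite /mk scaler_sumr -big_split /=.
by apply: eq_bigr => v _; rewrite (Kl v) scalerDl scalerA.
Qed.

Lemma hom_sub : vsub thom.
Proof. by apply: (@sub_eq _ _ (fun x => mk (cf x)) id) => //; apply: mk_lin => v; apply: cf_lin. Qed.

Lemma hom_wd v : thom (wd v).
Proof.
rewrite /thom /mk (bigD1 v) //= big1 => [|u uv]; rewrite cf_wd.
  by rewrite eqxx scale1r addr0.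
by rewrite eq_sym (negPf uv) scale0r.
Qed.

Lemma hom_mk F : thom (mk F).
Proof.
apply: (sub_lin hom_sub) => v _.
by apply: (subZ hom_sub); apply: hom_wd.
Qed.

Lemma mk_ext F G : (forall v, F v = G v) -> mk F = mk G.
Proof. by move=> e; apply: eq_bigr => v _; rewrite e. Qed.

Lemma cf_inj x y : thom x -> thom y -> (forall v, cf x v = cf y v) -> x = y.
Proof. by move=> <- <- e; apply: mk_ext => v; have := e v; rewrite !cf_mk. Qed.

Lemma mk_cf x : thom x -> mk (cf x) = x.
Proof. by []. Qed.

Lemma wd_ind (Q : V -> Prop) : vsub Q -> (forall v, Q (wd v)) ->
  forall x, thom x -> Q x.
Proof.
by move=> Qs Qw x <-; apply: (sub_lin Qs) => v _; apply: (subZ Qs).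
Qed.

Definition ip x y : rat := \sum_v cf x v * cf y v.

Lemma ipC x y : ip x y = ip y x.
Proof. by apply: eq_bigr => v _; rewrite mulrC. Qed.

Lemma ip_linl y : lin ((fun x => ip x y) : V -> rat^o).
Proof.
move=> a x z; rewrite /ip scaler_sumr -big_split /=.
by apply: eq_bigr => v _; rewrite cfP mulrDl -mulrA.
Qed.

Lemma ip_linr x : lin ((fun y => ip x y) : V -> rat^o).
Proof. by move=> a y z; rewrite !(ipC x); apply: ip_linl. Qed.

Lemma sum_delta (F : I -> rat) w : \sum_u F u * (w == u)%:R = F w.
Proof.
rewrite (bigD1 w) //= big1 => [|u uw]; first by rewrite eqxx mulr1 addr0.
by rewrite eq_sym (negPf uw) mulr0.
Qed.

Lemma ipBl x y z : ip (x - y) z = ip x z - ip y z.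
Proof. exact: (linB (ip_linl z)). Qed.
Lemma ipDl x y z : ip (x + y) z = ip x z + ip y z.
Proof. exact: (linD (ip_linl z)). Qed.
Lemma ipZl a x z : ip (a *: x) z = a * ip x z.
Proof. exact: (linZ (ip_linl z)). Qed.
Lemma ip0l z : ip 0 z = 0.
Proof. exact: (lin0 (ip_linl z)). Qed.
Lemma ipDr x y z : ip z (x + y) = ip z x + ip z y.
Proof. exact: (linD (ip_linr z)). Qed.
Lemma ipZr a x z : ip z (a *: x) = a * ip z x.
Proof. exact: (linZ (ip_linr z)). Qed.
Lemma ip0r z : ip z 0 = 0.
Proof. exact: (lin0 (ip_linr z)). Qed.

Lemma ip_wd x v : ip x (wd v) = cf x v.
Proof. by rewrite /ip; under eq_bigr do rewrite cf_wd; rewrite sum_delta. Qed.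

Lemma ip_eq0 x : thom x -> ip x x = 0 -> x = 0.
Proof.
move=> hx /psumr_eq0P h; apply: cf_inj => // [|v]; first by case: hom_sub.
have := h (fun v _ => _) v isT; rewrite cf0 => /(_ _)/eqP.
by rewrite mulf_eq0 orbb => e; apply/eqP/e => u; rewrite -expr2 sqr_ge0.
Qed.

Lemma ip_ext x y : thom x -> thom y ->
  (forall z, thom z -> ip x z = ip y z) -> x = y.
Proof.
move=> hx hy e; apply: cf_inj => // v.
by rewrite -!ip_wd e //; apply: hom_wd.
Qed.

(* B_1 (x) .. (x) B_n *)
Definition pmx (B : 'I_n -> 'M[rat]_d) x : V :=
  mk (fun v => \sum_(w : I) (\prod_p B p (v p) (w p)) * cf x w).

(* the place permutation w |-> w o s *)
Definition plc (s : 'S_n) x : V := mk (fun v => cf x [ffun p => v (s^-1%g p)]).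

Lemma pmx_lin B : lin (pmx B).
Proof.
apply: mk_lin => v; apply: lin_bigsum => w.
exact: (lin_scale _ (cf_lin w)).
Qed.

Lemma plc_lin s : lin (plc s).
Proof. by apply: mk_lin => v; apply: cf_lin. Qed.

Lemma hom_pmx B x : thom (pmx B x). Proof. exact: hom_mk. Qed.
Lemma hom_plc s x : thom (plc s x). Proof. exact: hom_mk. Qed.

Lemma pmx_ext B C x : (forall p, B p = C p) -> pmx B x = pmx C x.
Proof.
move=> e; apply: mk_ext => v; apply: eq_bigr => w _; congr (_ * _).
by apply: eq_bigr => p _; rewrite e.
Qed.

Lemma pmx_comp B C x : pmx B (pmx C x) = pmx (fun p => B p *m C p) x.
Proof.
apply: mk_ext => v; under eq_bigr do rewrite cf_mk mulr_sumr.
rewrite exchange_big; apply: eq_bigr => w _ /=.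
under eq_bigr do rewrite mulrA -big_split /=.
rewrite -mulr_suml; congr (_ * _).
rewrite -(bigA_distr_bigA (fun p j => B p (v p) j * C p j (w p))) /=.
by apply: eq_bigr => p _; rewrite mxE.
Qed.

Lemma prod_delta v w : \prod_p (1%:M : 'M[rat]_d) (v p) (w p) = (v == w)%:R.
Proof.
case: eqP => [->|/eqP ne]; first by apply: big1 => p _; rewrite mxE eqxx.
have /existsP [p ne_p] : [exists p, v p != w p].
  apply: contraR ne; rewrite negb_exists => /forallP h.
  by apply/eqP/ffunP => p; have := h p; rewrite negbK => /eqP.
by rewrite (bigD1 p) //= mxE (negPf ne_p) mul0r.
Qed.

Lemma pmx_one x : thom x -> pmx (fun _ => 1%:M) x = x.
Proof.
move=> hx; rewrite -[RHS]mk_cf //; apply: mk_ext => v.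
under eq_bigr do rewrite prod_delta.
rewrite (bigD1 v) //= big1 => [|w wv]; rewrite ?eqxx ?mul1r ?addr0 //.
by rewrite eq_sym (negPf wv) mul0r.
Qed.

Lemma pmx_adj B x y : ip (pmx B x) y = ip x (pmx (fun p => (B p)^T) y).
Proof.
rewrite /ip; under eq_bigr do rewrite cf_mk mulr_suml.
rewrite exchange_big /=; apply: eq_bigr => w _.
rewrite cf_mk mulr_sumr; apply: eq_bigr => v _.
rewrite mulrAC mulrC; congr (_ * (_ * _)).
by apply: eq_bigr => p _; rewrite mxE.
Qed.

Lemma pmx_wd B w : pmx B (wd w) = mk (fun v => \prod_p B p (v p) (w p)).
Proof.
by apply: mk_ext => v; under [LHS]eq_bigr do rewrite cf_wd; rewrite sum_delta.
Qed.

Definition fcomp v (s : 'S_n) : I := [ffun p => v (s p)].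

Lemma fcompK v s : fcomp (fcomp v s) s^-1%g = v.
Proof. by apply/ffunP => p; rewrite !ffunE permKV. Qed.
Lemma fcompKV v s : fcomp (fcomp v s^-1%g) s = v.
Proof. by apply/ffunP => p; rewrite !ffunE permK. Qed.
Lemma fcompM v s t : fcomp (fcomp v s) t = fcomp v (t * s)%g.
Proof. by apply/ffunP => p; rewrite !ffunE permM. Qed.
Lemma fcomp1 v : fcomp v 1%g = v.
Proof. by apply/ffunP => p; rewrite !ffunE perm1. Qed.

Lemma cf_plc s x v : cf (plc s x) v = cf x (fcomp v s^-1%g).
Proof. by rewrite cf_mk. Qed.

Lemma plc_wd s w : plc s (wd w) = wd (fcomp w s).
Proof.
apply: cf_inj => [||v]; [exact: hom_plc|exact: hom_wd|].
rewrite cf_plc !cf_wd; congr (nat_of_bool _)%:R.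
by apply/eqP/eqP => [->|<-]; rewrite ?fcompKV ?fcompK.
Qed.

Lemma plcM s t x : plc s (plc t x) = plc (s * t)%g x.
Proof. by apply: mk_ext => v; rewrite cf_plc; congr cf; rewrite -/(fcomp _ _) fcompM invMg. Qed.

Lemma plc1 x : thom x -> plc 1%g x = x.
Proof.
move=> hx; rewrite -[RHS]mk_cf //; apply: mk_ext => v.
by rewrite invg1 -/(fcomp v 1%g) fcomp1.
Qed.

Lemma sum_fcomp (A : zmodType) s (F : I -> A) : \sum_v F (fcomp v s) = \sum_v F v.
Proof.
rewrite [RHS](reindex (fun v => fcomp v s)) //.
by exists (fun v => fcomp v s^-1%g) => v _; rewrite ?fcompK ?fcompKV.
Qed.

Lemma plc_adj s x y : ip (plc s x) y = ip x (plc s^-1%g y).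
Proof.
rewrite /ip -(sum_fcomp s); apply: eq_bigr => v _.
by rewrite !cf_plc fcompK invgK.
Qed.

Lemma plc_pmx s B x : plc s (pmx B x) = pmx (fun p => B (s p)) (plc s x).
Proof.
apply: mk_ext => v; rewrite cf_mk -(sum_fcomp s^-1%g).
apply: eq_bigr => w _; rewrite cf_plc; congr (_ * _).
rewrite (reindex_inj (@perm_inj _ s)) /=; apply: eq_bigr => p _.
by rewrite !ffunE permK.
Qed.

End Coordinates.

(** * Derivations and symmetrised operators on a tensor power *)

Section Operators.
Context (d n : nat) (V : lmodType rat) (fr : frame d n V).
Local Notation I := {ffun 'I_n -> 'I_d}.
Local Notation wd := (fe fr).
Local Notation thom := (thom fr).
Local Notation ip := (ip fr).
Local Notation pmx := (pmx fr).
Local Notation plc := (plc fr).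
Local Notation M_ := 'M[rat]_d.
Implicit Types (x y : V) (u v w : I) (X Y : M_) (B C : 'I_n -> M_) (s : 'S_n).

Definition upd (A : Type) (B : 'I_n -> A) p (X : A) : 'I_n -> A :=
  fun q => if q == p then X else B q.

Lemma pmx_upd_lin B p x : lin (fun X => pmx (upd B p X) x).
Proof.
move=> a X Y; rewrite /pmx /mk scaler_sumr -big_split /=.
apply: eq_bigr => v _; rewrite scalerA -scalerDl; congr (_ *: _).
rewrite mulr_sumr -big_split /=; apply: eq_bigr => w _.
rewrite !(bigD1 p (P := xpredT)) //= {1 3 5}/upd eqxx !mxE.
have e Z : \prod_(i | i != p) upd B p Z i (v i) (w i) =
           \prod_(i | i != p) B i (v i) (w i).
  by apply: eq_bigr => q /negPf qp; rewrite /upd qp.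
by rewrite !e !mulrDl !mulrA.
Qed.

(* the infinitesimal action of X in gl_d *)
Definition lmx X x : V := \sum_p pmx (upd (fun _ => 1%:M) p X) x.

(* n! times the symmetrisation of B_1 (x) .. (x) B_n *)
Definition dmx B x : V := \sum_(s : 'S_n) pmx (fun p => B (s p)) x.

Lemma lmx_lin X : lin (lmx X). Proof. by apply: lin_bigsum => p; apply: pmx_lin. Qed.
Lemma dmx_lin B : lin (dmx B). Proof. by apply: lin_bigsum => p; apply: pmx_lin. Qed.
Lemma lmx_linX x : lin (fun X => lmx X x).
Proof. by apply: lin_bigsum => p; apply: pmx_upd_lin. Qed.

Lemma hom_lmx X x : thom (lmx X x).
Proof. by apply: (sub_lin (hom_sub fr)) => p _; apply: hom_pmx. Qed.
Lemma hom_dmx B x : thom (dmx B x).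
Proof. by apply: (sub_lin (hom_sub fr)) => p _; apply: hom_pmx. Qed.

Lemma lmx_pmx X B x : lmx X (pmx B x) = \sum_p pmx (upd B p (X *m B p)) x.
Proof.
apply: eq_bigr => p _; rewrite pmx_comp; apply: pmx_ext => q.
by rewrite /upd; case: eqP => [->//|_]; rewrite mul1mx.
Qed.

(** When both matrices act at the same place they contribute their product; the remaining sum, over
    ordered pairs of distinct places, is symmetric in [X] and [Y] and cancels. *)
Lemma lmx_comm X Y x :
  lmx X (lmx Y x) = lmx Y (lmx X x) + lmx (X *m Y - Y *m X) x.
Proof.
have lmx2 Z W : lmx Z (lmx W x) = lmx (Z *m W) x +
    \sum_p \sum_(q | q != p) pmx (upd (upd (fun _ => 1%:M) p W) q Z) x.
  rewrite /(lmx W) (lin_sum (lmx_lin _)) -big_split /=; apply: eq_bigr => p _.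
  rewrite lmx_pmx (bigD1 p) //=; congr (_ + _).
    by apply: pmx_ext => q; rewrite /upd eqxx; case: (q == p).
  apply: eq_bigr => q /negPf qp; apply: pmx_ext => r; rewrite /upd qp.
  by case: ifP; rewrite // mulmx1.
rewrite !lmx2 (linB (lmx_linX x)) [RHS]addrC addrA subrK; congr (_ + _).
rewrite (exchange_big_dep xpredT) //=.
apply: eq_bigr => p _; apply: eq_big => q; first by rewrite eq_sym.
move=> qp; apply: pmx_ext => r; rewrite /upd.
have [->|] := eqVneq r q; last by case: (r == p).
by rewrite eq_sym in qp; rewrite ?(negPf qp) // eq_sym (negPf qp).
Qed.

Lemma lmx_adj X x y : ip (lmx X x) y = ip x (lmx X^T y).
Proof.
rewrite (lin_sum (ip_linl fr y)) (lin_sum (ip_linr fr x)); apply: eq_bigr => p _.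
rewrite pmx_adj; congr ip; apply: pmx_ext => q.
by rewrite /upd; case: ifP => // _; rewrite trmx1.
Qed.

Lemma upd_perm A (D : 'I_n -> A) p Z s q :
  upd D p Z (s q) = upd (fun q => D (s q)) (s^-1%g p) Z q.
Proof. by rewrite /upd -(inj_eq (@perm_inj _ s) q) permKV. Qed.

Lemma plc_lmx s X x : plc s (lmx X x) = lmx X (plc s x).
Proof.
rewrite /lmx (lin_sum (plc_lin fr s)) [RHS](reindex_inj (@perm_inj _ s^-1%g)).
apply: eq_bigr => p _; rewrite plc_pmx; apply: pmx_ext => q.
by rewrite upd_perm.
Qed.

Lemma plc_dmx s B x : plc s (dmx B x) = dmx B (plc s x).
Proof.
rewrite /dmx (lin_sum (plc_lin fr s)) [RHS](reindex_inj (mulgI s)).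
by apply: eq_bigr => t _; rewrite plc_pmx; apply: pmx_ext => q; rewrite permM.
Qed.

Lemma dmx_perm s B x : dmx (fun p => B (s p)) x = dmx B x.
Proof.
rewrite /dmx [RHS](reindex_inj (mulIg s)).
by apply: eq_bigr => t _; apply: pmx_ext => q; rewrite permM.
Qed.

Lemma dmx_ext B C x : (forall p, B p = C p) -> dmx B x = dmx C x.
Proof. by move=> e; apply: eq_bigr => t _; apply: pmx_ext => q; rewrite e. Qed.

Lemma lmx_dmx X B x : lmx X (dmx B x) = \sum_p dmx (upd B p (X *m B p)) x.
Proof.
rewrite /dmx (lin_sum (lmx_lin X)) [RHS]exchange_big; apply: eq_bigr => s _ /=.
rewrite lmx_pmx [RHS](reindex_inj (@perm_inj _ s)).
by apply: eq_bigr => p _; apply: pmx_ext => q; rewrite upd_perm permK.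
Qed.

Lemma dmx_const X x : dmx (fun _ => X) x = (n`!)%:R *: pmx (fun _ => X) x.
Proof. by rewrite /dmx sumr_const card_Sn scaler_nat. Qed.

(* The symmetrised operators are polynomials in the derivations lmx X: this *)
(* is an induction on the number of places where B is not the identity.     *)
Lemma dmx_closure (Q : (V -> V) -> Prop) :
  (forall F G, Q F -> (forall x, thom x -> F x = G x) -> Q G) ->
  Q (fun x => x) ->
  (forall a F G, Q F -> Q G -> Q (fun x => a *: F x + G x)) ->
  (forall X F, Q F -> Q (fun x => lmx X (F x))) ->
  forall B, Q (dmx B).
Proof.
move=> Qext Qid Qlin QE B.
have QZ a F : Q F -> Q (fun x => a *: F x).
  move=> QF; apply: (Qext (fun x => (a - 1) *: F x + F x)); first exact: Qlin.
  by move=> x _; rewrite scalerBl scale1r subrK.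
have Q0 : Q (fun=> 0) by apply: (Qext (fun x => 0 *: x)) => [|x _]; [exact: QZ|rewrite scale0r].
have Qsum (r : seq 'I_n) (P : pred 'I_n) F :
    (forall p, P p -> Q (F p)) -> Q (fun x => \sum_(p <- r | P p) F p x).
  move=> QF; elim: r => [|p r IH].
    by apply: Qext Q0 _ => x _; rewrite big_nil.
  case Pp: (P p); last by apply: Qext IH _ => x _; rewrite big_cons Pp.
  apply: (Qext _ _ (Qlin 1 _ _ (QF p Pp) IH)) => x _.
  by rewrite big_cons Pp scale1r.
have [k] := ubnP #|[pred p | B p != 1%:M]|; elim: k B => // k IH B leB.
have [p Bp|B1] := pickP [pred p | B p != 1%:M]; last first.
  apply: (Qext _ _ (QZ (n`!)%:R _ Qid)) => x hx.
  rewrite -{1}(pmx_one hx) -dmx_const; apply: dmx_ext => p.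
  by have := B1 p => /= /negbFE/eqP.
(* Apply [lmx (B p)] to [dmx B']. Each place where [B'] is the identity gives back [dmx B], up to
   exchanging two factors; the other places give operators with fewer nontrivial factors than [B].
   Solving for [dmx B] divides by the number of places of the first kind, which is nonzero since [p]
   is one. *)
pose B' := upd B p 1%:M.
have cB' : (#|[pred q | B' q != 1%:M]| < k)%N.
  rewrite -ltnS; apply: leq_trans leB; rewrite ltnS [X in (_ < X)%N](cardD1 p) inE [X in (X + _)%N](_ : _ = 1%N) ?add1n ?ltnS; last by rewrite (Bp : B p != 1%:M).
  apply: subset_leq_card; apply/subsetP => q; rewrite !inE /B' /upd.
  by have [->|qp] := eqVneq q p; rewrite ?eqxx.
have QB' := IH _ cB'.
pose P := [pred q | B' q == 1%:M].
have same q : P q -> forall x, dmx (upd B' q (B p)) x = dmx B x.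
  move=> Pq x; rewrite -(dmx_perm (tperm p q) B); apply: dmx_ext => r.
  move: Pq; rewrite /= /B' /upd.
  have [->|qp] := eqVneq q p; first by rewrite tperm1 perm1; case: (eqVneq r p) => [->|].
  move/eqP => Bq; have [->|rq] := eqVneq r q; first by rewrite tpermR.
  have [->|rp] := eqVneq r p; first by rewrite tpermL Bq.
  by rewrite tpermD // eq_sym.
have Pp : P p by rewrite /= /B' /upd eqxx.
have c0 : (#|P|)%:R != 0 :> rat.
  by rewrite pnatr_eq0 -lt0n; apply/card_gt0P; exists p.
have Qrest : Q (fun x => \sum_(q | ~~ P q) dmx (upd B' q (B p *m B' q)) x).
  apply: Qsum => q nPq; apply: IH; apply: leq_ltn_trans cB'.
  apply: subset_leq_card; apply/subsetP => r; rewrite !inE {1}/upd.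
  by have [->|//] := eqVneq r q; move=> _; apply: nPq.
have := Qlin (-1) _ _ Qrest (QE (B p) _ QB').
move/(QZ (#|P|%:R^-1)); move/Qext; apply => x hx.
have -> : lmx (B p) (dmx B' x) =
    \sum_(q | P q) dmx (upd B' q (B p *m B' q)) x +
    \sum_(q | ~~ P q) dmx (upd B' q (B p *m B' q)) x.
  by rewrite lmx_dmx (bigID P).
rewrite scaleN1r addrCA addNr addr0.
rewrite (eq_bigr (fun=> dmx B x)) => [|q Pq]; last first.
  rewrite -(same q Pq); apply: dmx_ext => r; rewrite /upd; case: eqP => // _.
  by move: Pq => /eqP ->; rewrite mulmx1.
by rewrite sumr_const -scaler_nat scalerA mulVf // scale1r.
Qed.

Lemma pmx_upd_wd p X w :
  pmx (upd (fun _ => 1%:M) p X) (wd w)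
  = \sum_i X i (w p) *: wd [ffun q => if q == p then i else w q].
Proof.
apply: cf_inj => [||v]; first exact: hom_pmx.
  apply: (sub_lin (hom_sub fr)) => i _.
  by apply: (subZ (hom_sub fr)); apply: hom_wd.
rewrite pmx_wd cf_mk cf_sum (bigD1 p) //= {1}/upd eqxx.
rewrite (eq_bigr (fun q => (v q == w q)%:R)) => [|q /negPf qp]; last first.
  by rewrite /upd qp mxE.
under [RHS]eq_bigr do rewrite cfZ cf_wd.
rewrite (bigD1 (v p)) //= [X in _ + X]big1 ?addr0 => [|i iv]; last first.
  rewrite (_ : _ == _ = false) ?mulr0 //; apply: contraNF iv => /eqP/ffunP/(_ p).
  by rewrite ffunE eqxx => ->.
congr (_ * _); have [e|ne] := eqP.
  apply: big1 => q /negPf qp; move/ffunP/(_ q): e; rewrite ffunE qp => <-.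
  by rewrite eqxx.
have /existsP [q /andP [qp vw]] : [exists q, (q != p) && (v q != w q)].
  apply: contra_notT ne; rewrite negb_exists => /forallP h; apply/ffunP => q.
  rewrite ffunE; have := h q; case: eqP => [->//|_]; by rewrite /= negbK => /eqP.
by rewrite (bigD1 q) //= (negPf vw) mul0r.
Qed.

(** [delta_mx i j] sends [e_j] to [e_i], so it is a raising operator when [i < j]. *)
Lemma lmx_delta_wd i j w : lmx (delta_mx i j) (wd w)
  = \sum_(p | w p == j) wd [ffun q => if q == p then i else w q].
Proof.
rewrite /lmx [RHS]big_mkcond; apply: eq_bigr => p _; rewrite pmx_upd_wd.
rewrite (bigD1 i) //= big1 => [|k ki]; rewrite mxE ?eqxx ?(negPf ki) ?scale0r // addr0.
by case: eqP => _; rewrite /= ?scale1r ?scale0r.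
Qed.

Lemma pmx_delta_wd u w v :
  pmx (fun p => delta_mx (u p) (w p)) (wd v) = (w == v)%:R *: wd u.
Proof.
apply: cf_inj => [||t]; first exact: hom_pmx.
  by apply: (subZ (hom_sub fr)); apply: hom_wd.
rewrite pmx_wd cf_mk cfZ cf_wd.
transitivity (\prod_p ((u p == t p)%:R * (w p == v p)%:R : rat)).
  by apply: eq_bigr => p _; rewrite mxE -natrM mulnb ![_ == u p]eq_sym ![_ == w p]eq_sym.
rewrite big_split mulrC -!prod_delta; congr (_ * _);
  by apply: eq_bigr => p _; rewrite mxE.
Qed.

(** Up to scalars, these symmetrised matrix units are the standard basis of the Schur algebra, the
    commutant of the place permutations. *)
Lemma dmx_delta_wd u w v : dmx (fun p => delta_mx (u p) (w p)) (wd v)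
  = \sum_(s : 'S_n | fcomp w s == v) wd (fcomp u s).
Proof.
rewrite /dmx [RHS]big_mkcond; apply: eq_bigr => s _.
rewrite -(@pmx_ext _ _ _ _ (fun p => delta_mx (fcomp u s p) (fcomp w s p))) => [|p]; last by rewrite !ffunE.
by rewrite pmx_delta_wd; case: eqP; rewrite ?scale1r ?scale0r.
Qed.

Lemma coef_prod_affine (J : eqType) (r : seq J) (a b : J -> rat) : uniq r ->
  let q := \prod_(i <- r) ((a i)%:P + b i *: 'X) in
  [/\ (size q <= (size r).+1)%N, q`_0 = \prod_(i <- r) a i
    & q`_1 = \sum_(i <- r) b i * \prod_(j <- r | j != i) a j].
Proof.
elim: r => [|k r IH]; first by rewrite /= !big_nil size_poly1 !coef1.
move=> /= /andP [kr /IH /= [sq q0 q1]]; rewrite !big_cons.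
set q := \prod_(_ <- r) _ in sq q0 q1 *.
split.
- apply: leq_trans (size_polyMleq _ _) _.
  have : (size ((a k)%:P + b k *: 'X : {poly rat})%R <= 2)%N.
    apply: leq_trans (size_polyD _ _) _; rewrite geq_max.
    rewrite (leq_trans (size_polyC_leq1 _)) //.
    by rewrite (leq_trans (size_scale_leq _ _)) // size_polyX.
  case: (size _) => [|[|[|m]]] //= _; rewrite ?add0n ?addSn /=.
  + by apply: leq_trans (leq_pred _) _; apply: leqW.
  + exact: leqW.
- by rewrite mulrDl coefD coefCM -scalerAl coefZ coefXM mulr0 addr0 q0.
- rewrite mulrDl coefD coefCM -scalerAl coefZ coefXM /= q0 q1 eqxx addrC.
  congr (_ + _).
    congr (_ * _); rewrite big_seq [RHS]big_seq_cond; apply: eq_bigl => j.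
    by case jr: (j \in r) => //=; apply/esym; apply: contraNneq kr => <-.
  rewrite mulr_sumr; apply: eq_big_seq => i ir.
  rewrite big_cons; have -> : k != i by apply: contraNneq kr => ->.
  by rewrite mulrCA.
Qed.

Definition gact X x : V := pmx (fun _ => X) x.

(* Lagrange interpolation extracts the coefficient of t in (1 + t X)^{(x) n}. *)
Lemma lmx_gact : exists2 c : 'I_n.+1 -> rat, \sum_i c i = 0 &
  forall X x, thom x ->
    lmx X x = \sum_i c i *: gact (1%:M + i.+1%:R *: X) x.
Proof.
pose t (i : nat) : rat := i.+1%:R.
have t_inj : injective (t : nat -> rat).
  by move=> i j /eqP; rewrite /t eqr_nat eqSS => /eqP.
(* The weights are the linear coefficients of the Lagrange polynomials at the nodes 1, .., n + 1.
   Their sum is the linear coefficient of the constant polynomial 1, hence 0. Positive nodes keep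
   [1 + t E_ij] invertible. *)
exists (fun i => (tnth (lagrange n.+1 t) i : {poly rat})`_1).
  have : (1 : {poly rat})`_1 = 0 by rewrite coef1.
  rewrite {1}(@lagrange_gen _ n.+1 _ isT t_inj 1); last by rewrite size_poly1.
  rewrite coef_sum => e; rewrite -[RHS]e; apply: eq_bigr => i _.
  by rewrite hornerE mul1r.
move=> X x hx.
apply: cf_inj => [||v]; first exact: hom_lmx.
  apply: (sub_lin (hom_sub fr)) => i _; apply: (subZ (hom_sub fr)).
  by apply: hom_pmx.
rewrite /lmx !cf_sum.
under [LHS]eq_bigr do rewrite cf_mk.
under [RHS]eq_bigr do rewrite cfZ cf_mk mulr_sumr.
rewrite exchange_big [RHS]exchange_big; apply: eq_bigr => w _ /=.
under [RHS]eq_bigr do rewrite mulrA.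
rewrite -!mulr_suml; congr (_ * _).
pose q : {poly rat} :=
  \prod_p (((1%:M : M_) (v p) (w p))%:P + X (v p) (w p) *: 'X).
have [sq _ q1] := @coef_prod_affine _ (index_enum 'I_n)
  (fun p => (1%:M : M_) (v p) (w p)) (fun p => X (v p) (w p)) (index_enum_uniq _).
transitivity q`_1.
  rewrite q1; apply: eq_bigr => p _; rewrite (bigD1 p) //= {1}/upd eqxx.
  by congr (_ * _); apply: eq_bigr => r /negPf rp; rewrite /upd rp.
rewrite (@lagrange_gen _ n.+1 _ isT t_inj q); last first.
  by apply: leq_trans sq _; rewrite [index_enum _]unlock -enumT size_enum_ord.
rewrite coef_sum; apply: eq_bigr => i _; rewrite coefCM mulrC; congr (_ * _).
rewrite /q horner_prod; apply: eq_bigr => p _.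
by rewrite !hornerE !mxE mulrC.
Qed.
End Operators.

(** * GL-submodules, orthogonal projections and complements *)

Section Submodules.
Context (d n : nat) (V : lmodType rat) (fr : frame d n V).
Local Notation I := {ffun 'I_n -> 'I_d}.
Local Notation cf := (fc fr).
Local Notation thom := (thom fr).
Local Notation ip := (ip fr).
Local Notation plc := (plc fr).
Local Notation lmx := (lmx fr).
Local Notation dmx := (dmx fr).
Local Notation gact := (gact fr).
Local Notation M_ := 'M[rat]_d.
Implicit Types (x y z : V) (v w : I) (X Y : M_) (B C : 'I_n -> M_) (s : 'S_n).
Implicit Types (U W : V -> Prop).

Lemma unitmx_delta (i j : 'I_d) (t : rat) : 0 < t ->
  (1%:M + t *: delta_mx i j : M_) \in unitmx.
Proof.
(* On the diagonal the inverse requires [s + t + t s = 0]; off the diagonal the matrix unit squares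
   to zero. *)
move=> t0; pose s : rat := if i == j then - t / (1 + t) else - t.
have t1 : 1 + t != 0 by rewrite gt_eqF // ltr_pwDr.
have [] // := @mulmx1_unit _ _ (1%:M + t *: delta_mx i j) (1%:M + s *: delta_mx i j).
rewrite mulmxDl mulmxDr mul1mx mulmxDr mulmx1 mul1mx.
rewrite -scalemxAl -scalemxAr mul_delta_mx_cond scalerA -addrA [j == i]eq_sym.
rewrite /s; case: eqP => _; rewrite ?mulr0n ?mulr1n ?scaler0 ?addr0 -?scalerDl.
  have -> : - t / (1 + t) + (t + t * (- t / (1 + t))) = 0 by field.
  by rewrite scale0r addr0.
by rewrite addNr scale0r addr0.
Qed.

Definition gsub U : Prop :=
  [/\ vsub U, forall x, U x -> thom x
    & forall M, M \in unitmx -> forall x, U x -> U (gact M x)].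

Lemma gact_lin M : lin (gact M). Proof. exact: pmx_lin. Qed.

Lemma gact_comp M N x : gact M (gact N x) = gact (M *m N) x.
Proof. exact: pmx_comp. Qed.

Lemma gact1 x : thom x -> gact 1%:M x = x.
Proof. exact: pmx_one. Qed.

Lemma gact_adj M x y : ip (gact M x) y = ip x (gact M^T y).
Proof. exact: pmx_adj. Qed.

Lemma hom_gact M x : thom (gact M x). Proof. exact: hom_pmx. Qed.

Lemma plc_gact s M x : plc s (gact M x) = gact M (plc s x).
Proof. by rewrite /gact plc_pmx. Qed.

Lemma gact_dmx M x : thom x -> gact M x = (n`!)%:R^-1 *: dmx (fun _ => M) x.
Proof.
move=> hx; rewrite dmx_const scalerA mulVf ?scale1r //.
by rewrite pnatr_eq0 -lt0n fact_gt0.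
Qed.

Lemma lmx_deltas X x : lmx X x = \sum_i \sum_j X i j *: lmx (delta_mx i j) x.
Proof.
rewrite {1}[X]matrix_sum_delta (lin_sum (lmx_linX fr x)); apply: eq_bigr => i _.
rewrite (lin_sum (lmx_linX fr x)); apply: eq_bigr => j _.
by rewrite (linZ (lmx_linX fr x)).
Qed.

Section Equivariance.
Context (U : V -> Prop) (gU : gsub U).

(** [X] is first split into matrix units, since [1 + t X] may be singular at an interpolation
    node. *)
Lemma gsub_lmx X x : U x -> U (lmx X x).
Proof.
case: gU => Us Uh Um Ux; rewrite lmx_deltas.
apply: (sub_lin Us) => i _; apply: (sub_lin Us) => j _; apply: (subZ Us).
have [c _ ->] := lmx_gact fr; last exact: Uh.
apply: (sub_lin Us) => k _; apply: (subZ Us); apply: Um => //.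
by apply: unitmx_delta; rewrite ltr0n.
Qed.

Lemma gsub_dmx B x : U x -> U (dmx B x).
Proof.
case: (gU) => Us Uh _.
apply: (dmx_closure (Q := fun F => forall x, U x -> U (F x))) => //.
- by move=> F G QF e z Uz; rewrite -e; [apply: QF|apply: Uh].
- by move=> a F G QF QG z Uz; apply: Us.2; [apply: QF|apply: QG].
- by move=> X F QF z Uz; apply: gsub_lmx; apply: QF.
Qed.

(** Covers singular [M], in particular coordinate projections, because [gact M] is a multiple of a
    symmetrised operator. *)
Lemma gsub_gact M x : U x -> U (gact M x).
Proof.
case: (gU) => Us Uh _ Ux; rewrite gact_dmx; last exact: Uh.
by apply: (subZ Us); apply: gsub_dmx.
Qed.

Context (f : V -> V) (f_lin : forall (a : rat) x y, U x -> U y -> f (a *: x + y) = a *: f x + f y)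
  (f_act : forall M, M \in unitmx -> forall x, U x -> f (gact M x) = gact M (f x))
  (f_hom : forall x, U x -> thom (f x)).

Lemma on0 : f 0 = 0.
Proof.
case: (gU) => [[U0 _]] _ _; have := f_lin (-1) U0 U0.
by rewrite scaler0 addr0 scaleN1r addNr.
Qed.

Lemma on_sum J (r : seq J) (c : J -> rat) (F : J -> V) : (forall i, U (F i)) ->
  f (\sum_(i <- r) c i *: F i) = \sum_(i <- r) c i *: f (F i).
Proof.
case: (gU) => Us _ _ UF; elim: r => [|i r IH]; first by rewrite !big_nil on0.
rewrite !big_cons f_lin ?IH //.
by apply: (sub_lin Us) => j _; apply: (subZ Us).
Qed.

Lemma on_lmx X x : U x -> f (lmx X x) = lmx X (f x).
Proof.
move=> Ux; case: (gU) => Us Uh Um.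
have fd i j : f (lmx (delta_mx i j) x) = lmx (delta_mx i j) (f x).
  have [c _ e] := lmx_gact fr; rewrite !e; [|exact: f_hom|exact: Uh].
  have u (k : nat) : (1%:M + k.+1%:R *: delta_mx i j : M_) \in unitmx.
    by apply: unitmx_delta; rewrite ltr0n.
  rewrite on_sum => [|k]; last by apply: Um.
  by apply: eq_bigr => k _; rewrite f_act.
rewrite !lmx_deltas.
have Uij i j : U (lmx (delta_mx i j) x) by apply: gsub_lmx.
transitivity (\sum_i 1 *: f (\sum_j X i j *: lmx (delta_mx i j) x)).
  rewrite -on_sum => [|i]; last by apply: (sub_lin Us) => j _; apply: (subZ Us).
  by congr f; apply: eq_bigr => i _; rewrite scale1r.
apply: eq_bigr => i _; rewrite scale1r on_sum //.
by apply: eq_bigr => j _; rewrite fd.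
Qed.

(** The induction carries stability of [U] along with commutation, since [f] is linear on [U]
    only. *)
Lemma on_dmx B x : U x -> f (dmx B x) = dmx B (f x).
Proof.
case: (gU) => Us Uh _ Ux.
have [] : (forall y, U y -> U (dmx B y)) /\ (forall y, U y -> f (dmx B y) = dmx B (f y));
  last by move=> _; apply.
apply: (dmx_closure (Q := fun F =>
  (forall y, U y -> U (F y)) /\ (forall y, U y -> f (F y) = F (f y)))) => //.
- move=> F G [QF Qf] e; split=> y Uy; rewrite -!e; by [apply: QF|apply: Uh|apply: Qf|apply: f_hom].
- move=> a F G [QF Qf] [QG Qg]; split=> y Uy; first by apply: Us.2; [apply: QF|apply: QG].
  by rewrite f_lin ?Qf ?Qg //; [apply: QF|apply: QG].
- move=> X F [QF Qf]; split=> y Uy; first by apply: gsub_lmx; apply: QF.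
  by rewrite on_lmx ?Qf //; apply: QF.
Qed.

Lemma on_gact M x : U x -> f (gact M x) = gact M (f x).
Proof.
move=> Ux; case: (gU) => Us Uh _.
rewrite !gact_dmx; [|exact: f_hom|exact: Uh].
have Ud : U (dmx (fun _ => M) x) by apply: gsub_dmx.
by rewrite -[_ *: _ in LHS]addr0 f_lin ?on0 ?addr0 ?on_dmx //; case: Us.
Qed.
End Equivariance.

Definition is_proj U (F : V -> V) : Prop :=
  [/\ lin F, forall x, U (F x) & forall x u, U u -> ip (x - F x) u = 0].

(** Gram-Schmidt, by induction on a list of words outside of which the coordinates vanish on [U].
    The elements of [U] with zero coordinate at [w] form a subspace of codimension at most one; the
    projection onto it is corrected along one vector [e] orthogonal to it. *)
Lemma proj_exists U : vsub U -> (forall x, U x -> thom x) -> exists F, is_proj U F.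
Proof.
move=> Us Uh.
suff : forall (L : seq I) U, vsub U -> (forall x, U x -> thom x) ->
    (forall x, U x -> forall w, w \notin L -> cf x w = 0) -> exists F, is_proj U F.
  by move/(_ (enum I) U); apply => // x Ux w; rewrite mem_enum.
move=> {Us Uh U}; elim=> [|w L IH] U Us Uh supp.
  exists (fun _ => 0); split=> [a x y|x|x u Uu]; first by rewrite scaler0 addr0.
    by case: Us.
  have -> : u = 0; last exact: (lin0 (ip_linr fr _)).
  by apply: (cf_inj (Uh u Uu) (proj1 (hom_sub fr))) => v; rewrite cf0 (supp u).
pose U' x := U x /\ cf x w = 0.
have U's : vsub U' by apply: sub_and => //; apply: (sub_zero (cf_lin fr w)).
have [||F' [F'l F'U F'o]] := IH U' U's.
- by move=> x [/Uh].
- move=> x [Ux xw] v vL; case: (eqVneq v w) => [->//|vw].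
  by apply: supp; rewrite // inE negb_or vw.
case: (classic (exists2 x0, U x0 & cf x0 w <> 0)) => [[x0 Ux0 x0w]|no]; last first.
  exists F'; split=> // [x|x u Uu]; first by case: (F'U x).
  by apply: F'o; split=> //; apply: NNPP => h; apply: no; exists u.
pose e := x0 - F' x0.
have [UF F'w] := F'U x0.
have Ue : U e by apply: (subB Us).
have ew : cf e w != 0 by rewrite cfB F'w subr0; apply/eqP.
have ee : ip e e != 0.
  apply: contra_neq ew => /(ip_eq0 (Uh e Ue)) ->; exact: cf0.
exists (fun x => F' x + (ip x e / ip e e) *: e); split=> [||x u Uu].
- apply: lin_add => // a x y; rewrite (ip_linl fr e a x y) scalerA -scalerDl.
  by rewrite mulrDl -mulrA.
- by move=> x; apply: (subD Us); [case: (F'U x)|apply: (subZ Us)].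
pose c := cf u w / cf e w; pose u' := u - c *: e.
have U'u : U' u'.
  split; first by apply: (subB Us) => //; apply: (subZ Us).
  by rewrite cfB cfZ divfK // subrr.
have -> : u = c *: e + u' by rewrite addrC subrK.
have Fe : ip (F' x) e = 0 by rewrite ipC; apply: F'o.
have h1 := F'o x u' U'u; have h2 : ip e u' = 0 := F'o x0 u' U'u.
rewrite opprD addrA ipDr ipZr !(ipBl _ (x - F' x)) !ipZl h1 h2 mulr0 subrr addr0.
by rewrite ipBl Fe subr0 divfK // subrr mulr0.
Qed.

Section Projection.
Context (U : V -> Prop) (Us : vsub U) (Uh : forall x, U x -> thom x).
Context (F : V -> V) (pF : is_proj U F).

Lemma proj_self x : U x -> F x = x.
Proof.
case: pF => Fl FU Fo Ux.
have UxF : U (x - F x) by apply: (subB Us).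
by have /subr0_eq := ip_eq0 (Uh UxF) (Fo x _ UxF).
Qed.

Lemma proj_ip x u : U u -> ip (F x) u = ip x u.
Proof. by case: pF => Fl FU Fo Uu; have := Fo x u Uu; rewrite ipBl => /subr0_eq. Qed.

Lemma proj_eq x y : U y -> (forall u, U u -> ip x u = ip y u) -> F x = y.
Proof.
case: pF => Fl FU Fo Uy e.
have Ud : U (F x - y) by apply: (subB Us).
have := ip_eq0 (Uh Ud); rewrite {1}ipBl proj_ip // e // subrr => /(_ erefl).
exact: subr0_eq.
Qed.
End Projection.

(** The adjoint of [gact M] is [gact M^T], which preserves [U] as well. *)
Lemma proj_gact U F M x : gsub U -> is_proj U F -> F (gact M x) = gact M (F x).
Proof.
move=> gU pF; case: (gU) => Us Uh _; apply: (proj_eq Us Uh pF).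
  by apply: gsub_gact => //; case: pF.
move=> u Uu; rewrite !gact_adj (proj_ip pF) //.
exact: gsub_gact.
Qed.

Definition perp U x : Prop := thom x /\ forall u, U u -> ip x u = 0.

Lemma perp_gsub U : gsub U -> gsub (perp U).
Proof.
move=> gU; split.
- apply: sub_and; first exact: hom_sub.
  by apply: sub_all => u; apply: sub_imp; apply: (sub_zero (ip_linl fr u)).
- by move=> x [].
- move=> M _ x [hx ox]; split; first exact: hom_gact.
  by move=> u Uu; rewrite gact_adj ox //; apply: gsub_gact.
Qed.

Lemma gsub_and U W : gsub U -> gsub W -> gsub (fun x => U x /\ W x).
Proof.
move=> [Us Uh Um] [Ws Wh Wm]; split; first exact: sub_and.
  by move=> x [/Uh].
by move=> M uM x [Ux Wx]; split; [apply: Um|apply: Wm].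
Qed.

Lemma perp_self U x : U x -> perp U x -> x = 0.
Proof. by move=> Ux [hx ox]; apply: (ip_eq0 hx); apply: ox. Qed.

(* If gl = s + b with s^T killing x and b preserving N, then U(gl) N is       *)
(* spanned by N modulo the image of s (commute the b-factors to the right).   *)
Lemma dmx_orth (S b : M_ -> Prop) x (N : V -> Prop) :
  (forall X, exists Y Z, [/\ S Y, b Z & X = Y + Z]) ->
  (forall Y, S Y -> lmx Y^T x = 0) ->
  (forall Z z, b Z -> N z -> N (lmx Z z)) ->
  (forall z, N z -> thom z) -> (forall z, N z -> ip x z = 0) ->
  forall B z, N z -> ip x (dmx B z) = 0.
Proof.
move=> dec Sx bN Nh Nx B z Nz.
pose E (L : seq M_) y := foldr lmx y L.
have El L : lin (E L).
  by elim: L => [//|X L IH]; apply: (lin_comp (lmx_lin fr X) IH).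
have main k : forall L y, (size L < k)%N -> N y -> ip x (E L y) = 0.
  elim: k => // k IH [|X L] y; first by move=> _; apply: Nx.
  rewrite /= ltnS => sL Ny.
  have [Y [Z [SY bZ ->]]] := dec X.
  rewrite (linD (lmx_linX fr _)) ipDr.
  have -> : ip x (lmx Y (E L y)) = 0 by rewrite -[Y]trmxK -lmx_adj Sx // ip0l.
  rewrite add0r.
  (* The factor [Z] is moved to the right, past [L2]. Each commutator replaces two matrices by one,
     so it falls under [IH]; once [Z] reaches [y] it is absorbed in [N]. *)
  suff inner L2 : forall L1, (size L1 + size L2 < k)%N ->
    ip x (E L1 (lmx Z (E L2 y))) = 0 by apply: (inner L [::]).
  elim: L2 => [|X' L2 IH2] L1 /= s12.
    by apply: IH; [rewrite addn0 in s12|apply: bN].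
  rewrite lmx_comm (linD (El L1)) ipDr.
  have -> : E L1 (lmx X' (lmx Z (E L2 y))) = E (rcons L1 X') (lmx Z (E L2 y)).
    by rewrite /E foldr_rcons.
  rewrite IH2 ?add0r; last by rewrite size_rcons addSnnS.
  have -> A : E L1 (lmx A (E L2 y)) = E (L1 ++ A :: L2) y by rewrite /E foldr_cat.
  by apply: IH; rewrite ?size_cat.
pose Q y := thom y /\ forall L, ip x (E L y) = 0.
have Qs : vsub Q.
  apply: sub_and; first exact: hom_sub.
  by apply: sub_all => L; apply: (sub_pre (El L) (sub_zero (ip_linr fr x))).
have /(_ B z) : forall B y, Q y -> Q (dmx B y).
  move=> C; apply: (dmx_closure (Q := fun F => forall y, Q y -> Q (F y))) => //.
  - by move=> F G QF e y Qy; rewrite -e; [apply: QF|case: Qy].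
  - by move=> a F G QF QG y Qy; apply: Qs.2; [apply: QF|apply: QG].
  - move=> X F QF y Qy; have [_ h] := QF y Qy; split; first exact: hom_lmx.
    by move=> L; have := h (rcons L X); rewrite /E foldr_rcons.
case=> [|_ /(_ [::])] //; split; first exact: Nh.
by move=> L; apply: (main (size L).+1).
Qed.

End Submodules.

(** * Weights and Schur modules *)

Section Weights.
Context (d n : nat) (V : lmodType rat) (fr : frame d n V).
Local Notation I := {ffun 'I_n -> 'I_d}.
Local Notation wd := (fe fr).
Local Notation cf := (fc fr).
Local Notation thom := (thom fr).
Local Notation lmx := (lmx fr).
Local Notation dmx := (dmx fr).
Local Notation gact := (gact fr).
Local Notation gsub := (gsub fr).
Local Notation M_ := 'M[rat]_d.
Implicit Types (x y z : V) (u v w : I) (s : 'S_n) (U W : V -> Prop).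

Definition hw x : Prop := forall i j : 'I_d, (i < j)%N -> lmx (delta_mx i j) x = 0.

(** A weight is represented by any word with the right content, up to place permutation. *)
Definition wtp w v : bool := [exists s : 'S_n, v == fcomp w s].
Definition wt w x : Prop := thom x /\ forall v, cf x v != 0 -> wtp w v.

(** A linear function of the weight that every raising operator strictly increases; it stands in for
    the dominance order. *)
Definition ht w : nat := \sum_p (d - w p).
Definition cnt w (i : 'I_d) : nat := #|[pred p | w p == i]|.

Lemma wtp_refl w : wtp w w.
Proof. by apply/existsP; exists 1%g; rewrite fcomp1. Qed.

Lemma wtp_sym w v : wtp w v -> wtp v w.
Proof.
by move=> /existsP [s /eqP ->]; apply/existsP; exists s^-1%g; rewrite fcompK.
Qed.

Lemma wtp_trans w v u : wtp w v -> wtp v u -> wtp w u.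
Proof.
move=> /existsP [s /eqP ->] /existsP [t /eqP ->].
by apply/existsP; exists (t * s)%g; rewrite fcompM.
Qed.

Lemma ht_wtp w v : wtp w v -> ht v = ht w.
Proof.
move=> /existsP [s /eqP ->]; rewrite /ht [RHS](reindex_inj (@perm_inj _ s)).
by apply: eq_bigr => p _; rewrite ffunE.
Qed.

Lemma ht_le w : (ht w <= n * d)%N.
Proof.
rewrite /ht -[n in (n * _)%N]card_ord -sum_nat_const; apply: leq_sum => p _.
exact: leq_subr.
Qed.

Lemma neq0_cf x : thom x -> x <> 0 -> exists v, cf x v != 0.
Proof.
move=> hx nx; apply: NNPP => h; apply: nx.
apply: (cf_inj hx (proj1 (hom_sub fr))) => v; rewrite cf0.
by apply/eqP; apply: contra_notT h => ?; exists v.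
Qed.

Lemma cf_image (F : V -> V) x v : lin F -> thom x -> cf (F x) v != 0 ->
  exists2 u, cf x u != 0 & cf (F (wd u)) v != 0.
Proof.
move=> Fl hx; rewrite -{1}hx /mk (lin_sum Fl) cf_sum => ne.
apply: NNPP => h; move: ne; rewrite big1 ?eqxx // => u _.
rewrite (linZ Fl) cfZ; apply/eqP; rewrite mulf_eq0.
apply: contra_notT h; rewrite negb_or => /andP [? ?]; by exists u.
Qed.

(** Up to the order of the stabiliser of [w], the projection onto the weight space of [w]; being a
    [dmx], it preserves GL-submodules. *)
Definition wproj w x : V := dmx (fun p => delta_mx (w p) (w p)) x.

Lemma wproj_lin w : lin (wproj w). Proof. exact: dmx_lin. Qed.

Lemma wproj_wd w u :
  wproj w (wd u) = (#|[pred s : 'S_n | fcomp w s == u]|)%:R *: wd u.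
Proof.
rewrite /wproj dmx_delta_wd scaler_nat -sumr_const.
by apply: eq_bigr => s /eqP ->.
Qed.

Lemma cf_wproj w x v : thom x ->
  cf (wproj w x) v = (#|[pred s : 'S_n | fcomp w s == v]|)%:R * cf x v.
Proof.
move=> hx; rewrite -{1}hx /mk (lin_sum (wproj_lin w)) cf_sum.
rewrite (bigD1 v) //= big1 => [|u uv]; rewrite (linZ (wproj_lin w)) wproj_wd !cfZ cf_wd.
  by rewrite eqxx mulr1 addr0 mulrC.
by rewrite (negPf uv) !mulr0.
Qed.

Lemma wproj_wt w x : thom x -> wt w (wproj w x).
Proof.
move=> hx; split=> [|v]; first exact: hom_dmx.
rewrite cf_wproj // mulf_eq0 negb_or pnatr_eq0 -lt0n => /andP [/card_gt0P [s]].
by rewrite inE => /eqP <- _; apply/existsP; exists s.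
Qed.

Lemma wproj_cf w x : thom x -> cf x w != 0 -> cf (wproj w x) w != 0.
Proof.
move=> hx xw; rewrite cf_wproj // mulf_neq0 // pnatr_eq0 -lt0n.
by apply/card_gt0P; exists 1%g; rewrite inE fcomp1.
Qed.

Definition lperm (t : {perm 'I_d}) : M_ := \matrix_(a, b) (a == t b)%:R.

Lemma cf_lperm t x w : cf (gact (lperm t) x) [ffun p => t (w p)] = cf x w.
Proof.
rewrite cf_mk; rewrite (bigD1 w) //= [X in X * _]big1 => [|p _]; last first.
  by rewrite mxE ffunE eqxx.
rewrite mul1r big1 ?addr0 // => v vw.
have /existsP [p ne_p] : [exists p, v p != w p].
  apply: contraR vw; rewrite negb_exists => /forallP h.
  by apply/eqP/ffunP => p; have := h p; rewrite negbK => /eqP.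
rewrite (bigD1 p) //= mxE ffunE (inj_eq perm_inj) eq_sym (negPf ne_p).
by rewrite !mul0r.
Qed.

Lemma ht_swap (i j : 'I_d) w : (i < j)%N ->
  (ht [ffun p => tperm i j (w p)] + cnt w i * (j - i) = ht w + cnt w j * (j - i))%N.
Proof.
move=> ij; rewrite /cnt -!sum1_card !big_distrl /=.
rewrite (big_mkcond [pred p | w p == i]) (big_mkcond [pred p | w p == j]) /=.
rewrite /ht -!big_split /=; apply: eq_bigr => p _; rewrite ffunE !mul1n.
have ne : (i == j) = false by apply/eqP => e; rewrite e ltnn in ij.
have jd := ltn_ord j.
have [->|wi] := eqVneq (w p) i.
  by rewrite tpermL ne; lia.
have [->|wj] := eqVneq (w p) j; first by rewrite tpermR; lia.
by rewrite tpermD // eq_sym.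
Qed.

(** Take a word of maximal [ht] among those occurring in [U] and project onto its weight space. A
    nonzero raised vector would exceed the maximum, and so would exchanging two letters if the
    content were not decreasing. *)
Lemma hw_exists U : gsub U -> (exists2 x, U x & x <> 0) ->
  exists w y, [/\ U y, cf y w != 0, wt w y, hw y
    & forall i j : 'I_d, (i < j)%N -> (cnt w j <= cnt w i)%N].
Proof.
move=> gU [x0 Ux0 nx0]; have [Us Uh _] := gU.
have [w0 xw0] := neq0_cf (Uh _ Ux0) nx0.
have [w [x [Ux xw wmax]]] : exists w x, [/\ U x, cf x w != 0 &
    forall w' x', U x' -> cf x' w' != 0 -> (ht w' <= ht w)%N].
  have [k] := ubnP (n * d - ht w0)%N.
  elim: k w0 x0 Ux0 xw0 {nx0} => // k IH w x Ux xw lek.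
  have [|] := classic (forall w' x', U x' -> cf x' w' != 0 -> (ht w' <= ht w)%N).
    by move=> h; exists w, x.
  move=> h; apply: NNPP => nex; apply: h => w' x' Ux' xw'.
  rewrite leqNgt; apply/negP => lt; apply: nex; apply: IH Ux' xw' _.
  by have := ht_le w'; lia.
have hx := Uh _ Ux.
have Uy : U (wproj w x) by apply: gsub_dmx.
exists w, (wproj w x); split=> //; [exact: wproj_cf|exact: wproj_wt| |].
- move=> i j ij; apply: NNPP => ne.
  have [v rv] := neq0_cf (hom_lmx fr _ _) ne.
  have [u yu] := cf_image (lmx_lin fr _) (hom_dmx fr _ _) rv.
  rewrite lmx_delta_wd cf_sum => ru.
  have [p /eqP up e] : exists2 p, u p == j & v = [ffun q => if q == p then i else u q].
    apply: NNPP => h; move: ru; rewrite big1 ?eqxx // => p up.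
    by rewrite cf_wd; case: eqP => // e; case: h; exists p.
  have := wmax v _ (gsub_lmx gU (delta_mx i j) Uy) rv.
  rewrite -(ht_wtp ((wproj_wt w hx).2 u yu)) leqNgt => /negP; apply.
  rewrite /ht e (bigD1 p) //= [X in (_ < X)%N](bigD1 p) //= ffunE eqxx up.
  rewrite [X in (_ < _ + X)%N](eq_bigr (fun q => d - u q)%N) => [|q /negPf qp].
    by rewrite ltn_add2r; have := ltn_ord j; lia.
  by rewrite ffunE qp.
- move=> i j ij.
  have := wmax [ffun p => tperm i j (w p)] _ (gsub_gact gU (lperm (tperm i j)) Ux).
  rewrite cf_lperm => /(_ xw) le.
  have := ht_swap w ij; have : (0 < j - i)%N by rewrite subn_gt0.
  by move=> lt0 e; rewrite -(leq_pmul2r lt0); lia.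
Qed.
End Weights.

(** * Row and column symmetrizers *)

Section Young.
Context (d n : nat) (V : lmodType rat) (fr : frame d n V).
Context (c : seq nat) (hn : sumn c = n).
Local Notation I := {ffun 'I_n -> 'I_d}.
Local Notation wd := (fe fr).
Local Notation thom := (thom fr).
Local Notation ip := (ip fr).
Local Notation plc := (plc fr).
Local Notation lmx := (lmx fr).
Local Notation dmx := (dmx fr).
Local Notation gact := (gact fr).
Local Notation gsub := (gsub fr).
Local Notation M_ := 'M[rat]_d.
Implicit Types (x y z : V) (v w : I) (s : 'S_n) (U W : V -> Prop).

(** [row_group] and [col_group] inside ['S_n], where [n] is only propositionally equal to [sumn c];
    this lets [n] be [k.+2]. *)
Definition rows : {set 'S_n} :=
  [set s : 'S_n | [forall p, reshape_index c (s p) == reshape_index c p]].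
Definition cols : {set 'S_n} :=
  [set s : 'S_n | [forall p, reshape_offset c (s p) == reshape_offset c p]].

Lemma rowsP s : reflect (forall p, reshape_index c (s p) = reshape_index c p) (s \in rows).
Proof. by rewrite inE; apply: (iffP forallP) => h p; apply/eqP/h. Qed.

Lemma colsP s : reflect (forall p, reshape_offset c (s p) = reshape_offset c p) (s \in cols).
Proof. by rewrite inE; apply: (iffP forallP) => h p; apply/eqP/h. Qed.

Lemma rowsM s t : s \in rows -> t \in rows -> (s * t)%g \in rows.
Proof. by move=> /rowsP hs /rowsP ht; apply/rowsP => p; rewrite permM ht hs. Qed.
Lemma colsM s t : s \in cols -> t \in cols -> (s * t)%g \in cols.
Proof. by move=> /colsP hs /colsP ht; apply/colsP => p; rewrite permM ht hs. Qed.
Lemma rowsV s : s \in rows -> s^-1%g \in rows.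
Proof. by move=> /rowsP hs; apply/rowsP => p; rewrite -hs permKV. Qed.
Lemma colsV s : s \in cols -> s^-1%g \in cols.
Proof. by move=> /colsP hs; apply/colsP => p; rewrite -hs permKV. Qed.
Lemma rowsVE s : (s^-1%g \in rows) = (s \in rows).
Proof. by apply/idP/idP => /rowsV; rewrite ?invgK. Qed.
Lemma colsVE s : (s^-1%g \in cols) = (s \in cols).
Proof. by apply/idP/idP => /colsV; rewrite ?invgK. Qed.
Lemma rowsMl s t : t \in rows -> ((t * s)%g \in rows) = (s \in rows).
Proof.
move=> ht; apply/idP/idP => h; last exact: rowsM.
by rewrite -[s](mulKg t) rowsM // rowsV.
Qed.
Lemma colsMr s t : t \in cols -> ((s * t)%g \in cols) = (s \in cols).
Proof.
move=> ht; apply/idP/idP => h; last exact: colsM.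
by rewrite -[s](mulgK t) colsM // colsV.
Qed.

Definition symm x : V := \sum_(s in rows) plc s x.
Definition asym x : V := \sum_(s in cols) (-1) ^+ odd_perm s *: plc s x.

Lemma symm_lin : lin symm.
Proof.
move=> a x y; rewrite scaler_sumr -big_split; apply: eq_bigr => s _.
exact: plc_lin.
Qed.

Lemma asym_lin : lin asym.
Proof.
move=> a x y; rewrite scaler_sumr -big_split; apply: eq_bigr => s _.
by rewrite (plc_lin fr) scalerDr !scalerA mulrC.
Qed.

Lemma plc_symm s x : s \in rows -> plc s (symm x) = symm x.
Proof.
move=> hs; rewrite (lin_sum (plc_lin fr s)) [RHS](reindex_inj (mulgI s)).
by apply: eq_big => t; rewrite ?rowsMl // plcM.
Qed.

Lemma plc_asym s x : s \in cols -> asym (plc s x) = (-1) ^+ odd_perm s *: asym x.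
Proof.
move=> hs; rewrite /asym scaler_sumr [RHS](reindex_inj (mulIg s)).
apply: eq_big => t.
  by rewrite colsMr.
by move=> _; rewrite plcM odd_permM signr_addb scalerA mulrCA -signr_addb addbb mulr1.
Qed.

Lemma symm_symm x : symm (symm x) = (#|rows|)%:R *: symm x.
Proof.
rewrite {1}/symm scaler_nat -sumr_const; apply: eq_bigr => s hs.
exact: plc_symm.
Qed.

Lemma asym_asym x : asym (asym x) = (#|cols|)%:R *: asym x.
Proof.
rewrite [asym x in LHS]/asym (lin_sum asym_lin) scaler_nat -sumr_const.
apply: eq_bigr => s hs; rewrite (linZ asym_lin) plc_asym // scalerA.
by rewrite -signr_addb addbb scale1r.
Qed.

Lemma symm_adj x y : ip (symm x) y = ip x (symm y).
Proof.
rewrite (lin_sum (ip_linl fr y)) (lin_sum (ip_linr fr x)).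
rewrite [RHS](reindex_inj invg_inj) /=; apply: eq_big => s; rewrite ?rowsVE //.
by rewrite plc_adj.
Qed.

Lemma asym_adj x y : ip (asym x) y = ip x (asym y).
Proof.
rewrite (lin_sum (ip_linl fr y)) (lin_sum (ip_linr fr x)).
rewrite [RHS](reindex_inj invg_inj) /=; apply: eq_big => s; rewrite ?colsVE //.
by move=> _; rewrite ipZl ipZr plc_adj odd_permV.
Qed.

Lemma symm_comm (F : V -> V) x : lin F -> (forall s y, plc s (F y) = F (plc s y)) ->
  symm (F x) = F (symm x).
Proof. by move=> Fl Fc; rewrite (lin_sum Fl); apply: eq_bigr => s _. Qed.

Lemma asym_comm (F : V -> V) x : lin F -> (forall s y, plc s (F y) = F (plc s y)) ->
  asym (F x) = F (asym x).
Proof.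
by move=> Fl Fc; rewrite (lin_sum Fl); apply: eq_bigr => s _; rewrite Fc (linZ Fl).
Qed.

Lemma hom_symm x : thom (symm x).
Proof. by apply: (sub_lin (hom_sub fr)) => s _; apply: hom_plc. Qed.
Lemma hom_asym x : thom (asym x).
Proof.
by apply: (sub_lin (hom_sub fr)) => s _; apply: (subZ (hom_sub fr)); apply: hom_plc.
Qed.

Definition ysym x : V := symm (asym x).
Lemma ysym_lin : lin ysym. Proof. exact: lin_comp symm_lin asym_lin. Qed.
Lemma hom_ysym x : thom (ysym x). Proof. exact: hom_symm. Qed.

Lemma ysym_comm (F : V -> V) x : lin F -> (forall s y, plc s (F y) = F (plc s y)) ->
  ysym (F x) = F (ysym x).
Proof. by move=> Fl Fc; rewrite /ysym (asym_comm _ Fl Fc) (symm_comm _ Fl Fc). Qed.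

Lemma ysym_lmx X x : ysym (lmx X x) = lmx X (ysym x).
Proof. by apply: ysym_comm => [|s y]; [exact: lmx_lin|exact: plc_lmx]. Qed.
Lemma ysym_dmx B x : ysym (dmx B x) = dmx B (ysym x).
Proof. by apply: ysym_comm => [|s y]; [exact: dmx_lin|exact: plc_dmx]. Qed.
Lemma ysym_gact M x : ysym (gact M x) = gact M (ysym x).
Proof. by apply: ysym_comm => [|s y]; [exact: gact_lin|exact: plc_gact]. Qed.

Definition schurS x : Prop := exists2 y, thom y & x = ysym y.
(** The row-invariant tensors, that is [Sym^{c_1} (x) Sym^{c_2} (x) ..], which contain the Schur
    module. *)
Definition rsym x : Prop := thom x /\ symm x = (#|rows|)%:R *: x.

Lemma schurS_gsub : gsub schurS.
Proof.
split.
- split; first by exists 0; [case: (hom_sub fr)|rewrite (lin0 ysym_lin)].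
  move=> a x y [x' hx ->] [y' hy ->]; exists (a *: x' + y'); last by rewrite ysym_lin.
  by case: (hom_sub fr) => _; apply.
- by move=> x [y _ ->]; apply: hom_ysym.
- by move=> M _ x [y hy ->]; exists (gact M y); [exact: hom_gact|rewrite ysym_gact].
Qed.

Lemma schurS_rsym x : schurS x -> rsym x.
Proof. by move=> [y _ ->]; split; [exact: hom_ysym|exact: symm_symm]. Qed.

Lemma rows_neq0 : (#|rows|)%:R != 0 :> rat.
Proof.
rewrite pnatr_eq0 -lt0n; apply/card_gt0P; exists 1%g; apply/rowsP => p.
by rewrite perm1.
Qed.
(* im A = im (A A* ) for A = ysym, with A* = asym symm. *)
Lemma schurS_symm x : schurS x -> exists2 y, thom y & x = ysym (symm y).
Proof.
pose U x := exists2 y, thom y & x = ysym (symm y).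
have Us : vsub U.
  split; first by exists 0; [case: (hom_sub fr)|rewrite (lin0 symm_lin) (lin0 ysym_lin)].
  move=> a y z [y' hy ->] [z' hz ->]; exists (a *: y' + z').
    by case: (hom_sub fr) => _; apply.
  by rewrite symm_lin ysym_lin.
have Uh z : U z -> thom z by move=> [y _ ->]; apply: hom_ysym.
have [F [Fl FU Fo]] := proj_exists Us Uh.
move=> [x' hx' ->]; set x0 := ysym x'; pose r := x0 - F x0.
have [y hy e] := FU x0.
have rE : r = ysym (x' - symm y) by rewrite (linB ysym_lin) -e.
have hr : thom r by rewrite rE; apply: hom_ysym.
have h0 : asym (symm r) = 0.
  apply: (ip_eq0 (hom_asym _)).
  rewrite asym_adj asym_asym ipZr symm_adj -/(ysym _).
  by rewrite Fo ?mulr0 //; exists r.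
have r0 : r = 0.
  apply: (ip_eq0 hr); rewrite {1}rE symm_adj asym_adj h0; exact: ip0r.
by exists y => //; rewrite -e; apply: subr0_eq.
Qed.

(** The transposition of [p] and [q] is an odd element of the column group fixing the word, so the
    antisymmetrized word is its own opposite. *)
Lemma asym_coll w (p q : 'I_n) : p != q ->
  reshape_offset c p = reshape_offset c q -> w p = w q -> asym (wd w) = 0.
Proof.
move=> pq epq ew; set t := tperm p q.
have tc : t \in cols.
  by apply/colsP => r; rewrite /t; case: tpermP => [->|->|].
have tw : fcomp w t = w.
  by apply/ffunP => r; rewrite ffunE /t; case: tpermP => [->|->|].
have := plc_asym (wd w) tc; rewrite plc_wd tw odd_tperm pq expr1 scaleN1r.
move/eqP; rewrite -subr_eq0 opprK -mulr2n -scaler_nat scaler_eq0 pnatr_eq0 /=.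
by move/eqP.
Qed.

Lemma flatten_pos (i j : nat) : (j < nth 0 c i)%N -> exists p : 'I_n,
  [/\ val p = flatten_index c i j, reshape_index c p = i & reshape_offset c p = j].
Proof.
move=> ji; have lt : (flatten_index c i j < n)%N by rewrite -hn flatten_indexP.
by exists (Ordinal lt); rewrite /= flatten_indexKl // flatten_indexKr.
Qed.

Definition epsm (a : nat) : M_ := \matrix_(i, j) ((i == j) && (i < a)%N)%:R.

Lemma gact_epsm a w : gact (epsm a) (wd w) =
  if [forall p, (w p < a)%N] then wd w else 0.
Proof.
apply: cf_inj => [||v]; first exact: hom_gact.
  by case: ifP => _; [exact: hom_wd|case: (hom_sub fr)].
rewrite /gact pmx_wd cf_mk; case: forallP => h.
  rewrite cf_wd -prod_delta; apply: eq_bigr => p _; rewrite !mxE.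
  by case: eqP => [->|ne]; [rewrite h eqxx|rewrite eq_sym; case: eqP => // e; case: ne].
rewrite cf0; apply/eqP; rewrite prodf_seq_eq0; apply/hasP.
have /existsP [p pa] : [exists p, ~~ (w p < a)%N].
  by rewrite -negb_forall; apply/negP => /forallP.
exists p; rewrite ?mem_index_enum // mxE.
by case: (eqVneq (v p) (w p)) => [->|_]; rewrite ?(negPf pa) ?andbF.
Qed.

Lemma gact_epsm_id a x : (d <= a)%N -> thom x -> gact (epsm a) x = x.
Proof.
move=> da hx; rewrite -[RHS](gact1 hx); apply: pmx_ext => _.
by apply/matrixP => i j; rewrite !mxE (leq_trans (ltn_ord i) da) andbT.
Qed.

Lemma epsm_sym a : (epsm a)^T = epsm a.
Proof.
apply/matrixP => i j; rewrite !mxE.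
by case: (eqVneq j i) => [->|ne]; rewrite ?eqxx // eq_sym (negPf ne).
Qed.

(* The first column is longer than the available alphabet. *)
Lemma epsm_schurS a x : 0%N \notin c -> (minn a d < size c)%N -> schurS x ->
  gact (epsm a) x = 0.
Proof.
move=> c0 ac [y hy ->]; rewrite -ysym_gact.
move: y hy; apply: wd_ind.
  by apply: sub_zero; apply: lin_comp; [exact: ysym_lin|exact: gact_lin].
move=> w; rewrite gact_epsm; case: forallP => h; last exact: (lin0 ysym_lin).
rewrite /ysym; have cpos i : (i < size c)%N -> (0 < nth 0 c i)%N.
  by move=> ic; rewrite lt0n; apply: contraNneq c0 => <-; apply: mem_nth.
(* [f i] is the box of the first column in row [i]. These boxes carry fewer than [size c] letters,
   so two of them agree. *)
have cp (i : 'I_(size c)) := flatten_pos (cpos i (ltn_ord i)).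
have [f fP] := fin_all_exists cp.
have le (i : 'I_(size c)) : (w (f i) < minn a d)%N by rewrite leq_min h ltn_ord.
have /injectivePn [i1 [i2 ne e]] : ~~ injectiveb (fun i => Ordinal (le i)).
  apply: contraL ac => /injectiveP /leq_card; rewrite !card_ord.
  by rewrite -leqNgt.
have [_ r1 o1] := fP i1; have [_ r2 o2] := fP i2.
rewrite (@asym_coll w (f i1) (f i2)) ?(lin0 symm_lin) ?o1 ?o2 //.
  by apply: contraNneq ne => e'; apply/eqP/val_inj; rewrite /= -r1 -r2 e'.
by apply: val_inj; case: e.
Qed.

End Young.

(** * Highest weight vectors and irreducibility *)

Section HighestWeight.
Context (d n : nat) (V : lmodType rat) (fr : frame d n V).
Context (c : seq nat) (hn : sumn c = n) (hc : (size c <= d)%N).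
Local Notation I := {ffun 'I_n -> 'I_d}.
Local Notation wd := (fe fr).
Local Notation cf := (fc fr).
Local Notation thom := (thom fr).
Local Notation ip := (ip fr).
Local Notation lmx := (lmx fr).
Local Notation dmx := (dmx fr).
Local Notation gsub := (gsub fr).
Local Notation hw := (hw fr).
Local Notation wt := (wt fr).
Local Notation symm := (symm fr c).
Local Notation asym := (asym fr c).
Local Notation ysym := (ysym fr c).
Local Notation schurS := (schurS fr c).
Local Notation rsym := (rsym fr c).
Local Notation rows := (rows n c).
Local Notation cols := (cols n c).
Local Notation M_ := 'M[rat]_d.
Implicit Types (x y z : V) (X Y Z : M_) (v w : I) (s : 'S_n) (U W : V -> Prop).

Lemma row_letter (p : 'I_n) : (reshape_index c p < d)%N.
Proof. by apply: leq_trans hc; apply: reshape_indexP; rewrite hn. Qed.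

(** The tableau with letter [i] all along row [i]; its stabiliser is the row group. *)
Definition w0 : I := [ffun p => Ordinal (row_letter p)].

Lemma w0E p : w0 p = reshape_index c p :> nat.
Proof. by rewrite ffunE. Qed.

Lemma fcomp_w0 s : (fcomp w0 s == w0) = (s \in rows).
Proof.
apply/eqP/rowsP => [e p|h].
  by rewrite -!w0E -[in RHS]e [in RHS]ffunE.
by apply/ffunP => p; apply: val_inj; rewrite !ffunE /= h.
Qed.

(** Shows that the row-invariant tensors are generated by [w0] under the Schur algebra. *)
Lemma symm_wd w : symm (wd w) = dmx (fun p => delta_mx (w p) (w0 p)) (wd w0).
Proof.
rewrite dmx_delta_wd; apply: eq_big => s; first by rewrite fcomp_w0.
by move=> _; rewrite plc_wd.
Qed.

Lemma symm_w0 : symm (wd w0) = (#|rows|)%:R *: wd w0.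
Proof.
rewrite scaler_nat -sumr_const; apply: eq_bigr => s.
by rewrite -fcomp_w0 plc_wd => /eqP ->.
Qed.

Definition v0 : V := ysym (wd w0).

Lemma wt_v0 : wt w0 v0.
Proof.
split; first exact: hom_ysym.
have Qs : vsub (fun x => forall v, cf x v != 0 -> wtp w0 v).
  split=> [v|a x y hx hy v]; first by rewrite cf0 eqxx.
  rewrite cfP; case xv: (cf x v == 0); last by move=> _; apply: hx; rewrite xv.
  case yv: (cf y v == 0); last by move=> _; apply: hy; rewrite yv.
  by rewrite (eqP xv) (eqP yv) mulr0 addr0 eqxx.
rewrite /v0 /ysym /asym (lin_sum (symm_lin fr c)) => v; apply: (sub_lin Qs) => s _ {v}.
rewrite (linZ (symm_lin fr c)); apply: (subZ Qs) => v; move: v.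
apply: (sub_lin Qs) => t _ v; rewrite !plc_wd cf_wd.
case: (_ =P v) => [<- _|]; last by rewrite eqxx.
by rewrite fcompM; apply/existsP; exists (t * s)%g.
Qed.

(** By [schurS_symm] and [symm_wd], every element is a combination of Schur algebra operators
    applied to [v0]. *)
Lemma schurS_ind U : gsub U -> U v0 -> forall x, schurS x -> U x.
Proof.
move=> gU Uv x /(schurS_symm) [y hy ->]; have [Us _ _] := gU.
move: y hy; apply: wd_ind.
  by apply: sub_pre Us; apply: lin_comp; [exact: ysym_lin|exact: symm_lin].
by move=> w; rewrite symm_wd ysym_dmx; apply: gsub_dmx.
Qed.

Lemma lmx_upper_sum X x (Q : V -> Prop) : vsub Q ->
  (forall i j, X i j != 0 -> Q (lmx (delta_mx i j) x)) -> Q (lmx X x).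
Proof.
move=> Qs h; rewrite lmx_deltas.
apply: (sub_lin Qs) => i _; apply: (sub_lin Qs) => j _.
case: (eqVneq (X i j) 0) => [->|ne]; first by rewrite scale0r; case: Qs.
by apply: (subZ Qs); apply: h.
Qed.

(** gl is the sum of the strictly lower and the weakly upper triangular matrices; the transposes of
    the former kill highest weight vectors. *)
Definition lower (X : M_) := forall i j : 'I_d, X i j != 0 -> (j < i)%N.
Definition upper (X : M_) := forall i j : 'I_d, X i j != 0 -> (i <= j)%N.

Lemma lower_upper X : exists Y Z, [/\ lower Y, upper Z & X = Y + Z].
Proof.
exists (\matrix_(i, j) if (j < i)%N then X i j else 0),
       (\matrix_(i, j) if (j < i)%N then 0 else X i j); split.
- by move=> i j; rewrite mxE; case: ifP => //; rewrite eqxx.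
- by move=> i j; rewrite mxE [(i <= j)%N]leqNgt; case: (j < i)%N; rewrite ?eqxx.
- by apply/matrixP => i j; rewrite !mxE; case: ifP => _; rewrite ?addr0 ?add0r.
Qed.

Lemma hw_lower x Y : hw x -> lower Y -> lmx Y^T x = 0.
Proof.
move=> hx lY; apply: (@lmx_upper_sum _ x (fun z => z = 0)) => [|i j].
  exact: (@sub_zero V V id).
by rewrite mxE => /lY /hx.
Qed.

Lemma ht_raise v (i j : 'I_d) p : v p = j -> (i < j)%N ->
  (ht v < ht [ffun q => if q == p then i else v q])%N.
Proof.
move=> vp ij; rewrite /ht (bigD1 p) //= [X in (_ < X)%N](bigD1 p) //= ffunE eqxx vp.
rewrite [X in (_ < _ + X)%N](eq_bigr (fun q => d - v q)%N) => [|q /negPf qp].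
  by rewrite ltn_add2r; have := ltn_ord j; lia.
by rewrite ffunE qp.
Qed.

Lemma cf_lmx_delta x v (i j : 'I_d) : thom x -> cf (lmx (delta_mx i j) x) v != 0 ->
  exists u p, [/\ cf x u != 0, u p = j & v = [ffun q => if q == p then i else u q]].
Proof.
move=> hx rv; have [u yu] := cf_image (lmx_lin fr _) hx rv.
rewrite lmx_delta_wd cf_sum => ru.
apply: NNPP => h; move: ru; rewrite big1 ?eqxx // => p /eqP up.
by rewrite cf_wd; case: eqP => // e; case: h; exists u, p.
Qed.

(** By [dmx_orth], [y] is orthogonal to everything generated by [w0], hence to all row
    symmetrizations of words. *)
Lemma hw_rsym_eq0 y : rsym y -> hw y -> wt w0 y -> ip y (wd w0) = 0 -> y = 0.
Proof.
move=> [hy sy] hwy [_ wy] y0.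
(* [N] is stable under upper triangular matrices, which either keep the letters or increase [ht].
   All words of [y] have the height of [w0], so [y] is orthogonal to the other words in [N]. *)
pose N z := thom z /\ forall u, cf z u != 0 -> u = w0 \/ (ht w0 < ht u)%N.
have Ns : vsub N.
  split=> [|a x z [hx Nx] [hz Nz]]; first by split=> [|u]; [case: (hom_sub fr)|rewrite cf0 eqxx].
  split=> [|u]; first by case: (hom_sub fr) => _; apply.
  rewrite cfP; case xv: (cf x u == 0); last by move=> _; apply: Nx; rewrite xv.
  case yv: (cf z u == 0); last by move=> _; apply: Nz; rewrite yv.
  by rewrite (eqP xv) (eqP yv) mulr0 addr0 eqxx.
have Nw : N (wd w0).
  split=> [|u]; first exact: hom_wd.
  by rewrite cf_wd; case: (_ =P u) => [->|]; rewrite ?eqxx //; left.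
have orth B z : N z -> ip y (dmx B z) = 0.
  apply: (@dmx_orth _ _ _ fr lower upper).
  - exact: lower_upper.
  - by move=> Y; apply: hw_lower.
  - move=> Z {}z uZ [hz Nz]; apply: (lmx_upper_sum Ns) => i j /uZ ij.
    split=> [|v /(cf_lmx_delta hz) [u [p [zu up ->]]]]; first exact: hom_lmx.
    move: ij; rewrite leq_eqVlt => /orP [/eqP/val_inj e|ij].
      have -> : [ffun q => if q == p then i else u q] = u.
        by apply/ffunP => q; rewrite ffunE; case: eqP => // ->; rewrite up.
      exact: Nz.
    right; apply: leq_ltn_trans (ht_raise up ij).
    by case: (Nz u zu) => [->|/ltnW].
  - by move=> ? [].
  - move=> {}z [hz Nz]; rewrite /ip big1 // => u _.
    case yu: (cf y u == 0); first by rewrite (eqP yu) mul0r.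
    case zu: (cf z u == 0); first by rewrite (eqP zu) mulr0.
    have [e|] := Nz u (negbT zu); first by move: y0; rewrite ip_wd e => ->; rewrite mul0r.
    by rewrite (ht_wtp (wy u (negbT yu))) ltnn.
apply: (cf_inj hy (proj1 (hom_sub fr))) => w; rewrite cf0.
have : ip (symm y) (wd w) = 0 by rewrite symm_adj symm_wd orth.
by rewrite sy ipZl ip_wd => /eqP; rewrite mulf_eq0 (negPf (rows_neq0 _ _)) => /eqP.
Qed.

Lemma cols_rows s : s \in rows -> s \in cols -> s = 1%g.
Proof.
move=> /rowsP hr /colsP hs; apply/permP => p; apply: val_inj; rewrite perm1.
by rewrite -[RHS](reshape_indexK c) -hr -hs reshape_indexK.
Qed.

(** Row and column groups meet trivially, so only the identity contributes to the coefficient of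
    [w0] in [asym (wd w0)]. *)
Lemma ip_v0 : ip v0 (wd w0) != 0.
Proof.
rewrite /v0 /ysym symm_adj symm_w0 ipZr mulf_neq0 ?rows_neq0 //.
rewrite ip_wd /asym cf_sum (bigD1 1%g) /=; last by apply/colsP => p; rewrite perm1.
rewrite odd_perm1 expr0 scale1r plc1; last exact: hom_wd.
rewrite cf_wd eqxx big1 ?addr0 ?oner_eq0 // => s /andP [hs s1].
rewrite cfZ plc_wd cf_wd fcomp_w0; case hr: (s \in rows); last by rewrite mulr0.
by rewrite (cols_rows hr hs) eqxx in s1.
Qed.

Context (srt : sorted geq c).

Lemma sorted_nth i j : (i <= j)%N -> (nth 0 c j <= nth 0 c i)%N.
Proof.
move=> ij; case: (ltnP j (size c)) => jc; last by rewrite nth_default.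
by have := sorted_leq_nth (rev_trans leq_trans) leqnn 0%N srt; apply => //;
  rewrite inE //; apply: leq_ltn_trans jc.
Qed.

(** Raising the letter of a box in row [j] to [i < j] repeats the letter of the box of row [i] in
    the same column, which exists since row lengths decrease. *)
Lemma hw_v0 : hw v0.
Proof.
move=> i j ij; rewrite /v0 -ysym_lmx lmx_delta_wd (lin_sum (ysym_lin fr c)).
apply: big1 => p /eqP wp; rewrite /ysym.
have rp : reshape_index c p = j by rewrite -w0E wp.
have op : (reshape_offset c p < nth 0 c i)%N.
  apply: leq_trans (sorted_nth (ltnW ij)); rewrite -rp.
  by apply: reshape_offsetP; rewrite hn.
have [q [_ rq oq]] := flatten_pos hn op.
have qp : q != p by apply: contraTneq ij => e; rewrite -rq e rp ltnn.
rewrite (@asym_coll _ _ _ fr c _ p q) ?(lin0 (symm_lin fr c)) ?oq 1?eq_sym //.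
by rewrite !ffunE eqxx (negPf qp); apply: val_inj; rewrite /= rq.
Qed.

Lemma cnt_wtp u v i : wtp u v -> cnt v i = cnt u i.
Proof.
move=> /existsP [s /eqP ->]; rewrite /cnt -!sum1_card.
rewrite [RHS](reindex_inj (@perm_inj _ s)).
by apply: eq_bigl => p; rewrite !inE ffunE.
Qed.

Lemma lmx_diag_wt w x i : wt w x -> lmx (delta_mx i i) x = (cnt w i)%:R *: x.
Proof.
move=> [hx wx]; rewrite -{1 2}hx /mk (lin_sum (lmx_lin fr _)) scaler_sumr.
apply: eq_bigr => u _; rewrite (linZ (lmx_lin fr _)) lmx_delta_wd.
rewrite (eq_bigr (fun=> wd u)) => [|p /eqP up]; last first.
  by congr fe; apply/ffunP => q; rewrite ffunE; case: eqP => // ->.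
rewrite sumr_const -scaler_nat !scalerA -[#|_|]/(cnt u i).
case xu: (cf x u == 0); first by rewrite (eqP xu) mul0r mulr0.
by rewrite (cnt_wtp i (wx u (negbT xu))) mulrC.
Qed.

(** Multiplicity one: subtracting this multiple of [v0] makes the pairing with [w0] vanish, and
    [hw_rsym_eq0] applies. *)
Lemma hw_rsym_v0 y : rsym y -> hw y -> wt w0 y ->
  y = (ip y (wd w0) / ip v0 (wd w0)) *: v0.
Proof.
set k := _ / _; move=> [hy sy] hwy [_ wy].
apply: subr0_eq; apply: hw_rsym_eq0.
- split; first by apply: (subB (hom_sub fr)) => //; apply: (subZ (hom_sub fr)); apply: hom_ysym.
  rewrite (linB (symm_lin fr c)) sy (linZ (symm_lin fr c)) symm_symm.
  by rewrite scalerBr !scalerA mulrC.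
- by move=> i j ij; rewrite (linB (lmx_lin fr _)) (linZ (lmx_lin fr _)) hwy // hw_v0 // scaler0 subr0.
- split; first by apply: (subB (hom_sub fr)) => //; apply: (subZ (hom_sub fr)); apply: hom_ysym.
  move=> u; rewrite cfB cfZ; case yu: (cf y u == 0); last by move=> _; apply: wy; rewrite yu.
  by rewrite (eqP yu) sub0r oppr_eq0 mulf_eq0 negb_or => /andP [_ h]; apply: wt_v0.2.
- by rewrite ipBl ipZl divfK ?ip_v0 // subrr.
Qed.

(* dmx_orth for N spanned by v0: gl = s + b with b upper triangular.          *)
Lemma schurS_orth (S : M_ -> Prop) x : schurS x ->
  (forall X, exists Y Z, [/\ S Y, upper Z & X = Y + Z]) ->
  (forall Y, S Y -> lmx Y^T x = 0) -> ip x v0 = 0 -> x = 0.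
Proof.
move=> Sx dec Sk xv; have [hx _] := schurS_rsym Sx.
apply: (ip_eq0 hx).
have [y hy e] := schurS_symm Sx; rewrite {2}e.
move: y hy {e}; apply: wd_ind.
  by apply: (sub_pre _ (sub_zero (ip_linr fr x))); apply: lin_comp;
    [exact: ysym_lin|exact: symm_lin].
move=> u; rewrite symm_wd ysym_dmx -/v0.
apply: (@dmx_orth _ _ _ fr S upper _ (fun z => exists k, z = k *: v0)).
- exact: dec.
- exact: Sk.
- move=> Z _ uZ [k ->]; rewrite (linZ (lmx_lin fr _)).
  have Ns : vsub (fun z => exists k, z = k *: v0).
    split; first by exists 0; rewrite scale0r.
    by move=> a _ _ [k1 ->] [k2 ->]; exists (a * k1 + k2); rewrite scalerDl scalerA.
  apply: (subZ Ns); apply: (lmx_upper_sum Ns) => i j /uZ.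
  rewrite leq_eqVlt => /orP [/eqP/val_inj <-|ij]; last first.
    by exists 0; rewrite scale0r hw_v0.
  by exists (cnt w0 i)%:R; rewrite (lmx_diag_wt i wt_v0).
- move=> _ [k ->]; apply: (subZ (hom_sub fr)); exact: hom_ysym.
- by move=> _ [k ->]; rewrite ipZr xv mulr0.
- by exists 1; rewrite scale1r.
Qed.

(** By [schurS_orth], [x] is not orthogonal to [v0]; as distinct weight spaces are orthogonal, [x]
    has the weight of [v0], and multiplicity one concludes. *)
Lemma schurS_hw w x : schurS x -> hw x -> wt w x -> x <> 0 ->
  wtp w0 w /\ exists2 k, k != 0 & x = k *: v0.
Proof.
move=> Sx hwx wx nx; have [[hx sx] [_ wx']] := (schurS_rsym Sx, wx).
have xv : ip x v0 != 0.
  apply: contra_notN nx => /eqP; apply: (schurS_orth Sx lower_upper).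
  by move=> Y; apply: hw_lower.
have ww : wtp w0 w.
  apply: NNPP => nw; move: xv; rewrite /ip big1 ?eqxx // => u _.
  case xu: (cf x u == 0); first by rewrite (eqP xu) mul0r.
  case vu: (cf v0 u == 0); first by rewrite (eqP vu) mulr0.
  case: nw; apply: wtp_trans (wt_v0.2 u (negbT vu)) _.
  by apply: wtp_sym; apply: wx'; rewrite xu.
have wx0 : wt w0 x by split=> // u /wx'; apply: wtp_trans.
split=> //; exists (ip x (wd w0) / ip v0 (wd w0)); last exact: hw_rsym_v0.
apply: contra_notN nx => /eqP k0.
by rewrite (hw_rsym_v0 (schurS_rsym Sx) hwx wx0) k0 scale0r.
Qed.

Lemma v0_neq0 : v0 <> 0.
Proof. by move=> e; have := ip_v0; rewrite e ip0l eqxx. Qed.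

Lemma schurS_v0 : schurS v0. Proof. by exists (wd w0); first exact: hom_wd. Qed.

(** A nonzero submodule has a highest weight vector, which is a multiple of the generator [v0]. *)
Lemma schurS_irr U : gsub U -> (forall x, U x -> schurS x) -> (exists2 x, U x & x <> 0) ->
  forall x, schurS x -> U x.
Proof.
move=> gU US nU; have [w [y [Uy yw wy hwy _]]] := hw_exists gU nU.
have ny : y <> 0 by move=> e; rewrite e cf0 eqxx in yw.
have [_ [k k0 e]] := schurS_hw (US y Uy) hwy wy ny.
apply: schurS_ind => //; have [Us _ _] := gU.
have -> : v0 = k^-1 *: y by rewrite e scalerA mulVf // scale1r.
exact: (subZ Us).
Qed.
End HighestWeight.

(** * Homomorphisms between Schur modules *)

Section Partitions.
Context (d n : nat).
Local Notation I := {ffun 'I_n -> 'I_d}.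
Implicit Types (u v w : I) (c : seq nat).

Lemma wtp_cnt u v : (forall i, cnt u i = cnt v i) -> wtp u v.
Proof.
move=> h; have cE (w : I) i : cnt w i = count_mem i [tuple w p | p < n].
  rewrite /= count_map /cnt cardE /enum_mem size_filter count_filter.
  by apply: eq_count => p; rewrite /= !inE andbT.
have /tuple_permP [s /val_inj e] : perm_eq [tuple v p | p < n] [tuple u p | p < n].
  by apply/allP => i _ /=; rewrite -!cE h.
apply/existsP; exists s; apply/eqP/ffunP => p.
by have := congr1 (fun t => tnth t p) e; rewrite !tnth_mktuple ffunE.
Qed.

(** In a decreasing sequence the zeros come last, and past the end [nth] returns the default 0. Used
    to turn a content into a Young diagram with positive rows. *)
Lemma filter_sorted_nth (s : seq nat) i : sorted geq s ->
  nth 0%N [seq x <- s | x != 0%N] i = nth 0%N s i.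
Proof.
elim: s i => //= x s IH i xs; have {}IH := IH _ (path_sorted xs).
case: eqP => [x0|_] /=; last by case: i.
have z : {in s, forall y, y = 0%N}.
  move=> y ys; apply/eqP; rewrite -leqn0 -x0.
  by have /allP := order_path_min (rev_trans leq_trans) xs; apply.
have -> : [seq y <- s | y != 0%N] = [::].
  by apply/eqP; rewrite -(negbK (_ == _)) -has_filter -all_predC; apply/allP => y /z /= ->.
rewrite nth_nil; case: i => [|i] /=; first by rewrite x0.
case: (ltnP i (size s)) => h; last by rewrite nth_default.
by rewrite (z _ (mem_nth 0%N h)).
Qed.

Lemma partition_of w : (forall i j : 'I_d, (i < j)%N -> (cnt w j <= cnt w i)%N) ->
  exists c, [/\ young_diagram c, sumn c = n, (size c <= d)%N
    & forall i : 'I_d, nth 0%N c i = cnt w i].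
Proof.
move=> dec; pose s := [seq cnt w i | i <- enum 'I_d].
have ss : sorted geq s.
  apply: (path_sorted (x := \max_(i : 'I_d) cnt w i)); rewrite path_sortedE; last first.
    exact: rev_trans leq_trans.
  apply/andP; split; first by apply/allP => x /mapP [i _ ->]; apply: (leq_bigmax i).
  rewrite sorted_map; apply: (sub_sorted (e := fun i j : 'I_d => (i < j)%N)).
    by move=> i j /= /dec.
  have := iota_ltn_sorted 0 d; rewrite -val_enum_ord sorted_map.
  by apply: sub_sorted.
exists [seq x <- s | x != 0%N]; split.
- apply/andP; split; last by rewrite mem_filter.
  by apply: sorted_filter ss; apply: rev_trans leq_trans.
- have -> : sumn [seq x <- s | x != 0%N] = sumn s.
    by elim: (s) => //= x r; case: eqP => [->//|_] /= ->.
  rewrite sumnE big_map big_enum /=.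
  under eq_bigr do rewrite /cnt -sum1_card.
  rewrite -[RHS]card_ord -sum1_card (partition_big w xpredT) //=.
- by rewrite size_filter (leq_trans (count_size _ _)) // size_map size_enum_ord.
- move=> i; rewrite filter_sorted_nth // (nth_map i) ?size_enum_ord //.
  by rewrite nth_ord_enum.
Qed.

Lemma cnt_w0 c (hn : sumn c = n) (hc : (size c <= d)%N) (i : 'I_d) :
  cnt (w0 hn hc) i = nth 0%N c i.
Proof.
have [f fP] := fin_all_exists (fun j : 'I_(nth 0%N c i) => flatten_pos hn (ltn_ord j)).
have f_inj : injective f.
  by move=> j k e; have [_ _ oj] := fP j; apply: val_inj; rewrite /= -oj e; case: (fP k).
rewrite -[RHS]card_ord -(card_codom f_inj) /cnt; apply: eq_card => p.
rewrite inE -val_eqE /= w0E; apply/eqP/codomP => [e|[j ->]]; last by case: (fP j).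
have lt : (reshape_offset c p < nth 0%N c i)%N.
  by rewrite -e; apply: reshape_offsetP; rewrite hn.
exists (Ordinal lt); have [ej _ _] := fP (Ordinal lt).
by apply: val_inj; rewrite ej /= -e reshape_indexK.
Qed.

Lemma young_nth_eq (a b : seq nat) : young_diagram a -> young_diagram b ->
  (size a <= d)%N -> (size b <= d)%N ->
  (forall i : 'I_d, nth 0%N a i = nth 0%N b i) -> a = b.
Proof.
move=> /andP [_ a0] /andP [_ b0] sa sb e.
have lt (x y : seq nat) : 0%N \notin x -> (size x <= d)%N ->
    (forall i : 'I_d, nth 0%N x i = nth 0%N y i) -> (size x <= size y)%N.
  move=> x0 sx exy; rewrite leqNgt; apply/negP => yx.
  have := exy (Ordinal (leq_trans yx sx)); rewrite /= [RHS]nth_default // => z.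
  by move/negP: x0; apply; rewrite -z mem_nth.
have es : size a = size b by apply/eqP; rewrite eqn_leq !lt // => i; rewrite e.
apply: (eq_from_nth (x0 := 0%N)) => // i ia.
exact: (e (Ordinal (leq_trans ia sa))).
Qed.
End Partitions.

Section SchurSubmodules.
Context (d n : nat) (V : lmodType rat) (fr : frame d n V).
Local Notation I := {ffun 'I_n -> 'I_d}.
Local Notation wd := (fe fr).
Local Notation cf := (fc fr).
Local Notation thom := (thom fr).
Local Notation ip := (ip fr).
Local Notation plc := (plc fr).
Local Notation lmx := (lmx fr).
Local Notation gact := (gact fr).
Local Notation gsub := (gsub fr).
Local Notation hw := (hw fr).
Local Notation wt := (wt fr).
Local Notation schurS := (schurS fr).
Local Notation M_ := 'M[rat]_d.
Implicit Types (x y z : V) (X Y Z : M_) (v w : I) (s : 'S_n) (U W : V -> Prop).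

Definition is_hom U (f : V -> V) : Prop :=
  [/\ forall (a : rat) x y, U x -> U y -> f (a *: x + y) = a *: f x + f y,
      forall M, M \in unitmx -> forall x, U x -> f (gact M x) = gact M (f x)
    & forall x, U x -> thom (f x)].

(** A GL-map on the whole tensor power, commuting with all matrices; [is_hom] asks this on [U] only,
    for invertible ones. *)
Definition ghom (f : V -> V) : Prop :=
  [/\ lin f, forall M x, thom x -> f (gact M x) = gact M (f x)
    & forall x, thom x -> thom (f x)].

Definition injon U (f : V -> V) : Prop := forall x, U x -> f x = 0 -> x = 0.

Definition img U (f : V -> V) y : Prop := exists2 x, U x & f x = y.

Lemma gsub_thom : gsub thom.
Proof. by split=> [|//|M _ x _]; [exact: hom_sub|exact: hom_gact]. Qed.

Lemma ghom_is_hom U f : gsub U -> ghom f -> is_hom U f.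
Proof.
by move=> [_ Uh _] [fl fc fh]; split=> [a x y _ _|M _ x /Uh|x /Uh]; [exact: fl|exact: fc|exact: fh].
Qed.

Lemma ghom_comp f g : ghom f -> ghom g -> ghom (fun x => f (g x)).
Proof.
move=> [fl fc fh] [gl gc gh]; split; first exact: lin_comp.
  by move=> M x hx; rewrite gc // fc //; apply: gh.
by move=> x /gh /fh.
Qed.

Lemma ghom_proj U F : gsub U -> is_proj fr U F -> ghom F.
Proof.
move=> gU pF; have [Fl FU _] := pF; have [_ Uh _] := gU.
by split=> // [M x _|x _]; [exact: (proj_gact M x gU pF)|exact: Uh].
Qed.

Lemma is_hom_img U f : gsub U -> is_hom U f -> gsub (img U f).
Proof.
move=> gU [fl fc fh]; have [Us Uh Um] := gU; split.
- split; first by exists 0; [case: Us|exact: (on0 gU fl)].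
  move=> a _ _ [x Ux <-] [y Uy <-]; exists (a *: x + y); last by rewrite fl.
  by case: Us => _; apply.
- by move=> _ [x Ux <-]; apply: fh.
- by move=> M uM _ [x Ux <-]; exists (gact M x); [exact: Um|exact: fc].
Qed.

Lemma ker_gsub U f : gsub U -> is_hom U f -> gsub (fun x => U x /\ f x = 0).
Proof.
move=> gU [fl fc fh]; have [Us Uh Um] := gU; split.
- split; first by split; [case: Us|exact: (on0 gU fl)].
  move=> a x y [Ux fx] [Uy fy]; split; first by case: Us => _; apply.
  by rewrite fl // fx fy scaler0 addr0.
- by move=> x [/Uh].
- move=> M uM x [Ux fx]; split; first exact: Um.
  by rewrite fc // fx (lin0 (gact_lin fr M)).
Qed.

Lemma wt_sub w : vsub (wt w).
Proof.
apply: sub_and; first exact: hom_sub.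
split=> [v|a x y hx hy v]; first by rewrite cf0 eqxx.
rewrite cfP; case xv: (cf x v == 0); last by move=> _; apply: hx; rewrite xv.
case yv: (cf y v == 0); last by move=> _; apply: hy; rewrite yv.
by rewrite (eqP xv) (eqP yv) mulr0 addr0 eqxx.
Qed.

Lemma wt_plc w s x : wt w x -> wt w (plc s x).
Proof.
move=> [hx wx]; split=> [|v]; first exact: hom_plc.
rewrite cf_plc => /wx h; apply: wtp_trans h _.
by apply/existsP; exists s; rewrite fcompKV.
Qed.

Lemma wt_diag w x : thom x ->
  (forall i, lmx (delta_mx i i) x = (cnt w i)%:R *: x) -> wt w x.
Proof.
move=> hx h; split=> // v xv; apply: wtp_cnt => i.
have dw u : lmx (delta_mx i i) (wd u) = (cnt u i)%:R *: wd u.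
  apply: lmx_diag_wt; split=> [|t]; first exact: hom_wd.
  by rewrite cf_wd; case: (u =P t) => [->|]; rewrite ?eqxx // wtp_refl.
have := congr1 (fun z => cf z v) (h i).
rewrite -{1}hx /mk (lin_sum (lmx_lin fr _)) cf_sum (bigD1 v) //= big1 => [|u uv].
  rewrite (linZ (lmx_lin fr _)) dw !cfZ cf_wd eqxx mulr1 addr0 mulrC.
  by move/(mulIf xv)/eqP; rewrite eqr_nat => /eqP.
by rewrite (linZ (lmx_lin fr _)) dw !cfZ cf_wd (negPf uv) !mulr0.
Qed.

(* For x of weight w0 write x = theta w0 with theta in the group algebra of   *)
(* S_n: theta maps the Schur module generated by v0 into the module of x.     *)
Lemma schur_in U : gsub U -> (exists2 x, U x & x <> 0) ->
  exists c f, [/\ [/\ young_diagram c, sumn c = n & (size c <= d)%N], ghom f,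
    forall x, schurS c x -> U (f x) & injon (schurS c) f].
Proof.
move=> gU nU; have [w [y [Uy yw wy hwy dec]]] := hw_exists gU nU.
have [c [yc hn hc e]] := partition_of dec.
have {}wy : wt (w0 hn hc) y.
  split=> [|v /wy.2]; first by case: wy.
  by apply: wtp_trans; apply: wtp_cnt => i; rewrite cnt_w0.
set u0 := w0 hn hc in wy; have [hy wy'] := wy; have [Us Uh _] := gU.
have /andP [srt _] := yc.
(* [sg v] carries [u0] to [v]; the default concerns only words that are not rearrangements of [u0],
   where [y] has coordinate 0. Thus [f] sends [u0] to [y], and [g] is the adjoint of [f]. *)
pose sg v : 'S_n := odflt 1%g [pick s | v == fcomp u0 s].
have sgP v : wtp u0 v -> fcomp u0 (sg v) = v.
  by move=> /existsP [s h]; rewrite /sg; case: pickP => [t /eqP -> //|/(_ s)]; rewrite h.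
pose f x := \sum_v cf y v *: plc (sg v) x.
pose g x := \sum_v cf y v *: plc (sg v)^-1%g x.
have fl : lin f by apply: lin_bigsum => v; apply: lin_scale; apply: plc_lin.
have gl : lin g by apply: lin_bigsum => v; apply: lin_scale; apply: plc_lin.
have f_comm (F : V -> V) x : lin F -> (forall s z, plc s (F z) = F (plc s z)) ->
    f (F x) = F (f x).
  by move=> Fl Fc; rewrite (lin_sum Fl); apply: eq_bigr => v _; rewrite (linZ Fl) Fc.
have g_comm (F : V -> V) x : lin F -> (forall s z, plc s (F z) = F (plc s z)) ->
    g (F x) = F (g x).
  by move=> Fl Fc; rewrite (lin_sum Fl); apply: eq_bigr => v _; rewrite (linZ Fl) Fc.
have fg x z : ip (f x) z = ip x (g z).
  rewrite (lin_sum (ip_linl fr z)) (lin_sum (ip_linr fr x)).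
  by apply: eq_bigr => v _; rewrite ipZl ipZr plc_adj.
have fw : f (wd u0) = y.
  rewrite -[RHS]hy; apply: eq_bigr => v _; rewrite plc_wd.
  case: (eqVneq (cf y v) 0) => [->|/wy' /sgP ->//]; by rewrite !scale0r.
have fh x : thom (f x).
  apply: (sub_lin (hom_sub fr)) => v _; apply: (subZ (hom_sub fr)); exact: hom_plc.
have gf : ghom f.
  by split=> // M x _; apply: f_comm => [|s z]; [exact: gact_lin|exact: plc_gact].
have fU x : schurS c x -> U (f x).
  move=> [z _ ->]; rewrite /ysym.
  have := hom_asym fr c z; move: (asym fr c z); apply: wd_ind.
    by apply: sub_pre Us; apply: lin_comp fl _; apply: symm_lin.
  move=> u; rewrite (symm_wd fr hn hc) f_comm ?fw; [|exact: dmx_lin|by move=> s x'; apply: plc_dmx].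
  exact: gsub_dmx.
exists c, f; split=> //.
set v := v0 fr hn hc.
have fv : f v <> 0.
  (* [q] is a row-invariant highest weight vector pairing nontrivially with [u0], hence a nonzero
     multiple of [v]. Since [ip (f v) y] is the pairing of [asym (wd u0)] with [q], its vanishing
     would give [ip v v = 0]. *)
  pose q := symm fr c (g y).
  have rq : rsym fr c q by split; [exact: hom_symm|exact: symm_symm].
  have hq : hw q.
    move=> i j ij; rewrite /q -symm_comm; [|exact: lmx_lin|by move=> s z; apply: plc_lmx].
    rewrite -g_comm; [|exact: lmx_lin|by move=> s z; apply: plc_lmx].
    by rewrite hwy // (lin0 gl) (lin0 (symm_lin fr c)).
  have wq : wt u0 q.
    apply: (sub_lin (wt_sub _)) => s _; apply: wt_plc.
    apply: (sub_lin (wt_sub _)) => u _; apply: (subZ (wt_sub _)); exact: wt_plc.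
  have qw : ip q (wd u0) <> 0.
    rewrite symm_adj symm_w0 ipZr ipC -fg fw => /eqP.
    rewrite mulf_eq0 (negPf (rows_neq0 _ _)) /= => /eqP /(ip_eq0 hy) y0.
    by move: yw; rewrite y0 cf0 eqxx.
  have := hw_rsym_v0 srt rq hq wq; rewrite -/u0 -/v; set k := _ / _ => qE.
  move=> fv0; have : ip (f v) y = 0 by rewrite fv0 ip0l.
  rewrite fg /v /v0 /ysym symm_adj -/q qE ipZr => /eqP; rewrite mulf_eq0 => /orP [/eqP k0|/eqP h].
    by apply: qw; rewrite qE k0 scale0r ip0l.
  apply: (@v0_neq0 _ _ _ fr c hn hc); apply: (ip_eq0 (hom_ysym _ _ _)).
  have {}h : ip (asym fr c (wd u0)) (symm fr c (asym fr c (wd u0))) = 0 := h.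
  by rewrite /ysym symm_adj symm_symm ipZr h mulr0.
move=> x Sx fx; apply: NNPP => nx; apply: fv.
have gS := schurS_gsub fr c.
have [_ ->//] : schurS c v /\ f v = 0.
have := schurS_irr hn hc srt (ker_gsub gS (ghom_is_hom gS gf)) (fun z h => h.1).
by apply; [exists x|exact: schurS_v0].
Qed.
End SchurSubmodules.

(** * Schur's lemma, orthogonality and common constituents *)

Section SchurHoms.
Context (d n : nat) (V : lmodType rat) (fr : frame d n V).
Local Notation I := {ffun 'I_n -> 'I_d}.
Local Notation ip := (ip fr).
Local Notation lmx := (lmx fr).
Local Notation gsub := (gsub fr).
Local Notation hw := (hw fr).
Local Notation wt := (wt fr).
Local Notation schurS := (schurS fr).
Local Notation M_ := 'M[rat]_d.
Local Notation is_hom := (is_hom fr).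
Local Notation ghom := (ghom fr).
Implicit Types (x y z : V) (X Y Z : M_) (v w : I) (s : 'S_n) (U W : V -> Prop).

(** The copy is taken inside the submodule [G] generated by [r]. If [r] were orthogonal to it, so
    would be all of [G], hence the copy itself. *)
Lemma schur_pairing A r : gsub A -> A r -> r <> 0 ->
  exists c f, [/\ [/\ young_diagram c, sumn c = n & (size c <= d)%N], ghom f,
    forall x, schurS c x -> A (f x), injon (schurS c) f
    & exists2 x, schurS c x & ip r (f x) <> 0].
Proof.
move=> gA Ar nr; have [_ Ah _] := gA.
pose G z := forall U, gsub U -> U r -> U z.
have gG : gsub G.
  split.
  - split; first by move=> U [[U0 _] _ _] _.
    by move=> a x y Gx Gy U gU Ur; have [[_ UD] _ _] := gU; apply: UD; [apply: Gx|apply: Gy].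
  - by move=> z /(_ _ (gsub_thom fr)); apply; apply: Ah.
  - by move=> M uM x Gx U gU Ur; apply: (gsub_gact gU); apply: Gx.
have Gr : G r by [].
have [c [f [yc gf fG fi]]] := schur_in gG (ex_intro2 _ _ r Gr nr).
exists c, f; split=> // [x /fG|]; first by apply.
have gS := schurS_gsub fr c; have hf := ghom_is_hom gS gf.
apply: NNPP => no; have [yd hn hc] := yc.
have pr : perp fr (img (schurS c) f) r.
  split=> [|_ [x Sx <-]]; first exact: Ah.
  by apply: NNPP => ne; apply: no; exists x.
have vv := schurS_v0 fr hn hc.
have Gv := fG _ vv.
have /(_ (ex_intro2 _ _ _ vv erefl)) := perp_self _ (Gv _ (perp_gsub (is_hom_img gS hf)) pr).
by move/(fi _ vv); apply: v0_neq0.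
Qed.

Lemma schurS_size c x : 0%N \notin c -> sumn c = n -> schurS c x -> x <> 0 -> (size c <= d)%N.
Proof.
move=> c0 hn Sx nx; rewrite leqNgt; apply/negP => lt; apply: nx.
rewrite -(gact_epsm_id (leqnn d) (schurS_rsym Sx).1).
by apply: (epsm_schurS hn) => //; rewrite minnn.
Qed.

Lemma schur_hom_inj c h : young_diagram c -> sumn c = n -> is_hom (schurS c) h ->
  (exists2 x, schurS c x & h x <> 0) -> injon (schurS c) h.
Proof.
move=> /andP [srt c0] hn hh [z Sz hz] x Sx hx; apply: NNPP => nx; apply: hz.
have hc := schurS_size c0 hn Sx nx.
have := schurS_irr hn hc srt (ker_gsub (schurS_gsub fr c) hh) (fun z h => h.1).
by move=> /(_ (ex_intro2 _ _ x (conj Sx hx) nx) z Sz) [].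
Qed.

(** The image under [h] of the highest weight vector of [b], pulled back by [f], is a highest weight
    vector of [a] with the weight of [b]; by [schurS_hw] the two weights agree. *)
Lemma schur_hom_eq a b f h W : young_diagram a -> sumn a = n ->
  young_diagram b -> sumn b = n ->
  is_hom (schurS a) f -> injon (schurS a) f -> (forall y, W y -> img (schurS a) f y) ->
  is_hom (schurS b) h -> (forall x, schurS b x -> W (h x)) ->
  (exists2 x, schurS b x & h x <> 0) -> a = b.
Proof.
move=> ya na yb nb hf fi fs hh hW ex; have hi := schur_hom_inj yb nb hh ex.
have [/andP [sa a0] /andP [sb b0]] := (ya, yb).
have gA := schurS_gsub fr a; have gB := schurS_gsub fr b.
have [hl hc hm] := hh; have [fl fc fm] := hf; have [Ash Ah _] := gA.
have db : (size b <= d)%N.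
  case: ex => x Sx hx; apply: (schurS_size b0 nb Sx) => x0; apply: hx.
  by rewrite x0 (on0 gB hl).
pose v := v0 fr nb db; have Sv : schurS b v := schurS_v0 fr nb db.
have [x Sx fx] := fs _ (hW v Sv).
have nx : x <> 0.
  move=> x0; apply: (@v0_neq0 _ _ _ fr b nb db); apply: hi => //.
  by rewrite -fx x0 (on0 gA fl).
have da := schurS_size a0 na Sx nx.
have fB z k X : schurS a z -> f (lmx X z - k *: z) = lmx X (f z) - k *: f z.
  move=> Sz; have SX := gsub_lmx gA X Sz.
  have -> : lmx X z - k *: z = (- k) *: z + lmx X z by rewrite scaleNr addrC.
  by rewrite fl // (on_lmx gA fl fc fm) // scaleNr addrC.
have hX X : h (lmx X v) = lmx X (h v) by apply: (on_lmx gB).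
have hwx : hw x.
  move=> i j ij; apply: fi; first exact: gsub_lmx.
  have := fB x 0 (delta_mx i j) Sx; rewrite !scale0r !subr0 fx -hX => ->.
  by rewrite (hw_v0 fr nb db sb ij) (on0 gB hl).
have wx : wt (w0 nb db) x.
  apply: wt_diag; first exact: Ah.
  move=> i; apply: subr0_eq; apply: fi.
    by apply: (subB Ash); [exact: gsub_lmx|exact: (subZ Ash)].
  rewrite fB // fx -hX (lmx_diag_wt i (wt_v0 fr nb db)).
  have -> : (cnt (w0 nb db) i)%:R *: v0 fr nb db = (cnt (w0 nb db) i)%:R *: v + 0 by rewrite addr0.
  have S0 : schurS b 0 by case: gB => [[]].
  by rewrite hl // (on0 gB hl) addr0 subrr.
have [ww _] := schurS_hw na da sa Sx hwx wx nx.
apply: (young_nth_eq (d := d)) => // i.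
by rewrite -(cnt_w0 na da) -(cnt_w0 nb db) (cnt_wtp i ww).
Qed.

(** If not, [f'] followed by the orthogonal projection onto [W] would be a nonzero GL-map between
    Schur modules of distinct shapes. *)
Lemma schur_orth a b f f' W W' : young_diagram a -> sumn a = n ->
  young_diagram b -> sumn b = n -> a <> b -> gsub W ->
  is_hom (schurS a) f -> injon (schurS a) f -> (forall y, W y -> img (schurS a) f y) ->
  is_hom (schurS b) f' -> (forall y, W' y -> img (schurS b) f' y) ->
  forall y y', W y -> W' y' -> ip y y' = 0.
Proof.
move=> ya na yb nb ab gW hf fi fs hf' fs' y y' Wy W'y'.
have [Ws Wh _] := gW; have [F pF] := proj_exists Ws Wh; have [Fl FW Fo] := pF.
have [x' Sx' ex'] := fs' _ W'y'.
rewrite ipC -(proj_ip pF) //; apply: NNPP => ne; apply: ab.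
apply: (schur_hom_eq (f := f) (h := fun x => F (f' x)) (W := W)) => //.
- have [hl hc hm] := hf'; split=> [c u v Su Sv|M uM u Su|u Su].
  + by rewrite hl // Fl.
  + by rewrite hc // (proj_gact _ _ gW pF).
  + exact: Wh.
- by exists x' => // Fx; apply: ne; rewrite -ex' Fx ip0l.
Qed.

(** Choose the Schur module inside the orthogonal complement in [A] of the kernel of [G], where [G]
    is injective. *)
Lemma common_irr A G z : gsub A -> ghom G -> A z -> G z <> 0 ->
  exists c f, [/\ [/\ young_diagram c, sumn c = n & (size c <= d)%N], ghom f,
    forall x, schurS c x -> A (f x), injon (schurS c) f
    & injon (schurS c) (fun x => G (f x))].
Proof.
move=> gA gG Az Gz; have [As Ah _] := gA; have [Gl Gc Gh] := gG.
pose K x := A x /\ G x = 0.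
have gK : gsub K by apply: ker_gsub (ghom_is_hom gA gG).
have [Ks Kh _] := gK; have [F [Fl FK Fo]] := proj_exists Ks Kh.
have gP := gsub_and gA (perp_gsub gK).
pose r := z - F z.
have Pr : A r /\ perp fr K r.
  have Ar : A r by apply: (subB As) => //; case: (FK z).
  by split=> //; split; [exact: Ah|move=> u Ku; exact: Fo].
have nr : r <> 0.
  by move/subr0_eq => e; apply: Gz; rewrite e; case: (FK z).
have [c [f [yc gf fP fi]]] := schur_in gP (ex_intro2 _ _ r Pr nr).
exists c, f; split=> // [x /fP []//|x Sx Gfx].
have [Afx pfx] := fP x Sx; apply: fi => //.
by apply: perp_self pfx.
Qed.

(* S is contained in {Y | Y^T kills x}: the lower root vectors of gl are root *)
(* vectors of sp modulo upper triangular matrices.                            *)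
Lemma schurS_sp c x (dual : 'I_d -> 'I_d) (sg : 'I_d -> rat) :
  young_diagram c -> sumn c = n -> (size c <= d)%N ->
  involutive dual -> (forall a, sg a != 0) -> (forall a, sg (dual a) = - sg a) ->
  (forall p q : 'I_d, (q < p)%N -> q = dual p \/ (dual q <= dual p)%N) ->
  schurS c x -> x <> 0 ->
  (forall a b, sg b *: lmx (delta_mx a (dual b)) x + sg a *: lmx (delta_mx b (dual a)) x = 0) ->
  forall a : 'I_d, nth 0%N c a = nth 0%N c (dual a).
Proof.
move=> /andP [srt _] hn hc dK sg0 sgN dual_lt Sx nx kx a.
pose S Y := lmx Y^T x = 0.
have Ss : vsub S.
  split=> [|k X Y SX SY]; first by rewrite /S trmx0 (lin0 (lmx_linX fr x)).
  by rewrite /S linearP /= (lmx_linX fr x k) SX SY scaler0 addr0.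
pose dec X := exists Y Z, [/\ S Y, upper Z & X = Y + Z].
have upD k X Y : upper X -> upper Y -> upper (k *: X + Y).
  move=> uX uY i j; rewrite !mxE; case Xij: (X i j == 0); last by move=> _; apply: uX; rewrite Xij.
  by rewrite (eqP Xij) mulr0 add0r; apply: uY.
have up0 : upper (0 : M_) by move=> i j; rewrite mxE eqxx.
have decs : vsub dec.
  split; first by exists 0, 0; split; [case: Ss| |rewrite addr0].
  move=> k _ _ [Y [Z [SY uZ ->]]] [Y' [Z' [SY' uZ' ->]]].
  exists (k *: Y + Y'), (k *: Z + Z'); split; [by case: Ss => _; apply|exact: upD|].
  by rewrite scalerDr addrACA.
have up_delta (i j : 'I_d) : (i <= j)%N -> upper (delta_mx i j : M_).
  move=> ij p q; rewrite mxE; case: (p =P i) => [->|]; last by rewrite eqxx.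
  by case: (q =P j) => [->|]; last by rewrite eqxx.
have decX X : dec X.
  rewrite (matrix_sum_delta X); apply: (sub_lin decs) => p _; apply: (sub_lin decs) => q _.
  apply: (subZ decs); case: (leqP p q) => [pq|qp].
    by exists 0, (delta_mx p q); split; [case: Ss|exact: up_delta|rewrite add0r].
  (* After transposition, this element of sp is a nonzero multiple of [delta_mx p q] plus a multiple
     of [delta_mx (dual q) (dual p)]. By [dual_lt] the second term is upper triangular, unless
     [q = dual p] and it equals the first. *)
  have := kx q (dual p); rewrite dK => kpq.
  have kS : S (sg (dual p) *: delta_mx p q + sg q *: delta_mx (dual q) (dual p)).
    rewrite /S linearD /= !linearZ /= !trmx_delta.
    by rewrite (linD (lmx_linX fr x)) !(linZ (lmx_linX fr x)).
  case: (dual_lt p q qp) => [e|le].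
    exists (delta_mx p q), 0; split=> //; last by rewrite addr0.
    subst q; move: kS; rewrite dK -scalerDl => /(subZ Ss (sg (dual p) + sg (dual p))^-1).
    rewrite scalerA mulVf ?scale1r //.
    by rewrite -mulr2n -mulr_natr mulf_neq0.
  exists (delta_mx p q + (sg (dual p))^-1 *: (sg q *: delta_mx (dual q) (dual p))),
    (- ((sg (dual p))^-1 *: (sg q *: delta_mx (dual q) (dual p)))).
  split; last by rewrite addrK.
    move: (subZ Ss (sg (dual p))^-1 kS); rewrite scalerDr scalerA mulVf ?scale1r //.
  rewrite scalerA -scaleNr -[_ *: _]addr0; apply: upD => //; exact: up_delta.
have xv : ip x (v0 fr hn hc) != 0.
  apply: contra_notN nx => /eqP; apply: (schurS_orth srt Sx decX).
  by move=> Y.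
(* The torus element [delta_mx a a - delta_mx (dual a) (dual a)] kills [x]; pairing with [v0], which
   has weight [c] and is not orthogonal to [x], compares the two rows. *)
have := kx a (dual a); rewrite dK sgN => h.
have := ip0l fr (v0 fr hn hc); rewrite -h ipDl !ipZl !lmx_adj !trmx_delta.
rewrite !(lmx_diag_wt _ (wt_v0 fr hn hc)) !ipZr mulNr addrC => /subr0_eq.
move/(mulfI (sg0 a))/(mulIf xv)/eqP; rewrite eqr_nat => /eqP.
by rewrite !cnt_w0.
Qed.
End SchurHoms.

(** * The tensor algebra *)

Section TensorFrame.
Context (d : nat).
Local Notation T := (tensor d).

Lemma codom_inj n : injective (fun v : {ffun 'I_n -> 'I_d} => codom v).
Proof.
move=> u v e; apply/ffunP => p.
by have /eq_in_map -> // : map u (enum 'I_n) = map v (enum 'I_n) := e; rewrite mem_enum.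
Qed.

Definition tcf n (x : T) (v : {ffun 'I_n -> 'I_d}) : rat := x@_(FMonom (codom v)).
Definition twd n (v : {ffun 'I_n -> 'I_d}) : T := word (codom v).

Lemma tcf_lin n v : lin ((fun x => @tcf n x v) : T -> rat^o).
Proof. by move=> a x y; rewrite /tcf mcoeffD mcoeffZ. Qed.

Lemma tcf_wd n (u v : {ffun 'I_n -> 'I_d}) : tcf (twd u) v = (u == v)%:R.
Proof. by rewrite /tcf /twd mcoeff_word (inj_eq (@codom_inj n)). Qed.

Definition tframe n : frame d n T := Frame (@tcf_lin n) (@tcf_wd n).

Lemma size_codomF n (v : {ffun 'I_n -> 'I_d}) : size (codom v) = n.
Proof. by rewrite size_codom card_ord. Qed.

Lemma seq_codom n (s : seq 'I_d) : size s = n ->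
  exists v : {ffun 'I_n -> 'I_d}, s = codom v.
Proof.
move=> hs; pose t : n.-tuple 'I_d := tcast hs (in_tuple s).
exists (finfun (tnth t)).
have -> : codom (finfun (tnth t)) = codom (tnth t) by apply: eq_codom => p; rewrite ffunE.
by rewrite [codom _]map_tnth_enum /t val_tcast.
Qed.

Lemma homogE n (x : T) : homog n x <-> thom (tframe n) x.
Proof.
split=> [|<-]; last first.
  apply: (sub_lin (@homog_sub d n)) => v _; apply: (subZ (@homog_sub d n)).
  by rewrite -[n in homog n](size_codomF v); apply: homog_word.
apply: homog_ind => [|s /seq_codom [v ->]]; first exact: hom_sub.
exact: (hom_wd (tframe n) v).
Qed.

Lemma gl_act_lin (M : 'M_d) : lin (gl_act M). Proof. exact: linext_lin. Qed.

Lemma tlinB (F : T -> T) (x y : T) : lin F -> F (x - y) = F x - F y.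
Proof. by move=> Fl; exact: linB. Qed.
Lemma gl_act_word (M : 'M_d) s :
  gl_act M (word s) = \prod_(i <- s) \sum_(j < d) M j i *: gen j.
Proof. exact: linext_word. Qed.

Lemma gl_act_mul (M : 'M_d) (x y : T) : gl_act M (x * y) = gl_act M x * gl_act M y.
Proof.
move: x; apply: word_ext => [||s].
- exact: lin_comp (gl_act_lin M) (lin_mull y).
- exact: lin_comp (lin_mull _) (gl_act_lin M).
move: y; apply: word_ext => [||t].
- exact: lin_comp (gl_act_lin M) (lin_mulr _).
- exact: lin_comp (lin_mulr _) (gl_act_lin M).
by rewrite -word_cat !gl_act_word big_cat.
Qed.

Lemma prod_gen (s : seq 'I_d) : \prod_(i <- s) gen i = word s.
Proof.
elim: s => [|i s IH]; first by rewrite big_nil word_nil.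
by rewrite big_cons IH -word_cons.
Qed.

Lemma prod_scale (A : lalgType rat) (J : finType) (a : J -> rat) (F : J -> A) (r : seq J) :
  (forall c x y, x * (c *: y) = c *: (x * y) :> A) ->
  \prod_(i <- r) (a i *: F i) = (\prod_(i <- r) a i) *: \prod_(i <- r) F i.
Proof.
move=> scr; elim: r => [|i r IH]; first by rewrite !big_nil scale1r.
by rewrite !big_cons IH scr -scalerAl scalerA mulrC.
Qed.

Lemma gl_actE n (M : 'M_d) (x : T) : thom (tframe n) x ->
  gl_act M x = gact (tframe n) M x.
Proof.
move: x; apply: wd_ind; first exact: (sub_eq (gl_act_lin M) (gact_lin (tframe n) M)).
move=> w; rewrite /gact pmx_wd [LHS]gl_act_word.
rewrite big_map -[enum_mem _]deprecated_filter_index_enum big_filter.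
rewrite bigA_distr_bigA /=; apply: eq_bigr => v _.
rewrite prod_scale; last by move=> c x y; apply: mulr_scale.
congr (_ *: _); rewrite -[fe _ _]/(word (codom v)) -prod_gen big_map.
by rewrite -[enum_mem _]deprecated_filter_index_enum big_filter.
Qed.

Lemma homog_gl_act n (M : 'M_d) (x : T) : homog n x -> homog n (gl_act M x).
Proof. by move=> /homogE hx; rewrite (gl_actE M hx); apply/homogE; apply: hom_gact. Qed.

Lemma gl_submodE n (U : T -> Prop) : (forall x, U x -> homog n x) ->
  gl_submod U <-> gsub (tframe n) U.
Proof.
move=> Uh; have {}Uh x : U x -> thom (tframe n) x by move=> /Uh /homogE.
split=> [[Us Um]|[Us _ Um]].
  by split=> // M uM x Ux; rewrite -gl_actE; [apply: Um|apply: Uh].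
by split=> // M uM x Ux; rewrite (gl_actE M (Uh x Ux)); apply: Um.
Qed.

Lemma vspan_sub (V : lmodType rat) (Q : V -> Prop) : vsub (vspan Q).
Proof.
split; first by exists [::]; rewrite big_nil.
move=> a x y [s [sQ ->]] [t [tQ ->]].
exists ([seq (a * p.1, p.2) | p <- s] ++ t); split.
  by move=> p; rewrite mem_cat => /orP [/mapP [q qs ->]|/tQ//]; exact: (sQ q qs).
rewrite big_cat big_map scaler_sumr; congr (_ + _).
by apply: eq_bigr => p _; rewrite scalerA.
Qed.

Lemma vspan_mem (V : lmodType rat) (Q : V -> Prop) x : Q x -> vspan Q x.
Proof.
move=> Qx; exists [:: (1, x)]; split; last by rewrite big_seq1 scale1r.
by move=> p; rewrite inE => /eqP ->.
Qed.

Lemma vspan_le (V : lmodType rat) (Q R : V -> Prop) : vsub R ->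
  (forall x, Q x -> R x) -> forall x, vspan Q x -> R x.
Proof.
move=> Rs QR x [s [sQ ->]]; apply: (sub_lin_in Rs) => p ps.
by apply: (subZ Rs); apply: QR; apply: sQ.
Qed.

Lemma young_symE lam (w : {ffun 'I_(sumn lam) -> 'I_d}) (t : (sumn lam).-tuple 'I_d) :
  (forall p, tnth t p = w p) ->
  young_sym t = ysym (tframe (sumn lam)) lam (fe (tframe (sumn lam)) w).
Proof.
move=> e; rewrite /young_sym /ysym /symm; apply: eq_bigr => a _.
rewrite (lin_sum (plc_lin _ _)); apply: eq_bigr => b _.
rewrite (linZ (plc_lin _ _)) plcM plc_wd; congr (_ *: word _).
by apply: eq_codom => p; rewrite ffunE e.
Qed.

Lemma schurE lam x : schur lam x <-> schurS (tframe (sumn lam)) lam x.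
Proof.
have [Ss _ _] := schurS_gsub (tframe (sumn lam)) lam.
split.
  apply: (vspan_le Ss) => _ [w ->].
  exists (fe (tframe (sumn lam)) [ffun p => tnth w p]); first exact: hom_wd.
  by apply: young_symE => p; rewrite ffunE.
move=> [y hy ->]; move: y hy; apply: wd_ind.
  exact: sub_pre (ysym_lin _ _) (vspan_sub _).
move=> w; apply: vspan_mem; exists [tuple w p | p < sumn lam].
by rewrite (@young_symE _ w) // => p; rewrite tnth_mktuple.
Qed.

Lemma schur_homog lam (x : T) : schur lam x -> homog (sumn lam) x.
Proof. by move=> /schurE [y _ ->]; apply/homogE; apply: hom_ysym. Qed.

Lemma schur_gl_submod lam : gl_submod (@schur d lam).
Proof.
apply/(gl_submodE (@schur_homog lam)).
have [Ss Sh Sm] := schurS_gsub (tframe (sumn lam)) lam.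
split=> [|x /schurE/Sh//|M uM x /schurE Sx]; last by apply/schurE/Sm.
exact: vspan_sub.
Qed.

End TensorFrame.

(** The images of [w0] under all matrices span the row-invariant tensors: the vectors [z] whose
    images all lie in [Q] form a GL-submodule containing [w0]. *)
Lemma rsym_ind (d n : nat) (V : lmodType rat) (fr : frame d n V) (c : seq nat)
  (hn : sumn c = n) (hc : (size c <= d)%N) (Q : V -> Prop) : vsub Q ->
  (forall M, Q (gact fr M (fe fr (w0 hn hc)))) -> forall x, rsym fr c x -> Q x.
Proof.
move=> Qs Qw x [hx sx].
pose P z := thom fr z /\ forall M, Q (gact fr M z).
have gP : gsub fr P.
  split; first apply: sub_and; first exact: hom_sub.
  - by apply: sub_all => M; apply: (sub_pre (gact_lin fr M) Qs).
  - by move=> z [].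
  - move=> M _ z [hz Pz]; split; first exact: hom_gact.
    by move=> M'; rewrite gact_comp.
have Pw : P (fe fr (w0 hn hc)) by split; first exact: hom_wd.
suff [_ /(_ 1%:M)] : P x by rewrite gact1.
have [Ps _ _] := gP.
have -> : x = (#|rows n c|)%:R^-1 *: symm fr c x.
  by rewrite sx scalerA mulVf ?rows_neq0 // scale1r.
apply: (subZ Ps); move: x hx {sx}; apply: wd_ind.
  exact: (sub_pre (symm_lin fr c) Ps).
by move=> w; rewrite (symm_wd fr hn hc); apply: gsub_dmx.
Qed.

Lemma sum_scale_delta (V : lmodType rat) (J : finType) (F : J -> V) (a : J) (c : J -> rat) :
  (forall p, c p = (p == a)%:R) -> \sum_p c p *: F p = F a.
Proof.
move=> h; rewrite (bigD1 a) //= h eqxx scale1r big1 ?addr0 // => p /negPf pa.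
by rewrite h pa scale0r.
Qed.

Lemma morph_lie (A B : lalgType rat) (F : A -> B) : lin F ->
  (forall x y, F (x * y) = F x * F y) ->
  forall x y, F (x * y - y * x) = F x * F y - F y * F x.
Proof. by move=> Fl FM x y; rewrite (linB Fl) !FM. Qed.

(** * Products of submodules, common summands and heights *)

Section Tens.
Context (d : nat).
Local Notation T := (tensor d).
Implicit Types (x y z u v : T) (A B U W : T -> Prop).

Lemma tens_le (R : T -> Prop) A B : vsub R ->
  (forall u v, A u -> B v -> R (u * v)) -> forall x, tens A B x -> R x.
Proof. by move=> Rs h; apply: (vspan_le Rs) => _ [u [v [Au Bv ->]]]; apply: h. Qed.

Lemma tens_sub A B : vsub (tens A B). Proof. exact: vspan_sub. Qed.

Lemma tens_mem A B u v : A u -> B v -> tens A B (u * v).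
Proof. by move=> Au Bv; apply: vspan_mem; exists u, v. Qed.

Lemma tens_homog A B m n : (forall x, A x -> homog m x) -> (forall x, B x -> homog n x) ->
  forall x, tens A B x -> homog (m + n) x.
Proof.
move=> hA hB; apply: tens_le; first exact: homog_sub.
by move=> u v /hA hu /hB hv; apply: homog_mul.
Qed.

Lemma tens_gl_submod A B : gl_submod A -> gl_submod B -> gl_submod (tens A B).
Proof.
move=> [As Am] [Bs Bm]; split; first exact: tens_sub.
move=> M uM; apply: tens_le; first exact: (sub_pre (gl_act_lin M) (tens_sub A B)).
by move=> u v Au Bv; rewrite gl_act_mul; apply: tens_mem; [apply: Am|apply: Bm].
Qed.

Lemma ext2_homog x : ext2 x -> homog 2 x.
Proof.
apply: (vspan_le (@homog_sub d 2)) => _ [u [v [hu hv ->]]].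
by apply: (subB (@homog_sub d 2)); apply: (@homog_mul d 1 1).
Qed.

Lemma ext2_gl_submod : gl_submod (@ext2 d).
Proof.
split; first exact: vspan_sub.
move=> M uM; apply: vspan_le; first exact: (sub_pre (gl_act_lin M) (vspan_sub _)).
move=> _ [u [v [hu hv ->]]]; apply: vspan_mem.
exists (gl_act M u), (gl_act M v); split; [exact: homog_gl_act|exact: homog_gl_act|].
exact: morph_lie (gl_act_lin M) (gl_act_mul M) _ _.
Qed.

(** [A] lies in the span of the images of the word [s] under all matrices. Only this inclusion is
    asked, so that it also applies to [ext2] inside [H (x) H]. *)
Definition gens (s : seq 'I_d) A : Prop := forall Q : T -> Prop, vsub Q ->
  (forall M, Q (gl_act M (word s))) -> forall x, A x -> Q x.

Lemma gens_schur lam : (size lam <= d)%N ->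
  exists s : seq 'I_d, [/\ size s = sumn lam, forall i, i \in s -> (i < size lam)%N
    & gens s (schur lam)].
Proof.
move=> hc; set w := w0 (erefl (sumn lam)) hc.
exists (codom w); split; first exact: size_codomF.
  by move=> _ /codomP [p ->]; rewrite w0E; apply: reshape_indexP.
move=> Q Qs Qw x /schurE /schurS_rsym; apply: (@rsym_ind _ _ _ _ _ erefl hc) => // M.
by rewrite -gl_actE; [apply: Qw|apply: hom_wd].
Qed.

Lemma gens_homog2 (i j : 'I_d) : i != j -> gens [:: i; j] (@homog d 2).
Proof.
move=> ij Q Qs Qw; apply: homog_ind => // s.
case: s => [|a [|b []]] // _.
have := Qw (\matrix_(p, q) if q == i then (p == a)%:R else (p == b)%:R).
set M := \matrix_(_, _) _.
have -> : word [:: a; b] = gl_act M (word [:: i; j]) => //.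
rewrite gl_act_word big_cons big_seq1 word_cons.
congr (_ * _); apply/esym; apply: sum_scale_delta => p; rewrite mxE ?eqxx //.
by rewrite [j == i]eq_sym (negPf ij).
Qed.

(* The two generators are put on disjoint sets of letters, so that one matrix *)
(* acts on them independently.                                                *)
Lemma epsm_tens (s t : seq 'I_d) (a b : nat) A B U :
  (a + b <= d)%N -> (forall i, i \in s -> (i < a)%N) -> (forall i, i \in t -> (i < b)%N) ->
  gens s A -> gens t B ->
  gsub (tframe d (size s + size t)) U -> (forall x, U x -> tens A B x) ->
  (forall x, U x -> gl_act (epsm d (a + b)) x = 0) -> forall x, U x -> x = 0.
Proof.
move=> abd sa tb gA gB gU UT Ue u Uu; set N := (size s + size t)%N in gU.
have [Us Uh _] := gU; have hu := Uh u Uu.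
(* The letters of [t] are shifted past those of [s]; since [a + b <= d], the default of [insubd] is
   not reached on [t]. *)
pose sh (i : 'I_d) : 'I_d := insubd i (a + i)%N.
have shE i : i \in t -> sh i = (a + i)%N :> nat.
  move=> /tb ib; rewrite val_insubd; case: ifP => //.
  by rewrite (leq_trans _ abd) // ltn_add2l.
have st_size : size (s ++ map sh t) = N by rewrite size_cat size_map.
have [v vE] := seq_codom st_size.
have veps : gact (tframe d N) (epsm d (a + b)) (fe (tframe d N) v) = fe (tframe d N) v.
  rewrite gact_epsm; case: forallP => // h; case: h => p.
  have : v p \in s ++ map sh t by rewrite vE; apply: codom_f.
  rewrite mem_cat => /orP [/sa lt|/mapP [i it ->]]; first by rewrite ltn_addr.
  by rewrite shE // ltn_add2l tb.
(* With [w] the concatenated word, fixed by [eps]: [<u, M w> = <M^T u, eps w> = <eps (M^T u), w>],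
   and [eps] kills [U]. *)
have ort M : ip (tframe d N) u (gl_act M (word (s ++ map sh t))) = 0.
  rewrite vE -[word _]/(fe (tframe d N) v) (@gl_actE d N); last exact: hom_wd.
  rewrite ipC gact_adj ipC; set z := gact _ _ u.
  have Uz : U z by apply: gsub_gact.
  rewrite -veps ipC gact_adj epsm_sym -(@gl_actE d N); last exact: Uh.
  by rewrite Ue // ip0r.
have ort2 M1 M2 : ip (tframe d N) u (gl_act M1 (word s) * gl_act M2 (word t)) = 0.
  (* [M] acts as [M1] on the letters below [a] and as [M2] on the shifted letters. *)
  pose M : 'M[rat]_d := \matrix_(i, j)
    if (j < a)%N then M1 i j else M2 i (insubd j (j - a)%N).
  have <- : gl_act M (word s) = gl_act M1 (word s).
    rewrite !gl_act_word; apply: eq_big_seq => j js; apply: eq_bigr => i _.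
    by rewrite mxE sa.
  have <- : gl_act M (word (map sh t)) = gl_act M2 (word t).
    rewrite !gl_act_word big_map; apply: eq_big_seq => j js; apply: eq_bigr => i _.
    have -> : M i (sh j) = M2 i j; last by [].
    rewrite mxE shE // ltnNge leq_addr /=; congr (M2 i _).
    by apply: val_inj; rewrite val_insubd addKn ltn_ord.
  by rewrite -gl_act_mul -word_cat.
apply: (ip_eq0 hu); move: (UT u Uu).
suff: forall x, tens A B x -> ip (tframe d N) u x = 0 by apply.
apply: tens_le; first exact: (sub_zero (ip_linr _ u)).
move=> x y Ax By; move: x Ax; apply: gA.
  exact: (sub_pre (lin_mull y) (sub_zero (ip_linr (tframe d N) u))).
move=> M1; move: y By; apply: gB; last by move=> M2.
exact: (sub_pre (lin_mulr _) (sub_zero (ip_linr (tframe d N) u))).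
Qed.

Lemma epsm_schur a lam x : 0%N \notin lam -> (minn a d < size lam)%N ->
  schur lam x -> gl_act (epsm d a) x = 0.
Proof.
move=> l0 al /schurE Sx; rewrite (gl_actE _ (schurS_rsym Sx).1).
exact: (epsm_schurS erefl).
Qed.

Lemma epsm_ge a n x : (d <= a)%N -> homog n x -> gl_act (epsm d a) x = x.
Proof. by move=> da /homogE hx; rewrite (gl_actE _ hx) gact_epsm_id. Qed.

Lemma irr_img n c f : young_diagram c -> sumn c = n -> (size c <= d)%N ->
  is_hom (tframe d n) (schurS (tframe d n) c) f -> injon (schurS (tframe d n) c) f ->
  irreducible (img (schurS (tframe d n) c) f).
Proof.
move=> yc hn hc hf fi; have gS := schurS_gsub (tframe d n) c.
have gI := is_hom_img gS hf; have [_ Ih _] := gI.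
have /andP [srt c0] := yc.
have Ihom x : img (schurS (tframe d n) c) f x -> homog n x by move=> /Ih /homogE.
have vv := schurS_v0 (tframe d n) hn hc; have nv := v0_neq0 (fr := tframe d n) (hn := hn) (hc := hc).
split; first exact/(gl_submodE Ihom).
  exists (f (v0 (tframe d n) hn hc)); first by exists (v0 (tframe d n) hn hc).
  by move=> /(fi _ vv).
move=> W mW WI; have [|no] := classic (exists2 x, W x & x <> 0); last first.
  by left=> x Wx; apply: NNPP => nx; apply: no; exists x.
move=> [y Wy ny]; right; have [x Sx fx] := WI y Wy.
have gW : gsub (tframe d n) W by apply/gl_submodE => // z /WI /Ihom.
have [[W0 WD] _ Wm] := gW; have [Ss Sh Sm] := gS; have [fl fc fh] := hf.
pose P z := schurS (tframe d n) c z /\ W (f z).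
have gP : gsub (tframe d n) P.
  split.
  - split; first by split; [case: Ss|rewrite (on0 gS fl)].
    move=> a p q [Sp Wp] [Sq Wq]; split; first by case: Ss => _; apply.
    by rewrite fl //; apply: WD.
  - by move=> z [/Sh].
  - by move=> M uM z [Sz Wz]; split; [apply: Sm|rewrite fc //; apply: Wm].
have nx : x <> 0 by move=> x0; apply: ny; rewrite -fx x0 (on0 gS fl).
have Px : P x by split=> //; rewrite fx.
have all := schurS_irr hn hc srt gP (fun z h => h.1) (ex_intro2 _ _ x Px nx).
by move=> _ [z Sz <-]; case: (all z Sz).
Qed.

Lemma gl_iso_is_hom n U W f : (forall x, U x -> homog n x) -> (forall x, W x -> homog n x) ->
  (forall (a : rat) x y, U x -> U y -> f (a *: x + y) = a *: f x + f y) ->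
  (forall M, M \in unitmx -> forall x, U x -> f (gl_act M x) = gl_act M (f x)) ->
  (forall x, U x -> W (f x)) -> is_hom (tframe d n) U f.
Proof.
move=> Uh Wh fl fm fW; split=> // [M uM x Ux|x /fW/Wh/homogE//].
have /homogE hx := Uh x Ux; have /homogE hfx := Wh _ (fW x Ux).
by rewrite -(gl_actE M hx) -(gl_actE M hfx) fm.
Qed.

(** [common_irr] gives a Schur submodule of [A] on which [G] is injective; it and its image are
    isomorphic, and both split off by orthogonal complements. *)
Lemma common_summand n A B (G : T -> T) z : gl_submod A -> (forall x, A x -> homog n x) ->
  gl_submod B -> (forall x, B x -> homog n x) -> ghom (tframe d n) G ->
  (forall x, A x -> B (G x)) -> A z -> G z <> 0 -> common_irreducible_summand A B.
Proof.
move=> mA Ah mB Bh gG AB Az Gz.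
have gA : gsub (tframe d n) A by apply/gl_submodE.
have gB : gsub (tframe d n) B by apply/gl_submodE.
have [c [f [[yc hn hc] gf fA fi Gfi]]] := common_irr gA gG Az Gz.
have gS := schurS_gsub (tframe d n) c.
have gGf := ghom_comp gG gf.
have hf := ghom_is_hom gS gf; have hGf := ghom_is_hom gS gGf.
have summ C h : gsub (tframe d n) C -> is_hom (tframe d n) (schurS (tframe d n) c) h ->
    (forall x, schurS (tframe d n) c x -> C (h x)) ->
    summand (img (schurS (tframe d n) c) h) C.
  move=> gC hh hC; have gI := is_hom_img gS hh; have [Is Ih _] := gI.
  have [Cs Ch _] := gC; have [F [Fl FI Fo]] := proj_exists Is Ih.
  have IC x : img (schurS (tframe d n) c) h x -> C x by move=> [y Sy <-]; apply: hC.
  split=> //; first by apply/(gl_submodE (n := n)) => // x /Ih /homogE.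
  have gP := gsub_and gC (perp_gsub gI).
  exists (fun x => C x /\ perp (tframe d n) (img (schurS (tframe d n) c) h) x).
    by apply/(gl_submodE (n := n)) => // x [/Ch /homogE].
  split=> [x []//|x Cx|x Ix [_ px]]; last exact: perp_self px.
  exists (F x), (x - F x); have CxF : C (x - F x) by apply: (subB Cs) => //; apply: IC.
  split=> //; last by rewrite addrC subrK.
  by split=> //; split; [exact: Ch|move=> u Iu; apply: Fo].
exists (img (schurS (tframe d n) c) f), (img (schurS (tframe d n) c) (fun x => G (f x))).
split; [exact: irr_img|exact: summ|by apply: summ => // x Sx; apply: AB; apply: fA|].
have [Gl Gc Gh] := gG; have [_ fh] := (gf, fun x Sx => Ah _ (fA x Sx)).
exists G; split.
- by move=> a x y _ _; apply: Gl.
- move=> M _ _ [x Sx <-]; have /homogE hx := fh x Sx.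
  by rewrite (gl_actE M hx) (gl_actE M (Gh _ hx)); apply: Gc.
- by move=> _ [x Sx <-]; exists x.
- by move=> _ [x Sx <-] /(Gfi x Sx) ->; have [fl _ _] := hf; rewrite (on0 gS fl).
- by move=> _ [x Sx <-]; exists (f x) => //; exists x.
Qed.

(* eps_a, the projection of Q^d on its first a coordinates, kills S_lam iff   *)
(* a < h(lam), and a nonzero submodule of a product with r rows in total is   *)
(* not killed by eps_r.                                                       *)
Lemma common_height lam mu nu : young_diagram lam -> young_diagram mu -> young_diagram nu ->
  (sumn lam + sumn mu = 2 + sumn nu)%N ->
  common_irreducible_summand (tens (@schur d lam) (@schur d mu))
    (tens (@ext2 d) (@schur d nu)) ->
  (maxn (size lam) (size mu) - 2 <= size nu <= size lam + size mu)%N.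
Proof.
move=> /andP [_ l0] /andP [_ m0] /andP [_ n0] sz [U [W [iU [mU UA _] [mW WB _] [f [fl fm fW fi fs]]]]].
have [_ [u Uu nu0] _] := iU.
pose N := (sumn lam + sumn mu)%N.
have Ah : forall x, tens (@schur d lam) (@schur d mu) x -> homog N x.
  by apply: tens_homog; apply: schur_homog.
have Bh : forall x, tens (@ext2 d) (@schur d nu) x -> homog N x.
  by rewrite /N sz; apply: tens_homog; [apply: ext2_homog|apply: schur_homog].
have Uh x : U x -> homog N x by move=> /UA /Ah.
have Wh x : W x -> homog N x by move=> /WB /Bh.
have gU : gsub (tframe d N) U by apply/gl_submodE.
have gW : gsub (tframe d N) W by apply/gl_submodE.
have [gl gm gh] := gl_iso_is_hom Uh Wh fl fm fW.
have fE M x : U x -> f (gl_act M x) = gl_act M (f x).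
  move=> Ux; have /homogE hx := Uh x Ux; have /homogE hfx := Wh _ (fW x Ux).
  by rewrite (gl_actE M hx) (gl_actE M hfx) (on_gact gU gl gm gh).
have Uact M x : U x -> U (gl_act M x).
  by move=> Ux; have /homogE hx := Uh x Ux; rewrite (gl_actE M hx); apply: gsub_gact.
have f0 : f 0 = 0 by apply: (on0 gU gl).
have epsA a x : (minn a d < maxn (size lam) (size mu))%N -> U x -> gl_act (epsm d a) x = 0.
  move=> lt /UA; move: x; apply: tens_le; first exact: (sub_zero (gl_act_lin _)).
  move=> x y Sx Sy; rewrite gl_act_mul; move: lt; rewrite leq_max => /orP [lt|lt].
    by rewrite (epsm_schur l0 lt Sx) mul0r.
  by rewrite (epsm_schur m0 lt Sy) mulr0.
have epsB a x : (minn a d < size nu)%N -> W x -> gl_act (epsm d a) x = 0.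
  move=> lt /WB; move: x; apply: tens_le; first exact: (sub_zero (gl_act_lin _)).
  by move=> x y Sx Sy; rewrite gl_act_mul (epsm_schur n0 lt Sy) mulr0.
have killU a : (forall x, W x -> gl_act (epsm d a) x = 0) -> forall x, U x -> gl_act (epsm d a) x = 0.
  by move=> k x Ux; apply: fi; [exact: Uact|rewrite fE // k //; apply: fW].
have killW a : (forall x, U x -> gl_act (epsm d a) x = 0) -> forall x, W x -> gl_act (epsm d a) x = 0.
  by move=> k x /fs [y Uy <-]; rewrite -fE // k // f0.
(* For [a >= d] the projection is the identity, which settles the cases where the alphabet is too
   short. *)
have big a : (d <= a)%N -> (forall x, U x -> gl_act (epsm d a) x = 0) -> False.
  by move=> da k; apply: nu0; rewrite -(epsm_ge da (Uh u Uu)) k.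
have hd : (maxn (size lam) (size mu) <= d)%N.
  by rewrite leqNgt; apply/negP => lt; apply: (big d) => // x; apply: epsA; rewrite minnn.
have hnd : (size nu <= d)%N.
  by rewrite leqNgt; apply/negP => lt; apply: (big d) => //; apply: killU => x; apply: epsB; rewrite minnn.
have [ld md] : (size lam <= d)%N /\ (size mu <= d)%N.
  by move: hd; rewrite geq_max => /andP.
apply/andP; split; last first.
  rewrite leqNgt; apply/negP => lt.
  have kU : forall x, U x -> gl_act (epsm d (size lam + size mu)) x = 0.
    by apply: killU => x; apply: epsB; apply: leq_ltn_trans (geq_minl _ _) lt.
  case: (leqP d (size lam + size mu)) => [da|/ltnW da]; first exact: big da kU.
  have [s [ss sl gs]] := gens_schur ld; have [t [st tl gt]] := gens_schur md.
  apply: nu0; apply: (epsm_tens (U := U) da sl tl gs gt) => //.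
  by rewrite ss st.
(* Lower bound: two letters suffice to generate [ext2], so the projection on [2 + size nu] letters
   cannot kill [W]; yet it kills [U]. *)
rewrite leqNgt; apply/negP => lt.
have kU x : U x -> gl_act (epsm d (2 + size nu)) x = 0.
  by apply: epsA; apply: leq_ltn_trans (geq_minl _ _) _; lia.
case: (leqP d (2 + size nu)) => [da|/ltnW da]; first exact: big da kU.
have kW := killW _ kU.
have d2 : (1 < d)%N by apply: leq_trans da.
pose i0 : 'I_d := Ordinal (ltnW d2); pose i1 : 'I_d := Ordinal d2.
have [t [st tl gt]] := gens_schur hnd.
have g2 : gens [:: i0; i1] (@ext2 d).
  by move=> Q Qs Qw x /ext2_homog; apply: (gens_homog2 (i := i0) (j := i1)).
have fu : f u = 0.
  apply: (epsm_tens (U := W) da _ tl g2 gt) => //; last exact: fW.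
    by move=> i; rewrite !inE => /orP [] /eqP ->.
  by rewrite st -sz.
exact: nu0 (fi u Uu fu).
Qed.

End Tens.

(** * The bracket of symplectic derivations *)

(** Interface of the tensor algebra (words, linear extension, induction on words), playing for
    products the part that [frame] plays for one tensor power. *)
Record walg (d : nat) (A : lalgType rat) := WAlg {
  ww : seq 'I_d -> A;
  wlin : (seq 'I_d -> A) -> A -> A;
  w_scr : forall (c : rat) x y, x * (c *: y) = c *: (x * y) :> A;
  ww_cat : forall s t, ww (s ++ t) = ww s * ww t;
  ww_nil : ww [::] = 1;
  wlin_lin : forall f, lin (wlin f);
  wlin_w : forall f s, wlin f (ww s) = f s;
  ww_ind : forall Q : A -> Prop, vsub Q -> (forall s, Q (ww s)) -> forall x, Q x }.

Section WordAlgebra.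
Context (d : nat) (A : lalgType rat) (wa : walg d A).
Local Notation wo := (ww wa).
Local Notation lx := (wlin wa).
Local Notation ge i := (ww wa [:: i]).
Implicit Types (x y z : A) (f : 'I_d -> A).

Let wext (V : lmodType rat) (F G : A -> V) : lin F -> lin G ->
  (forall w, F (wo w) = G (wo w)) -> forall x, F x = G x.
Proof. by move=> Fl Gl e; apply: (ww_ind (sub_eq Fl Gl) e). Qed.

Lemma wo_cons i s : wo (i :: s) = ge i * wo s.
Proof. by rewrite -ww_cat. Qed.

Lemma wlin_mull y : lin (fun x : A => x * y).
Proof. by move=> a x z; rewrite mulrDl scalerAl. Qed.

Lemma wlin_mulr y : lin (fun x : A => y * x).
Proof. by move=> a x z; rewrite mulrDr (w_scr wa). Qed.

Definition lieA x y := x * y - y * x.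

Lemma lieA_linr y : lin (lieA y).
Proof. by apply: lin_sub; [exact: wlin_mulr|exact: wlin_mull]. Qed.

Definition derivation (D : A -> A) : Prop :=
  lin D /\ forall x y, D (x * y) = D x * y + x * D y.

Lemma derivation_lie D x y : derivation D -> D (lieA x y) = lieA (D x) y + lieA x (D y).
Proof.
move=> [Dl DM]; rewrite /lieA (linB Dl) !DM opprD [X in _ + X = _]addrC.
by rewrite !addrA; congr (_ + _); rewrite addrAC.
Qed.

Lemma derivation_comm D E : derivation D -> derivation E ->
  derivation (fun x => D (E x) - E (D x)).
Proof.
move=> [Dl DM] [El EM]; split.
  by apply: lin_sub; [exact: lin_comp Dl El|exact: lin_comp El Dl].
move=> x y; rewrite EM DM (linD Dl) (linD El) !DM !EM mulrBl mulrBr.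
set a := D (E x) * y; set b := E x * D y; set c := D x * E y; set e := x * D (E y).
set a' := E (D x) * y; set e' := x * E (D y).
have -> : a + b + (c + e) = a + (b + c) + e by rewrite !addrA.
have -> : a' + c + (b + e') = a' + (b + c) + e' by rewrite [b + c]addrC !addrA.
by rewrite opprD addrACA [- (_ + _)]opprD [X in X + _]addrACA subrr addr0.
Qed.

Definition derA f : A -> A := lx (fun w => \sum_(p < size w)
  wo (take p w) * f (tnth (in_tuple w) p) * wo (drop p.+1 w)).

Lemma derA_lin f : lin (derA f). Proof. exact: wlin_lin. Qed.

Lemma derA_nil f : derA f (wo [::]) = 0.
Proof. by rewrite /derA wlin_w big_ord0. Qed.

Lemma derA_cons f i s : derA f (wo (i :: s)) = f i * wo s + ge i * derA f (wo s).
Proof.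
rewrite /derA !wlin_w big_ord_recl /= drop0 ww_nil mul1r; congr (_ + _).
rewrite mulr_sumr; apply: eq_bigr => p _; rewrite /bump leq0n add1n.
rewrite wo_cons -!mulrA; congr (_ * (_ * (f _ * _))).
by rewrite !(tnth_nth i).
Qed.

Lemma derA_gen f i : derA f (ge i) = f i.
Proof. by rewrite derA_cons derA_nil mulr0 addr0 ww_nil mulr1. Qed.

Lemma derA_derivation f : derivation (derA f).
Proof.
split; first exact: derA_lin.
move=> x y; move: x; apply: wext => [||s].
- exact: lin_comp (derA_lin f) (wlin_mull y).
- apply: lin_add; first exact: lin_comp (wlin_mull y) (derA_lin f).
  exact: wlin_mull.
move: y; apply: wext => [||t].
- exact: lin_comp (derA_lin f) (wlin_mulr _).
- apply: lin_add; first exact: wlin_mulr.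
  exact: lin_comp (wlin_mulr _) (derA_lin f).
rewrite -ww_cat; elim: s => [|i s IH]; first by rewrite derA_nil ww_nil mul0r mul1r add0r.
by rewrite /= !derA_cons IH ww_cat (wo_cons i s) mulrDl mulrDr !mulrA addrA.
Qed.

Lemma derA_linf t (C : A -> 'I_d -> A) : (forall j, lin (fun s => C s j)) ->
  lin (fun s => derA (C s) t).
Proof.
move=> Cl a x y; move: t; apply: wext => [||s].
- exact: derA_lin.
- by apply: lin_add; [apply: lin_scale|]; exact: derA_lin.
elim: s => [|i s IH]; first by rewrite !derA_nil scaler0 addr0.
by rewrite !derA_cons IH Cl mulrDl mulrDr -scalerAl (w_scr wa) scalerDr addrACA.
Qed.

(** [1 (x) D] on [H (x) A], extended by zero to the empty word. *)
Definition oneD (D : A -> A) : A -> A :=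
  lx (fun w => if w is i :: w' then ge i * D (wo w') else 0).

Lemma oneD_lin D : lin (oneD D). Proof. exact: wlin_lin. Qed.

Lemma oneD_mul D i x : lin D -> oneD D (ge i * x) = ge i * D x.
Proof.
move=> Dl; move: x; apply: wext => [||s]; last by rewrite -wo_cons /oneD wlin_w.
  exact: lin_comp (oneD_lin D) (wlin_mulr _).
exact: lin_comp (wlin_mulr _) Dl.
Qed.

Lemma oneD_linD x (C : A -> A -> A) : (forall y, lin (fun s => C s y)) ->
  lin (fun s => oneD (C s) x).
Proof.
move=> Cl a s t; move: x; apply: wext => [||w].
- exact: oneD_lin.
- by apply: lin_add; [apply: lin_scale|]; exact: oneD_lin.
rewrite /oneD !wlin_w; case: w => [|i w]; first by rewrite scaler0 addr0.
by rewrite Cl mulrDr (w_scr wa).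
Qed.

Definition bmapA : A -> A :=
  lx (fun w => if w is i :: w' then lieA (ge i) (wo w') else 0).

Lemma bmapA_mul i x : bmapA (ge i * x) = lieA (ge i) x.
Proof.
move: x; apply: wext => [||s]; last by rewrite -wo_cons /bmapA wlin_w.
  exact: lin_comp (wlin_lin wa _) (wlin_mulr _).
exact: lieA_linr.
Qed.

Lemma bmapA_morph (F : A -> A) (m : 'M[rat]_d) : lin F -> F 1 = 1 ->
  (forall x y, F (x * y) = F x * F y) ->
  (forall i, F (ge i) = \sum_j m j i *: ge j) -> forall x, bmapA (F x) = F (bmapA x).
Proof.
move=> Fl F1 FM Fg; have bl : lin bmapA := wlin_lin wa _.
apply: wext => [||[|i w]]; [exact: lin_comp bl Fl|exact: lin_comp Fl bl| |].
  by rewrite {1}ww_nil F1 -(ww_nil wa) {1 2}/bmapA wlin_w (lin0 Fl).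
rewrite (wo_cons i w) FM bmapA_mul /lieA (linB Fl) !FM Fg mulr_suml mulr_sumr.
rewrite (lin_sum bl) -sumrB; apply: eq_bigr => j _.
by rewrite -scalerAl (linZ bl) bmapA_mul (w_scr wa) -scalerBr.
Qed.
End WordAlgebra.

Section SymplecticAlgebra.
Context (g : nat) (A : lalgType rat) (wa : walg (g + g) A).
Local Notation wo := (ww wa).
Local Notation lx := (wlin wa).
Local Notation ge i := (ww wa [:: i]).
Local Notation derA := (derA wa).
Local Notation oneD := (oneD wa).
Local Notation bmapA := (bmapA wa).
Implicit Types (x y z s t : A).

Let wext (V : lmodType rat) (F G : A -> V) : lin F -> lin G ->
  (forall w, F (wo w) = G (wo w)) -> forall x, F x = G x.
Proof. by move=> Fl Gl e; apply: (ww_ind (sub_eq Fl Gl) e). Qed.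

Definition contrA t (j : 'I_(g + g)) : A :=
  lx (fun w => if w is i :: w' then omega g i j *: wo w' else 0) t.

Lemma contrA_lin j : lin (fun t => contrA t j). Proof. exact: wlin_lin. Qed.

Lemma contrA_cons i w j : contrA (wo (i :: w)) j = omega g i j *: wo w.
Proof. by rewrite /contrA wlin_w. Qed.

Lemma contrA_mul i x j : contrA (ge i * x) j = omega g i j *: x.
Proof.
move: x; apply: wext => [||w]; last by rewrite -wo_cons contrA_cons.
  exact: lin_comp (contrA_lin j) (wlin_mulr wa _).
by apply: lin_scale.
Qed.

Definition tenA (D : A -> A) : A :=
  \sum_(i < g) (ge (lshift g i) * D (ge (rshift g i)) - ge (rshift g i) * D (ge (lshift g i))).

(** Duality undoes contraction: the functional [omega (u, -)] has tensor [u]. *)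
Lemma tenA_omega u : \sum_(i < g) (omega g u (rshift g i) *: ge (lshift g i)
    - omega g u (lshift g i) *: ge (rshift g i)) = ge u.
Proof.
rewrite sumrB /omega; case: (splitP u) => a ua.
- have -> : u = lshift g a by apply: val_inj.
  under [X in _ - X]eq_bigr do rewrite block_mxEul mxE scale0r.
  rewrite [X in _ - X]big1 // subr0; apply: sum_scale_delta => p.
  by rewrite block_mxEur mxE eq_sym.
- have -> : u = rshift g a by apply: val_inj.
  under [X in X - _]eq_bigr do rewrite block_mxEdr mxE scale0r.
  rewrite [X in X - _]big1 // sub0r -sumrN; under eq_bigr do rewrite -scaleNr.
  by apply: sum_scale_delta => p; rewrite block_mxEdl !mxE opprK eq_sym.
Qed.

(** For [t = u (x) xi] the map [v |-> omega (u, v) D xi] has tensor [u (x) D xi]. This turns the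
    commutator of derivations into a formula on tensors. *)
Lemma tenA_comp D t : lin D -> tenA (fun v => D (derA (contrA t) v)) = oneD D t.
Proof.
move=> Dl; move: t; apply: wext => [||w].
- apply: lin_bigsum => i.
  by apply: lin_sub; apply: (lin_comp (wlin_mulr wa _)); apply: (lin_comp Dl) => a x y;
    rewrite !derA_gen contrA_lin.
- exact: oneD_lin.
rewrite /tenA; under eq_bigr do rewrite !derA_gen.
case: w => [|u w].
  rewrite /oneD wlin_w big1 // => i _; rewrite /contrA !wlin_w.
  by rewrite (lin0 Dl) !mulr0 subr0.
rewrite wo_cons oneD_mul // -[in RHS]tenA_omega mulr_suml; apply: eq_bigr => i _.
by rewrite !contrA_mul !(linZ Dl) !(w_scr wa) mulrBl !scalerAl.
Qed.

Definition der_of s : A -> A := derA (contrA s).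

Definition hbrA s t : A := tenA (fun v => der_of s (der_of t v) - der_of t (der_of s v)).

Lemma tenAB D E : tenA (fun v => D v - E v) = tenA D - tenA E.
Proof.
rewrite /tenA -sumrB; apply: eq_bigr => i _.
by rewrite !mulrBr !opprB addrACA [RHS]addrACA; congr (_ + _); rewrite addrC.
Qed.

Lemma hbrAE s t : hbrA s t = oneD (der_of s) t - oneD (der_of t) s.
Proof. by rewrite /hbrA tenAB !tenA_comp //; exact: derA_lin. Qed.

Lemma der_of_linl v : lin (fun s => der_of s v).
Proof. by apply: derA_linf => j; exact: contrA_lin. Qed.

Lemma hbrA_linl t : lin (fun s => hbrA s t).
Proof.
move=> a x y; rewrite !hbrAE -[RHS]/((fun s => a *: _ + _) t).
have l : lin (fun s => oneD (der_of s) t - oneD (der_of t) s).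
  by apply: lin_sub; [apply: oneD_linD => v; exact: der_of_linl|exact: oneD_lin].
exact: l.
Qed.

Lemma hbrA_linr s : lin (hbrA s).
Proof.
move=> a x y; rewrite !hbrAE.
have l : lin (fun t => oneD (der_of s) t - oneD (der_of t) s).
  by apply: lin_sub; [exact: oneD_lin|apply: oneD_linD => v; exact: der_of_linl].
exact: l.
Qed.

Definition omegaA : A := \sum_(i < g) lieA (ge (lshift g i)) (ge (rshift g i)).

(** [[x_i, D y_i] + [D x_i, y_i]] is [D [x_i, y_i]]. So a tensor in the kernel of the bracket map is
    one whose derivation kills the symplectic element. *)
Lemma bmapA_tenA D : derivation D -> bmapA (tenA D) = D omegaA.
Proof.
move=> dD; have [Dl DM] := dD.
have bl : lin bmapA := wlin_lin wa _.
rewrite /tenA /omegaA (lin_sum bl) (lin_sum Dl); apply: eq_bigr => i _.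
rewrite (linB bl) !bmapA_mul (derivation_lie _ _ dD).
by rewrite /lieA opprB addrC.
Qed.

Lemma tenA_der_of x : tenA (der_of x) = oneD id x.
Proof. by rewrite -[LHS]/(tenA (fun v => id (der_of x v))) tenA_comp. Qed.

Lemma bmapA_hbrA s t : tenA (der_of s) = s -> tenA (der_of t) = t ->
  bmapA s = 0 -> bmapA t = 0 -> bmapA (hbrA s t) = 0.
Proof.
move=> es et.
have <- : der_of s omegaA = bmapA s.
  by rewrite -[in RHS]es (bmapA_tenA (derA_derivation _ _)).
have <- : der_of t omegaA = bmapA t.
  by rewrite -[in RHS]et (bmapA_tenA (derA_derivation _ _)).
move=> s0 t0; rewrite /hbrA bmapA_tenA; last by apply: derivation_comm; exact: derA_derivation.
have l0 x : der_of x 0 = 0 by exact: (lin0 (derA_lin _ _)).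
by rewrite s0 t0 !l0 subrr.
Qed.

Lemma omega_anti (i j : 'I_(g + g)) : omega g j i = - omega g i j.
Proof.
suff : (omega g)^T = - omega g by move/matrixP => /(_ i j); rewrite !mxE.
by rewrite /omega tr_block_mx opp_block_mx !trmx0 !oppr0 linearN /= trmx1 opprK.
Qed.

Lemma oneD_words i0 (u v : 'I_(g + g)) (s t : seq 'I_(g + g)) :
  oneD (der_of (wo (u :: s))) (wo (v :: t)) =
  \sum_(p < size t) omega g u (nth i0 t p) *: wo ((v :: take p t) ++ s ++ drop p.+1 t).
Proof.
rewrite (wo_cons wa v t) oneD_mul; last exact: derA_lin.
rewrite /der_of /derA wlin_w mulr_sumr; apply: eq_bigr => p _.
rewrite contrA_cons (tnth_nth i0) cat_cons (wo_cons wa v (_ ++ _)) !ww_cat (w_scr wa) -scalerAl (w_scr wa).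
by rewrite !mulrA.
Qed.

Definition contr2 : A -> A :=
  lx (fun w => if w is i :: j :: w' then omega g i j *: wo w' else 0).

Lemma contr2_mul i j x : contr2 (wo [:: i; j] * x) = omega g i j *: x.
Proof.
move: x; apply: wext => [||w].
- exact: lin_comp (wlin_lin wa _) (wlin_mulr wa _).
- by apply: lin_scale.
by rewrite -ww_cat /contr2 wlin_w.
Qed.

(** Antisymmetry of [omega] makes the two terms add up; this is the factor 2 of
    [c2_bracket_lift]. *)
Lemma contr2_lie i j (u : seq 'I_(g + g)) :
  contr2 (wo [:: i, j & u] - wo [:: j, i & u]) = (2 * omega g i j) *: wo u.
Proof.
have cl : lin contr2 := wlin_lin wa _.
rewrite (linB cl) /contr2 !wlin_w -scalerBl (omega_anti i j) opprK.
by rewrite mulr_natl mulr2n.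
Qed.

End SymplecticAlgebra.

Section TensorAlgebra.
Context (g : nat).

Definition twalg d : walg d (tensor d) := WAlg (@mulr_scale d) (@word_cat d)
  (@word_nil d) (@linext_lin d) (@linext_word d) (@word_ind d).

End TensorAlgebra.

(** * Equivariant maps between tensor powers and the lifted bracket *)

Section TensorMaps.
Context (d : nat).
Local Notation T := (tensor d).
Implicit Types (x y z : T) (F G : T -> T).

Lemma ghomT n F : lin F -> (forall M x, homog n x -> F (gl_act M x) = gl_act M (F x)) ->
  (forall x, homog n x -> homog n (F x)) -> ghom (tframe d n) F.
Proof.
move=> Fl Fc Fh; split=> // [M x hx|x hx]; last by apply/homogE/Fh/homogE.
have hx' : homog n x by apply/homogE.
rewrite -(gl_actE M hx) -(gl_actE M (n := n)); first exact: Fc.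
by apply/homogE; apply: Fh.
Qed.

Lemma ghomP n F : ghom (tframe d n) F ->
  [/\ lin F, forall M x, homog n x -> F (gl_act M x) = gl_act M (F x)
    & forall x, homog n x -> homog n (F x)].
Proof.
move=> [Fl Fc Fh]; split=> // [M x /homogE hx|x /homogE hx]; last by apply/homogE/Fh.
by rewrite (gl_actE M hx) (gl_actE M (Fh x hx)); apply: Fc.
Qed.

Lemma ghom_sub n F G : ghom (tframe d n) F -> ghom (tframe d n) G ->
  ghom (tframe d n) (fun x => F x - G x).
Proof.
move=> [Fl Fc Fh] [Gl Gc Gh]; split; first exact: lin_sub.
  by move=> M x hx; rewrite (tlinB _ _ (gact_lin (tframe d n) M)) Fc // Gc.
by move=> x hx; apply: (subB (hom_sub _)); [apply: Fh|apply: Gh].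
Qed.

Lemma ghom_sum n (J : finType) (F : J -> T -> T) : (forall i, ghom (tframe d n) (F i)) ->
  ghom (tframe d n) (fun x => \sum_i F i x).
Proof.
move=> gF; split.
- by apply: lin_bigsum => i; case: (gF i).
- move=> M x hx; rewrite (lin_sum (gact_lin (tframe d n) M)).
  by apply: eq_bigr => i _; case: (gF i) => _ Fc _; apply: Fc.
- by move=> x hx; apply: (sub_lin (hom_sub _)) => i _; case: (gF i) => _ _; apply.
Qed.

Definition tmap m F G : T -> T :=
  linext (fun w => F (word (take m w)) * G (word (drop m w))).

Lemma tmap_lin m F G : lin (tmap m F G). Proof. exact: linext_lin. Qed.

Lemma tmap_mul m F G x y : lin F -> lin G -> homog m x -> tmap m F G (x * y) = F x * G y.
Proof.
move=> Fl Gl; move: x; apply: homog_ext.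
- exact: lin_comp (tmap_lin m F G) (lin_mull y).
- exact: lin_comp (lin_mull _) Fl.
move=> s ss; move: y; apply: word_ext.
- exact: lin_comp (tmap_lin m F G) (lin_mulr _).
- exact: lin_comp (lin_mulr _) Gl.
move=> t; rewrite -word_cat [LHS]linext_word.
have -> : take m (s ++ t) = s by rewrite take_size_cat.
have -> : drop m (s ++ t) = t by rewrite drop_size_cat.
by [].
Qed.

Lemma tmap_ghom m n F G : ghom (tframe d m) F -> ghom (tframe d n) G ->
  ghom (tframe d (m + n)) (tmap m F G).
Proof.
move=> /ghomP [Fl Fc Fh] /ghomP [Gl Gc Gh].
have split_word s : size s = (m + n)%N ->
    [/\ homog m (word (take m s) : T), homog n (word (drop m s) : T)
      & word s = word (take m s) * word (drop m s) :> T].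
  move=> ss; split; last by rewrite -word_cat cat_take_drop.
    have {1}-> : m = size (take m s) by rewrite size_takel // ss leq_addr.
    exact: homog_word.
  have {1}-> : n = size (drop m s) by rewrite size_drop ss addKn.
  exact: homog_word.
apply: ghomT; first exact: tmap_lin.
- move=> M; apply: homog_ext.
  + exact: lin_comp (tmap_lin m F G) (gl_act_lin M).
  + exact: lin_comp (gl_act_lin M) (tmap_lin m F G).
  move=> s /split_word [ht hd ->].
  set a := word (take m s) in ht *; set b := word (drop m s) in hd *.
  apply: (etrans (congr1 (tmap m F G) (gl_act_mul M a b))).
  apply: (etrans (tmap_mul _ Fl Gl (@homog_gl_act _ _ M _ ht))).
  apply: esym; apply: (etrans (congr1 (gl_act M) (tmap_mul b Fl Gl ht))).
  apply: (etrans (gl_act_mul M (F a) (G b))).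
  exact: (congr2 (fun x y => x * y) (esym (Fc M a ht)) (esym (Gc M b hd))).
- apply: homog_ind; first exact: (sub_pre (tmap_lin m F G) (@homog_sub d _)).
  move=> s /split_word [ht hd ->]; rewrite (tmap_mul _ Fl Gl ht).
  by apply: homog_mul; [apply: Fh|apply: Gh].
Qed.

Section Places.
Context (i0 : 'I_d).

(** A place permutation encoded by the list of positions to be read, which makes the explicit
    rearrangements in the bracket easy to write. *)
Definition places (r : seq nat) : T -> T :=
  linext (fun w => word [seq nth i0 w p | p <- r]).

Lemma nth_codomF n (v : {ffun 'I_n -> 'I_d}) (p : 'I_n) : nth i0 (codom v) p = v p.
Proof.
rewrite -[codom v]/(map v (enum 'I_n)) (nth_map p) ?size_enum_ord //.
by rewrite nth_ord_enum.
Qed.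

Lemma places_ghom n r : perm_eq r (iota 0 n) -> ghom (tframe d n) (places r).
Proof.
move=> pr; have rn : size r = n by rewrite (perm_size pr) size_iota.
have ur : uniq r by rewrite (perm_uniq pr) iota_uniq.
have lt (p : 'I_n) : (nth 0%N r p < n)%N.
  have : nth 0%N r p \in r by rewrite mem_nth ?rn.
  by rewrite (perm_mem pr) mem_iota.
pose h p := Ordinal (lt p).
have h_inj : injective h.
  move=> p q /(congr1 val) /= /eqP; rewrite nth_uniq ?rn // => /eqP e.
  exact: val_inj.
pose s : 'S_n := perm h_inj.
have pE x : thom (tframe d n) x -> places r x = plc (tframe d n) s x.
  move: x; apply: wd_ind; first exact: (sub_eq (linext_lin _) (plc_lin _ s)).
  move=> v; rewrite plc_wd [LHS]linext_word; congr word.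
  apply: (eq_from_nth (x0 := i0)); first by rewrite size_map rn size_codomF.
  rewrite size_map rn => p pn; rewrite (nth_map 0%N) ?rn //.
  rewrite (nth_codomF (fcomp v s) (Ordinal pn)) ffunE permE.
  by rewrite -(nth_codomF v).
have [pl pc ph] : ghom (tframe d n) (plc (tframe d n) s).
  by split=> [|M x _|x _]; [exact: plc_lin|exact: plc_gact|exact: hom_plc].
split; first exact: linext_lin.
- by move=> M x hx; rewrite (pE _ hx) (pE _ (hom_gact _ M x)); apply: pc.
- by move=> x hx; rewrite (pE _ hx); apply: ph.
Qed.

(* Positions in s ++ t of s_0, t_p and of the word obtained from t by         *)
(* replacing t_p with s_1 .. s_k.1, where p > 0.                              *)
Definition left_rest (k l p : nat) : seq nat :=
  iota k.+2 p.+1 ++ iota 1 k.+1 ++ iota (k.+2 + p.+2) (l.+2 - p.+2).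
Definition right_rest (k l q : nat) : seq nat :=
  iota 0 q.+1 ++ iota k.+3 l.+1 ++ iota q.+2 (k.+2 - q.+2).

(** One summand per contraction in the bracket: the leading letter of one factor and a later letter
    of the other come first, antisymmetrised, followed by the remaining word. Unlike the bracket,
    this map is GL-equivariant. *)
Definition bracket_lift k l x : T :=
  \sum_(p < l.+1) (places [:: 0%N, (k.+2 + p.+1)%N & left_rest k l p] x
                   - places [:: (k.+2 + p.+1)%N, 0%N & left_rest k l p] x)
  - \sum_(q < k.+1) (places [:: k.+2, q.+1 & right_rest k l q] x
                   - places [:: q.+1, k.+2 & right_rest k l q] x).

Lemma bracket_lift_ghom k l : ghom (tframe d (k.+2 + l.+2)) (bracket_lift k l).
Proof.
have perm_iota n (r : seq nat) : (size r <= n)%N -> (forall p, (p < n)%N -> p \in r) -> perm_eq r (iota 0 n).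
  move=> sr nr; have sub : {subset iota 0 n <= r} by move=> p; rewrite mem_iota => /andP [_ /nr].
  have ss : (size r <= size (iota 0 n))%N by rewrite size_iota.
  have ur := leq_size_uniq (iota_uniq 0 n) sub ss.
  rewrite perm_sym; apply: uniq_perm; rewrite ?iota_uniq //.
  by move=> p; have [_ e] := uniq_min_size (iota_uniq 0 n) sub ss; rewrite e.
apply: ghom_sub; apply: ghom_sum => p; have lp := ltn_ord p; apply: ghom_sub;
  apply: places_ghom; apply: perm_iota => [|x xn];
  rewrite /left_rest /right_rest ?(in_cons, mem_cat, mem_iota) /= ?(size_cat, size_iota) /= ?(size_cat, size_iota); lia.
Qed.
End Places.
End TensorMaps.

Lemma lin_sum_diff (U V : lmodType rat) (F : U -> V) (I J : finType) (k : rat)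
  (a : I -> U) (b : J -> U) (c : I -> V) (e : J -> V) : lin F ->
  (forall i, F (a i) = k *: c i) -> (forall j, F (b j) = k *: e j) ->
  F (\sum_i a i - \sum_j b j) = k *: (\sum_i c i - \sum_j e j).
Proof.
move=> Fl ha hb; rewrite (linB Fl) !(lin_sum Fl) scalerBr !scaler_sumr.
by congr (_ - _); apply: eq_bigr => i _.
Qed.

Lemma scale_eqA (V : lmodType rat) (W : Type) (F : W -> V) (k a b : rat) (x y : W) :
  a = b -> x = y -> (k * a) *: F x = k *: (b *: F y).
Proof. by move=> -> ->; rewrite scalerA. Qed.

Section BracketLift.
Context (g : nat).
Local Notation d := (g + g)%N.
Local Notation T := (tensor d).
Local Notation tw := (twalg d).
Local Notation c2 := (contr2 tw).
Implicit Types (x y z s t : T).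
Context (i0 : 'I_d).

Lemma hbracketA s t : hbracket s t = oneD tw (der_of tw s) t - oneD tw (der_of tw t) s.
Proof. exact: (hbrAE tw). Qed.

Lemma hbracket_linl t : lin (fun s => hbracket s t).
Proof. exact: (hbrA_linl tw). Qed.
Lemma hbracket_linr s : lin (hbracket s).
Proof. exact: (hbrA_linr tw). Qed.

Lemma c2_lin : lin c2. Proof. exact: linext_lin. Qed.

Lemma c2_places i j r (w : seq 'I_d) :
  c2 (places i0 [:: i, j & r] (word w) - places i0 [:: j, i & r] (word w))
  = (2 * omega g (nth i0 w i) (nth i0 w j)) *: word [seq nth i0 w p | p <- r].
Proof.
have -> : places i0 [:: i, j & r] (word w)
    = word [:: nth i0 w i, nth i0 w j & [seq nth i0 w p | p <- r]] by exact: linext_word.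
have -> : places i0 [:: j, i & r] (word w)
    = word [:: nth i0 w j, nth i0 w i & [seq nth i0 w p | p <- r]] by exact: linext_word.
exact: (contr2_lie tw).
Qed.

Lemma left_restE k l p (u v : 'I_d) (s t : seq 'I_d) : size s = k.+1 -> size t = l.+1 ->
  (p < l.+1)%N -> [seq nth i0 (u :: s ++ v :: t) r | r <- left_rest k l p]
  = (v :: take p t) ++ s ++ drop p.+1 t.
Proof.
move=> ss st pl; set w := u :: _.
have sw : size w = (k.+2 + l.+2)%N by rewrite /w /= size_cat /= ss st; lia.
have wE : w = (u :: s) ++ (v :: t) by [].
rewrite /left_rest !map_cat !map_nth_iota ?sw; try lia.
congr (_ ++ (_ ++ _)).
- by rewrite wE drop_size_cat /= ?ss.
- by rewrite /w /= drop0 take_size_cat.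
- rewrite wE drop_cat /= ss ifF; last by lia.
  have -> : (k.+2 + p.+2 - k.+2)%N = p.+2 by lia.
  by rewrite /= take_oversize // size_drop st; lia.
Qed.

Lemma right_restE k l q (u v : 'I_d) (s t : seq 'I_d) : size s = k.+1 -> size t = l.+1 ->
  (q < k.+1)%N -> [seq nth i0 (u :: s ++ v :: t) r | r <- right_rest k l q]
  = (u :: take q s) ++ t ++ drop q.+1 s.
Proof.
move=> ss st ql; set w := u :: _.
have sw : size w = (k.+2 + l.+2)%N by rewrite /w /= size_cat /= ss st; lia.
have wE : w = (u :: s) ++ (v :: t) by [].
rewrite /right_rest !map_cat !map_nth_iota ?sw; try lia.
congr (_ ++ (_ ++ _)).
- by rewrite /w /= takel_cat // ss; lia.
- have -> : w = (u :: rcons s v) ++ t by rewrite /w /= cat_rcons.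
  by rewrite drop_size_cat /= ?size_rcons ?ss // take_oversize // st.
- rewrite wE drop_cat /= ss; case: ltnP => h.
    by rewrite takel_cat ?size_drop ?ss ?take_oversize // size_drop ss; lia.
  have -> : q = k by lia.
  by rewrite subnn take0 drop_oversize // ss.
Qed.

Lemma c2_bracket_lift k l s t : homog k.+2 s -> homog l.+2 t ->
  c2 (bracket_lift i0 k l (s * t)) = 2 *: hbracket s t.
Proof.
have bl : lin (bracket_lift i0 k l) by case: (bracket_lift_ghom i0 k l).
move=> hs ht; move: s hs; apply: homog_ext.
- exact: lin_comp c2_lin (lin_comp bl (lin_mull t)).
- by apply: lin_scale; exact: hbracket_linl.
case=> [//|u s] [ss]; move: t ht; apply: homog_ext.
- exact: lin_comp c2_lin (lin_comp bl (lin_mulr _)).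
- by apply: lin_scale; exact: hbracket_linr.
case=> [//|v t] [st]; rewrite -word_cat.
have e1 : oneD tw (der_of tw (word (u :: s))) (word (v :: t)) = \sum_(p < l.+1)
    omega g u (nth i0 t p) *: word ((v :: take p t) ++ s ++ drop p.+1 t).
  by rewrite -st; exact: (oneD_words tw).
have e2 : oneD tw (der_of tw (word (v :: t))) (word (u :: s)) = \sum_(p < k.+1)
    omega g v (nth i0 s p) *: word ((u :: take p s) ++ t ++ drop p.+1 s).
  by rewrite -ss; exact: (oneD_words tw).
have nu p : nth i0 (u :: s ++ v :: t) (k.+2 + p)%N = nth i0 (v :: t) p.
  by rewrite -cat_cons nth_cat /= ss ltnNge leq_addr /= addKn.
have eh := etrans (hbracketA (word (u :: s)) (word (v :: t)))
  (congr2 (fun a b => a - b) e1 e2).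
apply: esym; apply: (etrans (congr1 (fun x => 2 *: x) eh)); apply: esym.
apply: (lin_sum_diff c2_lin) => p; apply: (etrans (c2_places _ _ _ _));
  apply: (scale_eqA (@word d) 2); last first.
- exact: right_restE ss st (ltn_ord p).
- have := nu 0%N; rewrite addn0 cat_cons => -> /=.
  by rewrite nth_cat ss ltn_ord.
- exact: left_restE ss st (ltn_ord p).
- by rewrite cat_cons (nu p.+1).
Qed.

Lemma c2_tmap n f z : lin f -> homog (2 + n) z -> c2 (tmap 2 id f z) = f (c2 z).
Proof.
move=> fl; move: z; apply: homog_ext.
- exact: lin_comp c2_lin (tmap_lin 2 id f).
- exact: lin_comp fl c2_lin.
case=> [|i [|j w]] // _.
have -> : tmap 2 id f (word [:: i, j & w]) = word [:: i; j] * f (word w).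
  by rewrite [LHS]linext_word /= take0 drop0.
have -> : c2 (word [:: i, j & w]) = omega g i j *: word w by exact: linext_word.
by rewrite (linZ fl); exact: (contr2_mul tw).
Qed.

Lemma tmap_places_ext2 n (B : T -> Prop) f i j r (w : seq 'I_d) : lin f ->
  (forall x, homog n x -> B (f x)) -> size r = n ->
  tens (@ext2 d) B (tmap 2 id f (places i0 [:: i, j & r] (word w)
                                 - places i0 [:: j, i & r] (word w))).
Proof.
move=> fl fB rn; set v := [seq nth i0 w p | p <- r].
set a := nth i0 w i; set b := nth i0 w j.
have tl := tmap_lin 2 id f.
have e c e' u : tmap 2 id f (word [:: c, e' & u]) = word [:: c; e'] * f (word u).
  by apply: (etrans (linext_word _ _)); rewrite /= take0 drop0.
have e1 := etrans (congr1 (tmap 2 id f) (linext_word _ _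
  : places i0 [:: i, j & r] (word w) = word [:: a, b & v])) (e a b v).
have e2 := etrans (congr1 (tmap 2 id f) (linext_word _ _
  : places i0 [:: j, i & r] (word w) = word [:: b, a & v])) (e b a v).
have e3 := etrans (etrans (tlinB _ _ tl) (congr2 (fun x y => x - y) e1 e2))
  (esym (mulrBl _ _ _)).
apply: (eq_ind_r (tens _ _) _ e3).
apply: tens_mem; last by apply: fB; rewrite -rn -(size_map (nth i0 w) r); exact: homog_word.
apply: vspan_mem; exists (gen a), (gen b); split; [exact: (@homog_word d [:: a])|exact: (@homog_word d [:: b])|].
exact: (congr2 (fun x y => x - y) (word_cons a [:: b]) (word_cons b [:: a])).
Qed.

Lemma bracket_lift_ext2 n (B : T -> Prop) f k l x : lin f ->
  (forall x, homog n x -> B (f x)) -> (k + l).+2 = n ->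
  tens (@ext2 d) B (tmap 2 id f (bracket_lift i0 k l x)).
Proof.
move=> fl fB kl; have bl : lin (bracket_lift i0 k l) by case: (bracket_lift_ghom i0 k l).
move: x; apply: word_ind.
  exact: (sub_pre (lin_comp (tmap_lin 2 id f) bl) (tens_sub _ _)).
move=> w; rewrite /bracket_lift (tlinB _ _ (tmap_lin 2 id f)) !(lin_sum (tmap_lin 2 id f)).
apply: (subB (tens_sub _ _)); apply: (sub_lin (tens_sub _ _)) => p _;
  apply: (tmap_places_ext2 (n := n)) => //; have := ltn_ord p;
  rewrite /left_rest /right_rest ?(size_cat, size_iota); lia.
Qed.

(* 2 f(hbracket s t) is the contraction with omega of the value at s (x) t of *)
(* (1 (x) f) o bracket_lift, a GL-equivariant map into ext2 (x) S_nu.         *)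
Lemma bracket_condC k l lam mu nu f g1 g2 s t :
  sumn lam = k.+2 -> sumn mu = l.+2 -> sumn nu = (k + l).+2 ->
  ghom (tframe d (k + l).+2) f -> (forall x, homog (k + l).+2 x -> schur nu (f x)) ->
  ghom (tframe d k.+2) g1 -> ghom (tframe d l.+2) g2 ->
  schur lam s -> schur mu t -> f (hbracket (g1 s) (g2 t)) <> 0 -> condC g lam mu nu.
Proof.
move=> lk ml nn gf fS gg1 gg2 Ss St ne.
have [fl _ _] := ghomP gf; have [g1l _ g1h] := ghomP gg1; have [g2l _ g2h] := ghomP gg2.
have hs := schur_homog Ss; rewrite lk in hs.
have ht := schur_homog St; rewrite ml in ht.
have Ne : (k.+2 + l.+2 = 2 + (k + l).+2)%N by lia.
pose G x := tmap 2 id f (bracket_lift i0 k l (tmap k.+2 g1 g2 x)).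
have gid : ghom (tframe d 2) id by split.
have gG : ghom (tframe d (k.+2 + l.+2)) G.
  apply: (ghom_comp (f := tmap 2 id f)); first by rewrite Ne; exact: tmap_ghom.
  by apply: ghom_comp; [exact: bracket_lift_ghom|exact: tmap_ghom].
apply: (common_summand (n := (k.+2 + l.+2)%N) (G := G) (z := s * t)) => //.
- by apply: tens_gl_submod; exact: schur_gl_submod.
- by rewrite -lk -ml; apply: tens_homog; exact: schur_homog.
- by apply: tens_gl_submod; [exact: ext2_gl_submod|exact: schur_gl_submod].
- by rewrite Ne -nn; apply: tens_homog; [exact: ext2_homog|exact: schur_homog].
- by move=> x _; apply: (bracket_lift_ext2 (n := (k + l).+2)).
- exact: tens_mem.
have e1 : tmap k.+2 g1 g2 (s * t) = g1 s * g2 t by exact: tmap_mul.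
rewrite /G e1 => G0; apply: ne.
have hz : homog (2 + (k + l).+2) (bracket_lift i0 k l (g1 s * g2 t)).
  rewrite -Ne; have [_ _ bh] := ghomP (bracket_lift_ghom i0 k l); apply: bh.
  by apply: homog_mul; [exact: g1h|exact: g2h].
have := c2_tmap fl hz; rewrite G0 (lin0 c2_lin) c2_bracket_lift; [|exact: g1h|exact: g2h].
rewrite (linZ fl) => /esym h2.
have : (2 : rat)^-1 *: (2 *: f (hbracket (g1 s) (g2 t))) = 0 by rewrite h2 scaler0.
by rewrite scalerA mulVf // scale1r.
Qed.
End BracketLift.

(** * Stability of the symplectic derivations under GL and the bracket *)

Section FreeLie.
Context (d : nat) (i0 : 'I_d).
Local Notation T := (tensor d).
Implicit Types (x y : T).

Lemma free_lie_sub : vsub (@free_lie d).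
Proof.
split; last by move=> a x y; apply: FreeLieLin.
(* No constructor yields [0]: it is [- e + e] for a generator [e], whence the letter [i0]. *)
have := FreeLieLin (-1) (FreeLieGen i0) (FreeLieGen i0).
by rewrite scaleN1r addNr.
Qed.

Lemma gl_act_gen (M : 'M[rat]_d) i : gl_act M (gen i) = \sum_j M j i *: gen j.
Proof. by apply: (etrans (gl_act_word M [:: i])); rewrite big_seq1. Qed.

Lemma lie_deg_sub n : vsub (@lie_deg d n).
Proof. by apply: sub_and; [exact: free_lie_sub|exact: homog_sub]. Qed.

Lemma free_lie_gl_act (M : 'M[rat]_d) x : free_lie x -> free_lie (gl_act M x).
Proof.
elim=> [i|a {}x y _ hx _ hy|{}x y _ hx _ hy].
- rewrite gl_act_gen; apply: (sub_lin free_lie_sub) => j _.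
  by apply: (subZ free_lie_sub); exact: FreeLieGen.
- by rewrite gl_act_lin; exact: FreeLieLin.
- by rewrite (morph_lie (gl_act_lin M) (gl_act_mul M)); exact: FreeLieBr.
Qed.

Lemma lie_deg_gl_submod n : gl_submod (@lie_deg d n).
Proof.
split; first exact: lie_deg_sub.
by move=> M _ x [fx hx]; split; [exact: free_lie_gl_act|exact: homog_gl_act].
Qed.

Lemma der_free_lie (f : 'I_d -> T) x : (forall i, free_lie (f i)) ->
  free_lie x -> free_lie (der f x).
Proof.
move=> ff; elim=> [i|a {}x y _ hx _ hy|{}x y lx hx ly hy].
- by have -> : der f (gen i) = f i by exact: (derA_gen (twalg d)).
- have -> : der f (a *: x + y) = a *: der f x + der f y by exact: (derA_lin (twalg d)).
  exact: FreeLieLin.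
- have -> : der f (lie x y) = lie (der f x) y + lie x (der f y).
    exact: (derivation_lie x y (derA_derivation (twalg d) f)).
  by apply: (subD free_lie_sub); exact: FreeLieBr.
Qed.

Lemma der_homog (f : 'I_d -> T) k m x : (forall i, homog k.+1 (f i)) ->
  homog m x -> homog (m + k) (der f x).
Proof.
move=> fh; have dl : lin (der f) by exact: (derA_lin (twalg d)).
move: x; apply: homog_ind; first exact: (sub_pre dl (@homog_sub d _)).
move=> s <-; elim: s => [|i s IH].
  have -> : der f (word [::]) = 0 by exact: (derA_nil (twalg d)).
  by case: (@homog_sub d (size (Nil 'I_d) + k)).
have -> : der f (word (i :: s)) = f i * word s + gen i * der f (word s).
  exact: (derA_cons (twalg d)).
apply: (subD (@homog_sub d _)).
  have -> : (size (i :: s) + k = k.+1 + size s)%N by rewrite /= addnC addnS.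
  by apply: homog_mul; [exact: fh|exact: homog_word].
have -> : (size (i :: s) + k = 1 + (size s + k))%N by rewrite /= addSn.
by apply: homog_mul => //; exact: (@homog_word d [:: i]).
Qed.

Lemma homog1_gen x : homog 1 x -> forall Q : T -> Prop, vsub Q -> (forall i, Q (gen i)) -> Q x.
Proof.
move=> hx Q Qs Qg; move: x hx; apply: homog_ind => //.
by case=> [|i [|//]] // _; exact: Qg.
Qed.

Lemma bracket_map_gl_act (M : 'M[rat]_d) x : bracket_map (gl_act M x) = gl_act M (bracket_map x).
Proof.
move: x; apply: (bmapA_morph (wa := twalg d) (m := M)).
- exact: gl_act_lin.
- by rewrite -(@word_nil d); apply: (etrans (gl_act_word M [::])); rewrite big_nil word_nil.
- exact: gl_act_mul.
- exact: gl_act_gen.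
Qed.
End FreeLie.

Section SymplecticDerivations.
Context (g : nat) (i0 : 'I_(g + g)).
Local Notation d := (g + g)%N.
Local Notation T := (tensor d).
Local Notation tw := (twalg d).
Implicit Types (x y s t : T).

Lemma bracket_map_lin : lin (@bracket_map d). Proof. exact: linext_lin. Qed.

Lemma tens_gen_le (R : T -> Prop) (B : T -> Prop) : vsub R ->
  (forall i v, B v -> R (gen i * v)) -> forall x, tens (@homog d 1) B x -> R x.
Proof.
move=> Rs h; apply: tens_le => // u v hu Bv.
apply: (homog1_gen hu (sub_pre (lin_mull v) Rs)) => i; exact: h.
Qed.

Lemma hder_homog k t : hder k t -> homog k.+2 t.
Proof. by case=> ht _; apply: (tens_homog (m := 1) (n := k.+1)) ht => // x []. Qed.

Lemma hder_sub k : vsub (@hder g k).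
Proof. by apply: sub_and; [exact: tens_sub|exact: (sub_zero bracket_map_lin)]. Qed.

Lemma homog_gl_submod n : gl_submod (@homog d n).
Proof. by split=> [|M _ x]; [exact: homog_sub|exact: homog_gl_act]. Qed.

Lemma hder_gl_submod k : gl_submod (@hder g k).
Proof.
split; first exact: hder_sub.
move=> M uM x [tx bx]; split.
  have [_] := tens_gl_submod (homog_gl_submod 1) (lie_deg_gl_submod i0 k.+1).
  exact.
by rewrite (bracket_map_gl_act M x) bx (lin0 (gl_act_lin M)).
Qed.

Lemma contract_lie_deg k s j : hder k s -> lie_deg k.+1 (contract s j).
Proof.
case=> ts _; have cl : lin (fun s => contract s j) by exact: (contrA_lin tw).
move: s ts; apply: tens_gen_le; first exact: (sub_pre cl (lie_deg_sub i0 _)).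
move=> i v Lv; have -> : contract (gen i * v) j = omega g i j *: v.
  exact: (contrA_mul tw).
exact: (subZ (lie_deg_sub i0 _)).
Qed.

Lemma oneD_tens k l s t : hder k s -> hder l t ->
  tens (@homog d 1) (@lie_deg d (k + l).+1) (oneD tw (der_of tw s) t).
Proof.
move=> hs [tt _]; move: t tt; apply: tens_gen_le.
  exact: (sub_pre (oneD_lin tw _) (tens_sub _ _)).
move=> i v [fv hv].
have -> : oneD tw (der_of tw s) (gen i * v) = gen i * der_of_tensor s v.
  exact: (oneD_mul tw i v (derA_lin tw _)).
apply: tens_mem; first exact: (@homog_word d [:: i]).
have cs j := contract_lie_deg j hs.
split; first by apply: (der_free_lie i0) => // j; case: (cs j).
have -> : (k + l).+1 = (l.+1 + k)%N by rewrite addSn addnC.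
by apply: der_homog => // j; case: (cs j).
Qed.

Lemma hder_tenA k s : hder k s -> tenA tw (der_of tw s) = s.
Proof.
case=> ts _; apply: (etrans (tenA_der_of tw s)); move: s ts; apply: tens_gen_le.
  exact: (sub_eq (oneD_lin tw id) (@lin_id d)).
by move=> i v _; exact: (oneD_mul tw (D := id) i v (@lin_id d)).
Qed.

(** Derivations with Lie values preserve the free Lie algebra, and a commutator of derivations
    killing the symplectic element kills it too. *)
Lemma hder_hbracket k l s t : hder k s -> hder l t -> hder (k + l) (hbracket s t).
Proof.
move=> hs ht; split.
  apply: (eq_ind_r _ _ (hbracketA s t)); apply: (subB (tens_sub _ _)).
    exact: oneD_tens.
  by rewrite addnC; exact: oneD_tens.
apply: (bmapA_hbrA (wa := tw)); [exact: hder_tenA hs|exact: hder_tenA ht| |].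
  by case: hs.
by case: ht.
Qed.
End SymplecticDerivations.

(** * Symplectic invariants *)

Section Adjoint.
Context (d n : nat) (V : lmodType rat) (fr : frame d n V).

(** Turns a pairing with a copy [f x] of a Schur module into a GL-map towards that module. *)
Definition adj (f : V -> V) x : V := mk fr (fun v => ip fr x (f (fe fr v))).

Lemma ip_adj f x y : lin f -> thom fr y -> ip fr (adj f x) y = ip fr x (f y).
Proof.
move=> fl; move: y; apply: wd_ind.
  apply: (@sub_eq _ rat^o); first exact: ip_linr.
  exact: lin_comp (ip_linr fr x) fl.
by move=> v; rewrite ip_wd cf_mk.
Qed.

Lemma adj_ghom f : ghom fr f -> ghom fr (adj f).
Proof.
move=> [fl fc fh]; split.
- by apply: mk_lin => v; exact: ip_linl.
- move=> M x hx; apply: (ip_ext (hom_mk _ _) (hom_gact _ _ _)) => z hz.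
  by rewrite ip_adj // !gact_adj ip_adj ?fc //; exact: hom_gact.
- by move=> x _; exact: hom_mk.
Qed.
End Adjoint.

Lemma ydelta_cons r c : ydelta (r :: c) = [:: r, r & ydelta c].
Proof. by []. Qed.

Lemma sumn_ydelta c : sumn (ydelta c) = (2 * sumn c)%N.
Proof. by elim: c => // r c IH; rewrite ydelta_cons /= IH; lia. Qed.

Lemma size_ydelta c : size (ydelta c) = (2 * size c)%N.
Proof. by elim: c => // r c IH; rewrite ydelta_cons /= IH; lia. Qed.

Lemma ydelta_inj : injective ydelta.
Proof.
elim=> [|r c IH] [|q e] //; rewrite !ydelta_cons => h.
by congr (_ :: _); [case: h|apply: IH; case: h].
Qed.

Lemma mem_ydelta c x : (x \in ydelta c) = (x \in c).
Proof. by elim: c => // r c IH; rewrite ydelta_cons !inE IH orbA orbb. Qed.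

Lemma young_ydelta c : young_diagram (ydelta c) = young_diagram c.
Proof.
rewrite /young_diagram mem_ydelta; congr (_ && _).
case: c => // r c; rewrite ydelta_cons /= leqnn /=.
elim: c r => // q c IH r; rewrite ydelta_cons /= IH leqnn.
by rewrite andTb.
Qed.

Lemma ydelta_of c : 0%N \notin c ->
  (forall i, nth 0%N c i.*2 = nth 0%N c i.*2.+1) -> exists e, c = ydelta e.
Proof.
have [k] := ubnP (size c); elim: k c => // k IH [|a [|b c]] sz c0 h.
- by exists [::].
(* A last unpaired row would equal the default 0. *)
- by have /= a0 := h 0%N; rewrite a0 in c0.
have [||e ce] := IH c _ _ (fun i => h i.+1).
- by move: sz; rewrite /= !ltnS; apply: leq_trans.
- by apply: contra c0; rewrite !inE => ->; rewrite !orbT.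
by exists (a :: e); rewrite ydelta_cons -ce (h 0%N : a = b).
Qed.

(** * The symplectic form in an interleaved basis *)

Section PairedBasis.
Context (g : nat).
Local Notation d := (g + g)%N.

Lemma half_lt (a : 'I_d) : (a./2 < g)%N.
Proof. by have := ltn_ord a; lia. Qed.

Definition pairing_fun (a : 'I_d) : 'I_d :=
  if odd a then rshift g (Ordinal (half_lt a)) else lshift g (Ordinal (half_lt a)).

Lemma pairing_inj : injective pairing_fun.
Proof.
move=> a b; rewrite /pairing_fun => /(congr1 val) e; apply: val_inj; move: e.
by have := half_lt a; have := half_lt b; case: ifP; case: ifP => /= ? ?; lia.
Qed.

(* e_0, e_1, e_2, .. = x_1, y_1, x_2, y_2, .. *)
Definition pairing : {perm 'I_d} := perm pairing_inj.

Lemma partner_lt (a : 'I_d) : ((if odd a then a.-1 else a.+1) < d)%N.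
Proof. by have := ltn_ord a; case: ifP; lia. Qed.

Definition partner (a : 'I_d) : 'I_d := Ordinal (partner_lt a).
Definition psign (a : 'I_d) : rat := (-1) ^+ odd a.

Lemma partnerK : involutive partner.
Proof. by move=> a; apply: val_inj => /=; case: ifP; case: ifP; lia. Qed.

Lemma psign_partner a : psign (partner a) = - psign a.
Proof.
rewrite /psign /=; have -> : odd (if odd a then a.-1 else a.+1) = ~~ odd a.
  by case: ifP; lia.
by case: (odd a); rewrite ?expr0 ?expr1 ?opprK.
Qed.

(** [partner] exchanges the neighbours 2i and 2i + 1, so it reverses the order only inside a pair.
    The basis is interleaved for this reason. *)
Lemma partner_lt_or (p q : 'I_d) : (q < p)%N -> q = partner p \/ (partner q <= partner p)%N.
Proof.
move=> qp; have [e|ne] := eqVneq (q : nat) (partner p); first by left; apply: val_inj.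
by right; move: ne => /=; case: ifP; case: ifP; lia.
Qed.

Definition pform : 'M[rat]_d := \matrix_(a, b) omega g (pairing a) (pairing b).

Lemma pformE a b : pform a b = psign a * (b == partner a)%:R.
Proof.
rewrite mxE !permE /pairing_fun /psign /omega -val_eqE /=.
case: ifP => oa; case: ifP => ob.
- rewrite block_mxEdr mxE; case: eqP; rewrite ?mulr0 //; lia.
- rewrite block_mxEdl !mxE -val_eqE /= mulN1r; congr (- (nat_of_bool _)%:R).
  by apply/eqP/eqP; lia.
- rewrite block_mxEur !mxE -val_eqE /= mul1r; congr ((nat_of_bool _)%:R).
  by apply/eqP/eqP; lia.
- rewrite block_mxEul mxE; case: eqP; rewrite ?mulr0 //; lia.
Qed.

Lemma pform_conj : pform = perm_mx pairing *m omega g *m (perm_mx pairing)^T.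
Proof.
by apply/matrixP => a b; rewrite -row_permE tr_perm_mx -col_permE !mxE.
Qed.

Lemma pform_anti : pform^T = - pform.
Proof.
have E x y : pform x y = omega g (pairing x) (pairing y) by rewrite mxE.
by apply/matrixP => a b; rewrite mxE [RHS]mxE !E; exact: omega_anti.
Qed.

(** Symplectic transvections: the linear terms in [t] cancel by antisymmetry, and the quadratic one
    contains [u^T J u = 0]. *)
Lemma transvection_pform (u : 'cV[rat]_d) t :
  let M := 1%:M + t *: (u *m u^T *m pform) in M^T *m pform *m M = pform.
Proof.
set S := u *m u^T; move=> M.
have Jt := pform_anti.
have uJu : u^T *m pform *m u = 0.
  apply/matrixP => i j; rewrite !ord1 [RHS]mxE.
  have : (u^T *m pform *m u)^T = - (u^T *m pform *m u).
    by rewrite !trmx_mul trmxK Jt mulNmx mulmxN mulmxA.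
  move/matrixP => /(_ 0 0); rewrite mxE [RHS]mxE => /eqP.
  by rewrite -subr_eq0 opprK -mulr2n -mulr_natr mulf_eq0 pnatr_eq0 orbF => /eqP.
have SJS : S *m pform *m S = 0.
  have -> : S *m pform *m S = u *m (u^T *m pform *m u) *m u^T by rewrite /S !mulmxA.
  by rewrite uJu mulmx0 mul0mx.
have St : S^T = S by rewrite /S trmx_mul trmxK.
have MT : M^T = 1%:M + t *: (S *m pform)^T.
  by apply/matrixP => i j; rewrite !mxE eq_sym.
rewrite MT trmx_mul Jt St mulNmx /M.
rewrite !mulmxDl mul1mx !mulmxDr mulmx1 !scalerN !mulNmx.
rewrite -!scalemxAl -!scalemxAr !scalerA.
have -> : pform *m S *m pform *m (S *m pform) = 0.
  have -> : pform *m S *m pform *m (S *m pform) = pform *m (S *m pform *m S) *m pform.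
    by rewrite !mulmxA.
  by rewrite SJS mulmx0 mul0mx.
rewrite scaler0 oppr0 addr0 mulmx1 !mulmxA.
by rewrite addrK.
Qed.
End PairedBasis.

(** Terms with equal index are merged, leaving one component for each index. *)
Lemma vspan_family (V : lmodType rat) (K : eqType) (P : K -> Prop) (F : K -> V -> Prop) x :
  (forall nu, vsub (F nu)) -> vspan (fun x => exists2 nu, P nu & F nu x) x ->
  exists (L : seq K) (X : K -> V),
    [/\ uniq L, forall nu, nu \in L -> P nu /\ F nu (X nu) & x = \sum_(nu <- L) X nu].
Proof.
move=> Fs [s [sP ->]]; elim: s sP => [|[c u] s IH] sP.
  by exists [::], (fun _ => 0); split=> //; rewrite !big_nil.
have [|L [X [uL LP e]]] := IH; first by move=> p ps; apply: sP; rewrite inE ps orbT.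
have [nu Pnu Fu] := sP (c, u) (mem_head _ _).
pose X' mu := if mu == nu then c *: u + (if nu \in L then X nu else 0) else X mu.
have FX' : F nu (X' nu).
  rewrite /X' eqxx; have [F0 FD] := Fs nu; apply: FD => //.
  by case: ifP => // /LP [].
rewrite big_cons /= e.
case nL: (nu \in L).
  exists L, X'; split=> // [mu mL|].
    by case: (eqVneq mu nu) => [->//|ne]; rewrite /X' (negPf ne); apply: LP.
  rewrite (bigD1_seq nu) // [in RHS](bigD1_seq nu) //= {1}/X' eqxx nL addrA.
  by congr (_ + _); apply: eq_bigr => mu /negPf ne; rewrite /X' ne.
exists (nu :: L), X'; split=> [|mu|]; first by rewrite /= nL.
  rewrite inE => /orP [/eqP -> //|mL]; have [Pm Fm] := LP mu mL; split=> //.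
  by rewrite /X'; case: eqP => [em|//]; rewrite em nL in mL.
rewrite big_cons {1}/X' eqxx nL addr0; congr (_ + _).
apply: eq_big_seq => mu mL; rewrite /X'; case: eqP => // em.
by rewrite em nL in mL.
Qed.

(** * Isotypic components *)

Section Isotypic.
Context (d : nat).
Local Notation T := (tensor d).
Implicit Types (x y : T) (U W : T -> Prop) (lam a b : seq nat).

Lemma schur_frame lam n x : sumn lam = n -> schur lam x <-> schurS (tframe d n) lam x.
Proof. by move=> <-; exact: schurE. Qed.

Lemma isotypic_homog lam n x : sumn lam = n -> isotypic lam x -> homog n x.
Proof.
move=> <-; move: x; apply: vspan_le; first exact: homog_sub.
by move=> x [W [_ Wh _ Wx]]; apply: Wh.
Qed.

Lemma isotypic_gl_submod lam : gl_submod (@isotypic d lam).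
Proof.
split; first exact: vspan_sub.
move=> M uM; apply: vspan_le; first exact: (sub_pre (gl_act_lin M) (vspan_sub _)).
move=> x [W [[Ws Wm] Wh iW Wx]]; apply: vspan_mem; exists W; split=> //.
exact: Wm.
Qed.

Lemma gl_iso_frame lam n W f : sumn lam = n -> gl_submod W ->
  (forall y, W y -> homog (sumn lam) y) ->
  (forall (a : rat) x y, schur lam x -> schur lam y -> f (a *: x + y) = a *: f x + f y) ->
  (forall M, M \in unitmx -> forall x, schur lam x -> f (gl_act M x) = gl_act M (f x)) ->
  (forall x, schur lam x -> W (f x)) ->
  gsub (tframe d n) W /\ is_hom (tframe d n) (schurS (tframe d n) lam) f.
Proof.
move=> hn mW Wh fl fm fW; rewrite hn in Wh.
have hS x : schur lam x -> homog n x by move=> /schur_homog; rewrite hn.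
split; first exact/(gl_submodE (n := n)).
have [gl gm gh] := gl_iso_is_hom hS Wh fl fm fW.
have E x := schur_frame x hn.
by split=> [c x y /E Sx /E Sy|M uM x /E Sx|x /E Sx]; [exact: gl|exact: gm|exact: gh].
Qed.

(** Both components are spanned by copies of Schur modules, to which [schur_orth] applies. *)
Lemma isotypic_orth a b n x y : young_diagram a -> young_diagram b ->
  sumn a = n -> sumn b = n -> a <> b -> isotypic a x -> isotypic b y ->
  ip (tframe d n) x y = 0.
Proof.
move=> ya yb na nb ab ix iy; move: x ix; apply: vspan_le.
  exact: (sub_zero (ip_linl (tframe d n) y)).
move=> x [W [mW Wh [f [fl fm fW _ fs]] Wx]]; have [gW hf] := gl_iso_frame na mW Wh fl fm fW.
move: y iy; apply: vspan_le; first exact: (sub_zero (ip_linr (tframe d n) x)).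
move=> y [W' [mW' Wh' [f' [fl' fm' fW' fi' fs']] Wy]].
have [gW' hf'] := gl_iso_frame nb mW' Wh' fl' fm' fW'.
have Ea z := schur_frame z na; have Eb z := schur_frame z nb.
rewrite ipC; apply: (@schur_orth _ _ _ (tframe d n) b a f' f W' W) => //.
- by move=> ba; apply: ab.
- by move=> z /Eb Sz; apply: fi'.
- by move=> z /fs' [u /Eb Su <-]; exists u.
- by move=> z /fs [u /Ea Su <-]; exists u.
Qed.

Lemma direct_isotypic n a x : young_diagram a -> sumn a = n -> isotypic a x ->
  dsum (fun b => [/\ young_diagram b, sumn b = n & b <> a]) (@isotypic d) x -> x = 0.
Proof.
move=> ya na ix sx; have /homogE hx := isotypic_homog na ix.
apply: (ip_eq0 hx).
suff: forall y, dsum (fun b => [/\ young_diagram b, sumn b = n & b <> a]) (@isotypic d) y ->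
  ip (tframe d n) x y = 0 by apply.
apply: vspan_le; first exact: (sub_zero (ip_linr (tframe d n) x)).
by move=> y [b [yb nb ba] iy]; apply: (isotypic_orth ya yb na nb) => // ab; apply: ba.
Qed.

End Isotypic.

Lemma sub_scaleN1 (V : lmodType rat) (u v : V) : u - v = (-1) *: v + u.
Proof. by rewrite scaleN1r addrC. Qed.

Lemma conj_form n (w J M Q : 'M[rat]_n) : Q *m Q^T = 1%:M -> Q^T *m Q = 1%:M ->
  J = Q *m w *m Q^T -> M^T *m J *m M = J ->
  (Q^T *m M *m Q)^T *m w *m (Q^T *m M *m Q) = w.
Proof.
move=> QQ' QQ eJ MJ; rewrite !trmx_mul trmxK.
have -> : Q^T *m (M^T *m Q) *m w *m (Q^T *m M *m Q) = Q^T *m (M^T *m (Q *m w *m Q^T) *m M) *m Q.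
  by rewrite !mulmxA.
by rewrite -eJ MJ eJ !mulmxA QQ mul1mx -mulmxA QQ mulmx1.
Qed.

(** Polarisation of [u u^T] at [e_a + e_b]; the form sends [delta_mx a b] to
    [delta_mx a (partner b)] up to the sign [psign b]. *)
Lemma form_polar g (V : lmodType rat) (f : 'M[rat]_(g + g) -> V) : lin f ->
  (forall u : 'cV[rat]_(g + g), f (u *m u^T *m pform g) = 0) ->
  forall a b : 'I_(g + g), psign b *: f (delta_mx a (partner b)) +
    psign a *: f (delta_mx b (partner a)) = 0.
Proof.
move=> fl kill a b.
have dE (i j : 'I_(g + g)) : delta_mx i j *m pform g = psign j *: delta_mx i (partner j).
  apply/matrixP => p q; rewrite !mxE (bigD1 j) //= big1 => [|r rj]; last first.
    by rewrite mxE (negPf rj) andbF mul0r.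
  rewrite pformE addr0 !mxE eqxx andbT mulrCA; congr (_ * _).
  by rewrite -natrM mulnb.
pose e (i : 'I_(g + g)) : 'cV[rat]_(g + g) := delta_mx i 0.
have := kill (e a + e b); have := kill (e a); have := kill (e b).
rewrite linearD /= !mulmxDl !mulmxDr /e !trmx_delta !mul_delta_mx !mulmxDl !dE.
rewrite !(linD fl) !(linZ fl) => -> ->.
by rewrite addr0 add0r addrC.
Qed.

(** * Inclusions for the bracket *)

Section BracketInclusion.
Context (g : nat) (i0 : 'I_(g + g)).
Local Notation d := (g + g)%N.
Local Notation T := (tensor d).
Implicit Types (x y s t : T) (lam mu nu : seq nat).

Lemma Htilde_gl_submod k lam : gl_submod (@Htilde g k lam).
Proof.
have [Is Im] := @isotypic_gl_submod d lam; have [Hs Hm] := hder_gl_submod i0 k.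
split; first exact: sub_and.
by move=> M uM x [Ix Hx]; split; [apply: Im|apply: Hm].
Qed.

Lemma sp_inv_sub : vsub (@sp_inv g).
Proof.
apply: sub_all => M; apply: sub_imp.
exact: (sub_eq (gl_act_lin M) (@lin_id d)).
Qed.

Lemma dsum_gl_submod (P : seq nat -> Prop) (F : seq nat -> T -> Prop) :
  (forall nu, gl_submod (F nu)) -> gl_submod (dsum P F).
Proof.
move=> Fm; split; first exact: vspan_sub.
move=> M uM; apply: vspan_le; first exact: (sub_pre (gl_act_lin M) (vspan_sub _)).
move=> x [nu Pnu Fx]; apply: vspan_mem; exists nu => //.
by have [_ m] := Fm nu; apply: m.
Qed.

Lemma dsum_le (P Q : seq nat -> Prop) (F G : seq nat -> T -> Prop) :
  (forall nu x, P nu -> F nu x -> Q nu /\ G nu x) -> forall x, dsum P F x -> dsum Q G x.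
Proof.
move=> h; apply: vspan_le; first exact: vspan_sub.
by move=> x [nu Pnu Fx]; have [Q1 G1] := h nu x Pnu Fx; apply: vspan_mem; exists nu.
Qed.

(** Isotypic elements are sums of images of Schur modules, so a nonzero value would occur on one
    pair of images, and [bracket_condC] would yield (C). *)
Lemma not_condC_kills k l lam mu nu f : sumn lam = k.+2 -> sumn mu = l.+2 ->
  sumn nu = (k + l).+2 -> ~ condC g lam mu nu ->
  ghom (tframe d (k + l).+2) f -> (forall x, homog (k + l).+2 x -> schur nu (f x)) ->
  forall s t, isotypic lam s -> isotypic mu t -> f (hbracket s t) = 0.
Proof.
move=> lk ml nn nC gf fS s t is_ it; have [fl _ _] := gf.
(* A GL-map defined on a Schur module extends to the tensor power by composition with the orthogonal
   projection. *)
have ext (c : seq nat) n W h : sumn c = n -> gl_submod W ->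
    (forall y, W y -> homog (sumn c) y) ->
    (forall (a : rat) x y, schur c x -> schur c y -> h (a *: x + y) = a *: h x + h y) ->
    (forall M, M \in unitmx -> forall x, schur c x -> h (gl_act M x) = gl_act M (h x)) ->
    (forall x, schur c x -> W (h x)) ->
    exists G, ghom (tframe d n) G /\ forall x, schur c x -> G x = h x.
  move=> hn mW Wh hl hm hW; have [gW hh] := gl_iso_frame hn mW Wh hl hm hW.
  have gS := schurS_gsub (tframe d n) c; have [Ss Sh _] := gS.
  have [F pF] := proj_exists Ss Sh; have [Fl FS Fo] := pF.
  have [h1 h2 h3] := hh.
  exists (fun x => h (F x)); split; last first.
    by move=> x /(schur_frame x hn) Sx; rewrite (proj_self Ss Sh pF Sx).
  split=> [a x y|M x hx|x hx]; last exact: h3.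
    by rewrite Fl; apply: h1.
  by rewrite (proj_gact M x gS pF) (on_gact gS h1 h2 h3).
move: s is_; apply: vspan_le; first exact: (sub_zero (lin_comp fl (hbracket_linl t))).
move=> _ [W [mW Wh [h [hl hm hW _ hs]] /hs [s Ss <-]]].
have [g1 [gg1 e1]] := ext lam k.+2 W h lk mW Wh hl hm hW.
move: t it; apply: vspan_le; first exact: (sub_zero (lin_comp fl (hbracket_linr _))).
move=> _ [W' [mW' Wh' [h' [hl' hm' hW' _ hs']] /hs' [t St <-]]].
have [g2 [gg2 e2]] := ext mu l.+2 W' h' ml mW' Wh' hl' hm' hW'.
rewrite -(e1 s Ss) -(e2 t St); apply: NNPP => ne; apply: nC.
exact: (bracket_condC i0 lk ml nn gf fS gg1 gg2 Ss St ne).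
Qed.

Lemma isotypic_img n c f x : sumn c = n -> ghom (tframe d n) f ->
  injon (schurS (tframe d n) c) f -> schurS (tframe d n) c x -> isotypic c (f x).
Proof.
move=> hn gf fi Sx; have gS := schurS_gsub (tframe d n) c.
have gI := is_hom_img gS (ghom_is_hom gS gf); have [_ Ih _] := gI.
have [fl fc fh] := ghomP gf.
have Shom z : schurS (tframe d n) c z -> homog n z by move=> /(schurS_rsym) [/homogE].
have Ihom y : img (schurS (tframe d n) c) f y -> homog n y by move=> /Ih /homogE.
apply: vspan_mem; exists (img (schurS (tframe d n) c) f); split.
- exact/(gl_submodE Ihom).
- by rewrite hn.
- have E z := schur_frame z hn; exists f; split.
  + by move=> a y z _ _; exact: fl.
  + by move=> M _ z /E /Shom hz; exact: fc.
  + by move=> z /E Sz; exists z.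
  + by move=> z /E Sz; exact: fi.
  + by move=> _ [z Sz <-]; exists z => //; exact/E.
- by exists x.
Qed.

(** Were the component [r] orthogonal to [Bsub] nonzero, it would pair with a copy of some Schur
    module [c] inside [hder] and orthogonal to [Bsub]. If [c] satisfies (C) the copy lies in [Bsub],
    so it is zero; otherwise [not_condC_kills], applied to the adjoint of the embedding, makes the
    pairing zero. *)
Lemma hbracket_Bsub k l lam mu s t : sumn lam = k.+2 -> sumn mu = l.+2 ->
  Htilde k lam s -> Htilde l mu t -> Bsub k l lam mu (hbracket s t).
Proof.
move=> lk ml [is_ hs] [it ht]; set n := (k + l).+2; set x0 := hbracket s t.
have hx0 : hder (k + l) x0 by exact: hder_hbracket.
have mB : gl_submod (@Bsub g k l lam mu) by apply: dsum_gl_submod => nu; exact: Htilde_gl_submod.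
have Bd x : Bsub k l lam mu x -> hder (k + l) x.
  by move: x; apply: vspan_le; [exact: hder_sub|move=> x [nu _ []]].
have Bh x : Bsub k l lam mu x -> homog n x by move=> /Bd /hder_homog.
have gB : gsub (tframe d n) (@Bsub g k l lam mu) by apply/gl_submodE.
have gH : gsub (tframe d n) (@hder g (k + l)).
  by apply/gl_submodE; [exact: hder_homog|exact: (hder_gl_submod i0)].
have [Bs Bth _] := gB; have [F pF] := proj_exists Bs Bth; have [Fl FB Fo] := pF.
have gY := gsub_and gH (perp_gsub gB).
pose r := x0 - F x0.
have Yr : hder (k + l) r /\ perp (tframe d n) (@Bsub g k l lam mu) r.
  have hr : hder (k + l) r by exact (subB (@hder_sub g _) hx0 (Bd _ (FB x0))).
  split; first exact: hr.
  split; first by apply/homogE; exact (hder_homog hr).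
  by move=> u Bu; apply: Fo.
have [/subr0_eq ->//|nr] := classic (r = 0).
have [c [f [[yc hn hc] gf fY fi [x Sx rx]]]] := schur_pairing gY Yr nr.
have [hfx pfx] := fY x Sx.
have [fl fc fh] := gf.
case: rx; case: (classic (condC g lam mu c)) => [C|nC].
  have Bfx : Bsub k l lam mu (f x).
    apply: vspan_mem; exists c; first by split.
    exact (conj (isotypic_img hn gf fi Sx) hfx).
  by rewrite (perp_self Bfx pfx) ip0r.
have gS := schurS_gsub (tframe d n) c; have [Ss Sh _] := gS.
have [P pP] := proj_exists Ss Sh; have [Pl PS Po] := pP.
have gPf : ghom (tframe d n) (fun z => P (adj (tframe d n) f z)).
  by apply: ghom_comp; [exact: ghom_proj gS pP|exact: adj_ghom].
have z0 : P (adj (tframe d n) f x0) = 0.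
  apply: (not_condC_kills lk ml hn nC gPf) => // z _; exact/(schur_frame _ hn).
have /homogE hx0h := hder_homog hx0.
have : ip (tframe d n) x0 (f x) = 0.
  by rewrite -ip_adj //; [rewrite -(proj_ip pP) // z0 ip0l|exact: Sh].
rewrite ipBl => ->; rewrite sub0r ipC; have [_ o] := pfx.
by rewrite o // oppr0.
Qed.

(** The differences [M X - X] stay in their isotypic components and sum to zero; by orthogonality
    each vanishes. *)
Lemma sp_inv_component n (L : seq (seq nat)) (X : seq nat -> T) :
  uniq L -> (forall nu, nu \in L -> [/\ young_diagram nu, sumn nu = n & isotypic nu (X nu)]) ->
  sp_inv (\sum_(nu <- L) X nu) -> forall nu, nu \in L -> sp_inv (X nu).
Proof.
move=> uL LP inv nu nL M MO; have [yn sn in_] := LP nu nL.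
have h mu : mu \in L -> homog n (X mu).
  by move=> /LP [_ sm im]; apply: isotypic_homog im.
have gI mu : sumn mu = n -> gsub (tframe d n) (@isotypic d mu).
  move=> sm; apply/gl_submodE; last exact: isotypic_gl_submod.
  by move=> x; exact: isotypic_homog.
pose Y mu := gl_act M (X mu) - X mu.
have YI mu : mu \in L -> isotypic mu (Y mu).
  move=> mL; have [_ sm im] := LP mu mL; have [Is _ _] := gI mu sm.
  apply: (subB Is) => //; have /homogE hX := h mu mL.
  by rewrite (gl_actE M hX); apply: (gsub_gact (gI mu sm)).
have Y0 : \sum_(mu <- L) Y mu = 0.
  have e := inv M MO; rewrite (lin_sum (gl_act_lin M)) in e.
  by apply: (etrans (sumrB _ _ _ _)); rewrite e subrr.
apply: subr0_eq; have /homogE hY := isotypic_homog sn (YI nu nL).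
apply: (ip_eq0 hY).
have := ip0r (tframe d n) (Y nu); rewrite -Y0 (lin_sum (ip_linr _ _)) (bigD1_seq nu) //=.
rewrite big_seq_cond big1 ?addr0 // => mu /andP [mL /eqP ne].
have [ym sm _] := LP mu mL.
by apply: (isotypic_orth yn ym sn sm) => //; [move=> e; apply: ne|exact: YI|exact: YI].
Qed.

(** [x] pairs with some copy [W] of the Schur module, and its projection to [W] pulls back to a
    nonzero invariant there. In the interleaved basis the polarised transvections of sp kill it, and
    [schurS_sp] makes the rows equal in pairs. *)
Lemma sp_inv_shape n nu x : young_diagram nu -> sumn nu = n -> isotypic nu x ->
  sp_inv x -> x <> 0 -> exists c, nu = ydelta c.
Proof.
move=> yn sn ix invx nx; have /homogE hx := isotypic_homog sn ix.
have [W [mW Wh [f [fl fm fW fi fs]] [w Ww xw]]] : exists W, [/\ gl_submod W,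
    forall y, W y -> homog (sumn nu) y, gl_iso (schur nu) W
    & exists2 w, W w & ip (tframe d n) x w <> 0].
  apply: NNPP => no; apply: nx; apply: (ip_eq0 hx).
  suff: forall y, isotypic nu y -> ip (tframe d n) x y = 0 by apply.
  apply: vspan_le; first exact: (sub_zero (ip_linr (tframe d n) x)).
  move=> y [W [mW Wh iW Wy]]; apply: NNPP => ne; apply: no; exists W; split=> //.
  by exists y.
have [gW [hl hm hh]] := gl_iso_frame sn mW Wh fl fm fW.
have E z := schur_frame z sn; have gS := schurS_gsub (tframe d n) nu; have [Ss Sh _] := gS.
have [Ws Wth _] := gW; have [F pF] := proj_exists Ws Wth; have [Fl FW Fo] := pF.
have [z /E Sz fz] := fs _ (FW x).
have nz : z <> 0.
  by move=> z0; apply: xw; rewrite -(proj_ip pF) // -fz z0 (on0 gS hl) ip0l.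
have inv_z M : M^T *m omega g *m M = omega g -> gact (tframe d n) M z = z.
  move=> MO; apply: subr0_eq; have SM := gsub_gact gS M Sz.
  apply: fi; first by apply/E; apply: (subB Ss).
  have -> : f (gact (tframe d n) M z - z) = gact (tframe d n) M (f z) - f z.
    exact (etrans (congr1 f (sub_scaleN1 _ _)) (etrans (hl _ _ _ Sz SM)
      (etrans (congr1 (+%R ((-1) *: f z)) (on_gact gS hl hm hh M Sz)) (esym (sub_scaleN1 _ _))))).
  rewrite fz -(proj_gact M x gW pF) -(gl_actE M hx) invx //; exact: subrr.
(* Passage to the interleaved symplectic basis. *)
pose Q := perm_mx (@pairing g) : 'M[rat]_d.
have QQ : Q^T *m Q = 1%:M by rewrite /Q tr_perm_mx -perm_mxM mulVg perm_mx1.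
pose y := gact (tframe d n) Q z.
have Sy : schurS (tframe d n) nu y by apply: gsub_gact.
have hz := Sh z Sz; have hy := Sh y Sy.
have ny : y <> 0.
  move=> y0; apply: nz; rewrite -(gact1 hz) -QQ -gact_comp -/y y0.
  exact: (lin0 (gact_lin _ _)).
have inv_y M : M^T *m pform g *m M = pform g -> gact (tframe d n) M y = y.
  move=> MJ; have QQ' : Q *m Q^T = 1%:M by rewrite /Q tr_perm_mx -perm_mxM mulgV perm_mx1.
  have eM : M *m Q = Q *m (Q^T *m M *m Q) by rewrite !mulmxA QQ' mul1mx.
  have iM := inv_z _ (conj_form QQ' QQ (@pform_conj g) MJ).
  exact (etrans (gact_comp _ _ _ _) (etrans (congr1 (fun A => gact _ A z) eM)
    (etrans (esym (gact_comp _ _ _ _)) (congr1 (gact _ Q) iM)))).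
(* The derivation is a combination of transvections with coefficients of sum zero, and each
   transvection fixes [y]. *)
have kill (u : 'cV[rat]_d) : lmx (tframe d n) (u *m u^T *m pform g) y = 0.
  have [c c0 e] := lmx_gact (tframe d n); rewrite (e _ y hy).
  rewrite (eq_bigr (fun i => c i *: y)); first by rewrite -scaler_suml c0 scale0r.
  by move=> i _; exact (congr1 ( *:%R (c i)) (inv_y _ (transvection_pform u _))).
have lX := lmx_linX (tframe d n) y.
have polar := form_polar lX kill.
have hc : (size nu <= d)%N.
  by have /andP [_ n0] := yn; exact: (schurS_size n0 sn Sy ny).
have eqn := schurS_sp yn sn hc (@partnerK g) (fun a => _) (@psign_partner g)
  (@partner_lt_or g) Sy ny polar.
apply: ydelta_of; first by case/andP: yn.
move=> i; case: (ltnP i.*2 d) => lt; last first.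
  by rewrite !nth_default //; [apply: leqW|]; apply: leq_trans hc lt.
have := eqn _ (Ordinal lt) => /=; rewrite odd_double /= => -> //.
by move=> a; rewrite /psign signr_eq0.
Qed.
End BracketInclusion.

(** * Invariant part, directness and coordinates *)

Section Components.
Context (g : nat) (i0 : 'I_(g + g)) (k l : nat) (lam mu : seq nat).
Hypotheses (hlam : sumn lam = k.+2) (hmu : sumn mu = l.+2).
Local Notation T := (tensor (g + g)).
Implicit Types (x y s t : T) (nu : seq nat).

Lemma bracket_Bsub x :
  bracket_span (@Htilde g k lam) (@Htilde g l mu) x -> Bsub k l lam mu x.
Proof.
move: x; apply: vspan_le; first exact: vspan_sub.
by move=> _ [s [t [Hs Ht ->]]]; exact: (hbracket_Bsub i0).
Qed.

Lemma Bsub_hder x : Bsub k l lam mu x -> hder (k + l) x.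
Proof. by move: x; apply: vspan_le; [exact: hder_sub|move=> x [nu _ []]]. Qed.

Lemma Ssub_hder x : Ssub k l lam mu x -> hder (k + l) x /\ sp_inv x.
Proof.
move: x; apply: vspan_le; first exact: sub_and (@hder_sub g _) (@sp_inv_sub g).
by move=> x [nu _ [[]]].
Qed.

Lemma sumn_ydelta2 nu n : (2 * sumn nu)%N = n -> sumn (ydelta nu) = n.
Proof. by rewrite sumn_ydelta. Qed.

(** Each isotypic component of [x] in [Bsub] is again Sp-invariant, hence zero or of type
    [ydelta c]. *)
Lemma bracket_Ssub x : bracket_span (@Htilde g k lam) (@Htilde g l mu) x -> sp_inv x ->
  Ssub k l lam mu x.
Proof.
move=> /bracket_Bsub Bx invx.
have [L [X [uL LP e]]] := vspan_family (fun nu => proj1 (Htilde_gl_submod i0 (k + l) nu)) Bx.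
have inv : forall nu, nu \in L -> sp_inv (X nu).
  apply: (sp_inv_component (n := (k + l).+2)) => // [nu /LP [[yn sn _] [im _]]|] //.
  by rewrite -e.
rewrite e; apply: sub_lin_in; first exact: vspan_sub.
move=> nu nL; have [[yn sn C] Hn] := LP nu nL; have invn := inv nu nL.
have [->|nX] := classic (X nu = 0); first exact: (proj1 (vspan_sub _)).
have [c ec] := sp_inv_shape yn sn (proj1 Hn) invn nX; rewrite ec in yn sn C Hn invn *.
apply: vspan_mem; exists c; last exact (conj Hn invn).
split; [by rewrite -young_ydelta|by rewrite -sumn_ydelta|exact: C].
Qed.

Lemma Bsub_direct : direct (@Bindex g k l lam mu) (@Htilde g (k + l)).
Proof.
move=> nu x [yn sn _] [ix _] sx; apply: (direct_isotypic yn sn ix).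
by move: x sx {ix}; apply: dsum_le => a x [[ya sa _] ne] [ia _].
Qed.

Lemma Ssub_direct : direct (@Sindex g k l lam mu) (@Hsp g (k + l)).
Proof.
move=> nu x [yn sn _] [[ix _] _] sx.
have ynd : young_diagram (ydelta nu) by rewrite young_ydelta.
apply: (direct_isotypic ynd (sumn_ydelta2 sn) ix).
move: x sx {ix}; apply: vspan_le; first exact: vspan_sub.
move=> x [a [[ya sa _] ne] [[ia _] _]]; apply: vspan_mem; exists (ydelta a) => //.
split; [by rewrite young_ydelta|exact: sumn_ydelta2|by move=> /ydelta_inj].
Qed.

(** [y = x - (x - y)], where neither [x] nor [x - y] involves the type [ydelta nu], while [y] is of
    that type. *)
Lemma coord_eq0 nu x y : young_diagram nu -> (2 * sumn nu)%N = (k + l).+2 ->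
  ~ @Sindex g k l lam mu nu -> Ssub k l lam mu x -> Hsp_coord (k + l) nu x y -> y = 0.
Proof.
move=> yn sn nS Sx [[[iy _] _] dy].
have ynd : young_diagram (ydelta nu) by rewrite young_ydelta.
apply: (direct_isotypic ynd (sumn_ydelta2 sn) iy).
have vD := vspan_sub (fun x => exists2 b, [/\ young_diagram b, sumn b = (k + l).+2 &
  b <> ydelta nu] & @isotypic (g + g) b x).
rewrite -(subKr x y); apply: (subB vD).
- move: x Sx {dy}; apply: vspan_le => //.
  move=> x [a Sa [[ia _] _]]; have [ya sa _] := Sa; apply: vspan_mem; exists (ydelta a) => //.
  split; [by rewrite young_ydelta|exact: sumn_ydelta2|].
  by move=> /ydelta_inj ea; apply: nS; rewrite -ea.
- move: (x - y) dy; apply: vspan_le => //.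
  move=> z [a [ya sa _ ne] [[ia _] _]]; apply: vspan_mem; exists (ydelta a) => //.
  split; [by rewrite young_ydelta|exact: sumn_ydelta2|by move=> /ydelta_inj].
Qed.

Lemma condC_height nu : young_diagram lam -> young_diagram mu -> young_diagram nu ->
  sumn nu = (k + l).+2 -> condC g lam mu nu ->
  (maxn (size lam) (size mu) - 2 <= size nu <= size lam + size mu)%N.
Proof.
move=> yl ym yn sn; apply: common_height => //.
by rewrite hlam hmu sn !addSn !addnS.
Qed.

End Components.

Local Close Scope ring_scope.

Theorem theorem1p3 (g k l : nat) (lam mu : seq nat)
  (hg : 0 < g)
  (hlam : young_diagram lam) (hlamk : sumn lam = k.+2)
  (hmu : young_diagram mu) (hmul : sumn mu = l.+2) :
  (* (i) *)
  [/\ gl_submod (@Bsub g k l lam mu),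
      direct (@Bindex g k l lam mu) (@Htilde g (k + l)),
      forall x, @Bsub g k l lam mu x -> hder (k + l) x,
      forall x, bracket_span (@Htilde g k lam) (@Htilde g l mu) x ->
        @Bsub g k l lam mu x
    & forall nu, @Bindex g k l lam mu nu ->
        maxn (size lam) (size mu) - 2 <= size nu <= size lam + size mu]
  /\
  (* (ii) *)
  [/\ subspace (@Ssub g k l lam mu),
      direct (@Sindex g k l lam mu) (@Hsp g (k + l)),
      forall x, @Ssub g k l lam mu x -> hder (k + l) x /\ sp_inv x,
      forall x, bracket_span (@Htilde g k lam) (@Htilde g l mu) x -> sp_inv x ->
        @Ssub g k l lam mu x
    & forall nu, young_diagram nu -> 2 * sumn nu = (k + l).+2 ->
        size lam + size mu < 2 * size nu \/
        2 * size nu < maxn (size lam) (size mu) - 2 ->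
        forall x y, bracket_span (@Htilde g k lam) (@Htilde g l mu) x ->
          sp_inv x -> Hsp_coord (k + l) nu x y -> y = 0%R].
Proof.
(* A letter exists since [g] is positive; it is the default letter for words and puts [0] in the
   free Lie algebra. *)
have lt0 : 0 < g + g by rewrite addn_gt0 hg.
pose i0 := Ordinal lt0; split; split.
- by apply: dsum_gl_submod => nu; exact: (Htilde_gl_submod i0).
- exact: Bsub_direct.
- exact: Bsub_hder.
- exact: (bracket_Bsub i0 hlamk hmul).
- by move=> nu [yn sn C]; exact: (condC_height hlamk hmul hlam hmu yn sn C).
- exact: vspan_sub.
- exact: Ssub_direct.
- exact: Ssub_hder.
- exact: (bracket_Ssub i0 hlamk hmul).
- move=> nu yn sn hh x y Bx invx; apply: (coord_eq0 yn sn); last first.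
    exact: (bracket_Ssub i0 hlamk hmul Bx invx).
  move=> [_ _ C]; have ynd : young_diagram (ydelta nu) by rewrite young_ydelta.
  have := condC_height hlamk hmul hlam hmu ynd (sumn_ydelta2 sn) C.
  rewrite size_ydelta => /andP [h1 h2].
  by case: hh; rewrite ltnNge ?h1 ?h2.
Qed.
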